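(* (Associativity) Let $(V,Y(\cdot,(x,\varphi)),\mathbf{1},\tau)$ be an ($N=1$ Neveu-Schwarz) vertex operator superalgebra over $\bigwedge_*$ with odd formal variables. For $u,v,w\in V$ and $v'\in V'$, we have the following equality of rational functions: $$\iota_{12}^{-1}\langle v',Y(u,(x_1,\varphi_1))Y(v,(x_2,\varphi_2))w\rangle=\left.\left(\iota_{20}^{-1}\langle v',Y(Y(u,(x_0,\varphi_1-\varphi_2))v,(x_2,\varphi_2))w\rangle\right)\right|_{x_0=x_1-x_2-\varphi_1\varphi_2}.$$
   Context: **Grassmann algebras and conventions.** $\bigwedge_*$ denotes either $\bigwedge_L$, the exterior algebra over $\mathbb{C}$ of an $L$-dimensional complex vector space $U_L$ ($L\in\mathbb{N}$, $U_L\subset U_{L+1}$), or the direct limit $\bigwedge_\infty$ of the $\bigwedge_L$; it is $\mathbb{Z}_2$-graded, $\bigwedge_*=\bigwedge_*^0\oplus\bigwedge_*^1$. For $a\in\bigwedge_*$, its body $a_B\in\mathbb{C}$ is its component of exterior degree $0$. For a $\mathbb{Z}_2$-graded space, $\eta(v)=i$ for $v$ homogeneous of sign $i\in\{0,1\}$. $[A,B]$ denotes the supercommutator $AB-(-1)^{\eta(A)\eta(B)}BA$ for homogeneous $A,B$. Even formal variables ($x,x_0,x_1,x_2$) commute with everything. Odd formal variables ($\varphi,\varphi_1,\varphi_2$) commute with even variables and with even elements of $\bigwedge_*$ and even operators, anticommute with each other and with odd elements of $\bigwedge_*$ and odd operators, and square to zero. $\delta(x)=\sum_{n\in\mathbb{Z}}x^n$.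 Expressions such as $(x_1-x_2)^n$, $n\in\mathbb{Z}$, inside delta functions are expanded in nonnegative powers of the second variable, and functions of even and odd variables are expanded about the even variables: $(x_1-x_2-\varphi_1\varphi_2)^n=(x_1-x_2)^n-n\varphi_1\varphi_2(x_1-x_2)^{n-1}$, so $\delta\left(\frac{x_1-x_2-\varphi_1\varphi_2}{x_0}\right)=\sum_{n\in\mathbb{Z}}(x_1-x_2-\varphi_1\varphi_2)^nx_0^{-n}$, and similarly for other such expressions. $Y$ is extended linearly to series with formal-variable coefficients. **Vertex operator superalgebra over $\bigwedge_*$ with odd formal variables.** This is a $\frac12\mathbb{Z}$-graded (by weight) $\bigwedge_*$-module, also $\mathbb{Z}_2$-graded (by sign), $V=\coprod_{n\in\frac12\mathbb{Z}}V_{(n)}=\coprod_{n}V^0_{(n)}\oplus\coprod_nV^1_{(n)}=V^0\oplus V^1$, with $\dim V_{(n)}<\infty$ for all $n\in\frac12\mathbb{Z}$ and $V_{(n)}=0$ for $n$ sufficiently small (positive energy), equipped with a linear map $V\otimes V\to V[[x,x^{-1}]][\varphi]$, equivalently $V\to(\mathrm{End}\,V)[[x,x^{-1}]][\varphi]$, $v\mapsto Y(v,(x,\varphi))=\sum_{n\in\mathbb{Z}}v_nx^{-n-1}+\varphi\sum_{n\in\mathbb{Z}}v_{n-\frac12}x^{-n-1}$, where $v_n\in(\mathrm{End}\,V)^{\eta(v)}$ and $v_{n-\frac12}\in(\mathrm{End}\,V)^{(\eta(v)+1)\bmod 2}$ for $v$ of homogeneous sign, and with distinguished vectors $\mathbf{1}\in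 V^0_{(0)}$ (vacuum) and $\tau\in V^1_{(3/2)}$ (Neveu-Schwarz element), such that for $u,v\in V$: (1) (truncation) $u_nv=0$ for $n\in\frac12\mathbb{Z}$ sufficiently large; (2) $Y(\mathbf{1},(x,\varphi))=1$; (3) (creation) $Y(v,(x,\varphi))\mathbf{1}\in V[[x]][\varphi]$ and $\lim_{(x,\varphi)\to0}Y(v,(x,\varphi))\mathbf{1}=v$; (4) (Jacobi identity) for $u,v$ of homogeneous sign, $$x_0^{-1}\delta\left(\tfrac{x_1-x_2-\varphi_1\varphi_2}{x_0}\right)Y(u,(x_1,\varphi_1))Y(v,(x_2,\varphi_2))-(-1)^{\eta(u)\eta(v)}x_0^{-1}\delta\left(\tfrac{x_2-x_1+\varphi_1\varphi_2}{-x_0}\right)Y(v,(x_2,\varphi_2))Y(u,(x_1,\varphi_1))$$ $$=x_2^{-1}\delta\left(\tfrac{x_1-x_0-\varphi_1\varphi_2}{x_2}\right)Y(Y(u,(x_0,\varphi_1-\varphi_2))v,(x_2,\varphi_2));$$ (5) (Neveu-Schwarz relations) with $G(n+\frac12)=\tau_{n+1}$ and $2L(n)=\tau_{n+\frac12}$ for $n\in\mathbb{Z}$, one has for $m,n\in\mathbb{Z}$: $[L(m),L(n)]=(m-n)L(m+n)+\frac1{12}(m^3-m)\delta_{m+n,0}(\mathrm{rank}\,V)$, $[G(m+\frac12),L(n)]=(m-\frac{n-1}{2})G(m+n+\frac12)$, $[G(m+\frac12),G(n-\frac12)]=2L(m+n)+\frac13(m^2+m)\delta_{m+n,0}(\mathrm{rank}\,V)$,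 where $\mathrm{rank}\,V\in\mathbb{C}$; (6) $L(0)v=nv$ for $n\in\frac12\mathbb{Z}$ and $v\in V_{(n)}$; (7) ($G(-\frac12)$-derivative property) $\left(\frac{\partial}{\partial\varphi}+\varphi\frac{\partial}{\partial x}\right)Y(v,(x,\varphi))=Y(G(-\tfrac12)v,(x,\varphi))$. **Graded dual.** $V_{(n)}^*=\mathrm{Hom}_{\bigwedge_*}(V_{(n)},\bigwedge_* )$, $V'=\coprod_{n\in\frac12\mathbb{Z}}V_{(n)}^*$ is the graded dual, and $\langle\cdot,\cdot\rangle$ is the natural pairing of $V'$ with $\prod_nV_{(n)}$, applied coefficientwise to formal series (with the odd formal variables written to the left of the coefficients). **Rational superfunctions and expansion maps.** For even variables $x_i,x_j$, $\bigwedge_*[x_i,\varphi_1,x_j,\varphi_2]_{S'}$ is the ring obtained from $\bigwedge_*[x_i,x_j][\varphi_1,\varphi_2]$ by inverting the set $S'$ of all $a_ix_i+a_jx_j+a\varphi_1\varphi_2$ with $a_i,a_j,a\in\bigwedge_*^0$ and $(a_i)_B,(a_j)_B$ not both zero. Expanding about the even variables, $\frac{1}{a_ix_i+a_jx_j+a\varphi_1\varphi_2}=\frac{1}{a_ix_i+a_jx_j}-\frac{a\varphi_1\varphi_2}{(a_ix_i+a_jx_j)^2}$. The map $\iota_{ij}$ sends an element of this ring to a formal series in $\bigwedge_*[[x_i,x_i^{-1},x_j,x_j^{-1}]][\varphi_1,\varphi_2]$ by first expanding in the odd variables as just described and then expanding each term as a series containing at most finitely many negative powers of $x_j$ (binomial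 expansion of negative powers of linear polynomials involving both variables). $\iota_{ij}^{-1}$ denotes the inverse on the image; the claim includes that the two series lie in the images of $\iota_{12}$ and $\iota_{20}$ respectively, as rational functions whose denominators are of the form $x_1^rx_2^s(x_1-x_2-\varphi_1\varphi_2)^t$ and $x_0^rx_2^s(x_0+x_2-\varphi_1\varphi_2)^t$ ($r,s,t\in\mathbb{Z}$) respectively. *)

(* Defs.v *)
From HB Require Import structures.
From mathcomp Require Import all_boot all_order all_algebra.
From mathcomp Require Import finmap complex zify.
From mathcomp Require Import monalg.
From mathcomp Require Import boolp classical_sets functions cardinality fsbigop reals.
Set Implicit Arguments. Unset Strict Implicit. Unset Printing Implicit Defensive.
Import GRing.Theory.
Local Open Scope ring_scope.

(* Generators e_0, e_1, ... of the Grassmann algebra: the first l of them for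
   [Some l] (the exterior algebra of an l-dimensional space), all of them for
   [None] (the direct limit). *)
Definition gen_lt (L : option nat) (i : nat) : bool :=
  if L is Some l then (i < l)%N else true.
Definition gen (L : option nat) : Type := {i : nat | gen_lt L i}.
HB.instance Definition _ L := Choice.on (gen L).

(* e_S e_T = wsign S T * e_(S u T), where e_S is the product of the generators
   in S in increasing order. *)
Definition winv L (S T : {fset gen L}) : nat :=
  (\sum_(i <- S) \sum_(j <- T) (val j < val i))%N.
Definition wsign L (S T : {fset gen L}) : int :=
  if [disjoint S & T]%fset then (-1) ^+ winv S T else 0.

Lemma big_fsetU_disj (I : choiceType) (S T : {fset I}) (F : I -> nat) :
  [disjoint S & T]%fset ->
  (\sum_(i <- (S `|` T)%fset) F i = \sum_(i <- S) F i + \sum_(i <- T) F i)%N.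
Proof.
move=> dST; rewrite -big_cat; apply: perm_big; apply: uniq_perm => //.
  rewrite cat_uniq !fset_uniq andbT /=; apply/hasPn => i iT.
  by apply: contraL iT => iS; exact: (fdisjointP dST).
by move=> i; rewrite in_fsetU mem_cat.
Qed.

Lemma wsignA L (S T U : {fset gen L}) :
  wsign S T * wsign (S `|` T)%fset U = wsign T U * wsign S (T `|` U)%fset.
Proof.
rewrite /wsign fdisjointUX fdisjointXU.
case: (boolP [disjoint S & T]%fset) => dST; last by rewrite !(mul0r, mulr0).
case: (boolP [disjoint S & U]%fset) => dSU; last by rewrite !(mul0r, mulr0).
case: (boolP [disjoint T & U]%fset) => dTU; last by rewrite !(mul0r, mulr0).
rewrite /= -!exprD; congr (_ ^+ _).
have dl : winv (S `|` T)%fset U = (winv S U + winv T U)%N.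
  by rewrite /winv big_fsetU_disj.
have dr : winv S (T `|` U)%fset = (winv S T + winv S U)%N.
  rewrite /winv -big_split /=; apply: eq_bigr => i _.
  by rewrite big_fsetU_disj.
by rewrite dl dr; lia.
Qed.

Lemma wsign0l L (S : {fset gen L}) : wsign fset0 S = 1.
Proof. by rewrite /wsign fdisjoint0X /winv big_seq_fset0. Qed.

Lemma wsign0r L (S : {fset gen L}) : wsign S fset0 = 1.
Proof.
rewrite /wsign fdisjointX0 /winv big1 // => i _.
by rewrite big_seq_fset0.
Qed.

Definition grass (K : fieldType) (L : option nat) : Type := {malg K[{fset gen L}]}.
HB.instance Definition _ K L := GRing.Lmodule.on (grass K L).

Section Grass.
Variables (K : fieldType) (L : option nat).
Implicit Types a b c : grass K L.

Definition gmono (S : {fset gen L}) (x : K) : grass K L := << x *g S >>.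

Definition gmul a b : grass K L :=
  \sum_(S <- msupp a) \sum_(T <- msupp b)
    gmono (S `|` T)%fset (a@_S * b@_T *~ wsign S T).

Lemma gmullw (d1 d2 : {fset {fset gen L}}) a b :
  (msupp a `<=` d1)%fset -> (msupp b `<=` d2)%fset ->
  gmul a b = \sum_(S <- d1) \sum_(T <- d2)
    gmono (S `|` T)%fset (a@_S * b@_T *~ wsign S T).
Proof.
move=> le1 le2; rewrite /gmul (big_fset_incl _ le1) /=.
  apply/eq_bigr=> S _; apply/big_fset_incl => // T _ /mcoeff_outdom ->.
  by rewrite mulr0 mul0rz /gmono monalgU0.
move=> S _ /mcoeff_outdom aS; rewrite big1 // => T _.
by rewrite aS mul0r mul0rz /gmono monalgU0.
Qed.

Lemma gmul0l : left_zero 0 gmul.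
Proof. by move=> a; rewrite /gmul msupp0 big_seq_fset0. Qed.

Lemma gmul0r : right_zero 0 gmul.
Proof.
by move=> a; rewrite /gmul big1 // => S _; rewrite msupp0 big_seq_fset0.
Qed.

Lemma gmulDl : left_distributive gmul +%R.
Proof.
move=> a b c.
rewrite (gmullw (msuppD_le a b) (fsubset_refl _)).
rewrite (gmullw (fsubsetUl _ (msupp b)) (fsubset_refl (msupp c))).
rewrite (gmullw (fsubsetUr (msupp a) _) (fsubset_refl (msupp c))).
rewrite -big_split /=; apply/eq_bigr=> S _.
rewrite -big_split /=; apply/eq_bigr=> T _.
by rewrite mcoeffD mulrDl mulrzDl /gmono monalgUD.
Qed.

Lemma gmulDr : right_distributive gmul +%R.
Proof.
move=> c a b.
rewrite (gmullw (fsubset_refl _) (msuppD_le a b)).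
rewrite (gmullw (fsubset_refl (msupp c)) (fsubsetUl _ (msupp b))).
rewrite (gmullw (fsubset_refl (msupp c)) (fsubsetUr (msupp a) _)).
rewrite -big_split /=; apply/eq_bigr=> S _.
rewrite -big_split /=; apply/eq_bigr=> T _.
by rewrite mcoeffD mulrDr mulrzDl /gmono monalgUD.
Qed.

Lemma gmulUU S T (x y : K) :
  gmul (gmono S x) (gmono T y) = gmono (S `|` T)%fset (x * y *~ wsign S T).
Proof. by rewrite (gmullw msuppU_le msuppU_le) !big_seq_fset1 !mcoeffUU. Qed.

Lemma gmonoE a : a = \sum_(S <- msupp a) gmono S a@_S.
Proof. exact: monalgE. Qed.

Lemma gmul_suml I (r : seq I) (F : I -> grass K L) b :
  gmul (\sum_(i <- r) F i) b = \sum_(i <- r) gmul (F i) b.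
Proof. exact: (big_morph (gmul^~ b) (fun _ _ => gmulDl _ _ _) (gmul0l _)). Qed.

Lemma gmul_sumr I (r : seq I) (F : I -> grass K L) b :
  gmul b (\sum_(i <- r) F i) = \sum_(i <- r) gmul b (F i).
Proof. exact: (big_morph (gmul b) (fun _ _ => gmulDr _ _ _) (gmul0r _)). Qed.

Lemma gmulA : associative gmul.
Proof.
move=> a b c; rewrite [a]gmonoE !gmul_suml; apply: eq_bigr => S _.
rewrite [b]gmonoE gmul_suml !gmul_sumr gmul_suml; apply: eq_bigr => T _.
rewrite [c]gmonoE !gmul_sumr; apply: eq_bigr => U _.
rewrite !gmulUU fsetUA; congr gmono.
by rewrite mulrzAr mulrzAl -!mulrzA mulrA [X in _ *~ X]mulrC wsignA mulrC.
Qed.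

Lemma gmul1l : left_id (gmono fset0 1) gmul.
Proof.
move=> a; rewrite [a]gmonoE gmul_sumr; apply/eq_bigr => S _.
by rewrite gmulUU fset0U wsign0l mul1r.
Qed.

Lemma gmul1r : right_id (gmono fset0 1) gmul.
Proof.
move=> a; rewrite [a]gmonoE gmul_suml; apply/eq_bigr => S _.
by rewrite gmulUU fsetU0 wsign0r mulr1.
Qed.

Lemma gone_neq0 : gmono fset0 1 != 0.
Proof. by rewrite monalgU_eq0 oner_eq0. Qed.

HB.instance Definition _ := GRing.Zmodule_isNzRing.Build (grass K L)
  gmulA gmul1l gmul1r gmulDl gmulDr gone_neq0.

Lemma gscaleE (x : K) a : x *: a = gmono fset0 x * a.
Proof.
rewrite /GRing.mul /= {2}[a]gmonoE gmul_sumr {1}[a]gmonoE scaler_sumr.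
apply/eq_bigr => S _; rewrite gmulUU fset0U wsign0l mulr1z.
by apply/malgP => T; rewrite mcoeffZ !mcoeffU mulrnAr.
Qed.

Lemma gscaleAl (x : K) a b : x *: (a * b) = (x *: a) * b.
Proof. by rewrite !gscaleE mulrA. Qed.

Lemma gscaleAr (x : K) a b : x *: (a * b) = a * (x *: b).
Proof.
rewrite !gscaleE !mulrA; congr (_ * _).
rewrite /GRing.mul /= [a]gmonoE gmul_suml gmul_sumr.
apply/eq_bigr => S _; rewrite !gmulUU fset0U fsetU0 wsign0l wsign0r !mulr1z.
by rewrite mulrC.
Qed.

HB.instance Definition _ := GRing.Lmodule_isLalgebra.Build K (grass K L) gscaleAl.
HB.instance Definition _ := GRing.Lalgebra_isAlgebra.Build K (grass K L) gscaleAr.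

Definition geta (i : gen L) : grass K L := gmono [fset i]%fset 1.

Lemma getaC i j : geta i * geta j = - (geta j * geta i).
Proof.
rewrite /GRing.mul /= !gmulUU fsetUC -monalgUN; congr gmono.
rewrite mulr1 -mulrNz; congr (_ *~ _).
rewrite /wsign !fdisjoint1X !in_fset1 eq_sym.
have [->|/= neq_ij] := eqVneq j i; first by [].
rewrite /winv !big_seq_fset1.
have : val i != val j by rewrite (inj_eq val_inj) eq_sym.
by case: (ltngtP (val i) (val j)).
Qed.

Lemma geta_sqr i : geta i * geta i = 0.
Proof.
by rewrite /GRing.mul /= gmulUU /wsign fdisjoint1X in_fset1 eqxx /gmono
  mulr0z monalgU0.
Qed.
End Grass.

Section GrassmannParity.
Variables (K : fieldType) (L : option nat).
Implicit Types (a : grass K L) (i : bool).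

Definition gpart i a : grass K L :=
  [malg S in msupp a => if odd #|` S| == i then a@_S else 0].

Definition gconj a : grass K L := gpart false a - gpart true a.

Definition body a : K := a@_(fset0 : {fset gen L}).

(* Geometric series about the body: when [body a != 0] the soul
   [a - (body a)%:A] is nilpotent, the sum is finite and it is the inverse
   of [a].  Not used when [body a = 0]. *)
Definition ginv a : grass K L :=
  \sum_(k \in [set: nat])
     ((- 1) ^+ k * (body a)^-1 ^+ k.+1) *: (a - (body a)%:A) ^+ k.

Definition gpow a (n : int) : grass K L :=
  match n with Posz m => a ^+ m | Negz m => ginv a ^+ m.+1 end.

End GrassmannParity.

(* Coefficients of formal series in x_0, x_1, x_2, phi_1, phi_2, in doubly
   infinite powers of the even variables.  [f e (s, t)] is the coefficient of
   x^e phi_1^s phi_2^t, with the odd variables standing to the left of it. *)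
Definition evar : Type := 'I_3.
Definition x0 : evar := inord 0.
Definition x1 : evar := inord 1.
Definition x2 : evar := inord 2.

Definition eexp : Type := {ffun evar -> int}.

Definition xe (i : evar) (n : int) : eexp := [ffun k => if k == i then n else 0].

Definition oexp : Type := (bool * bool)%type.

Definition o0 : oexp := (false, false).
Definition o12 : oexp := (true, true).
(* [ovar false] is the exponent of phi_1 and [ovar true] that of phi_2. *)
Definition ovar (t : bool) : oexp := (~~ t, t).
Definition oadd (o p : oexp) : oexp := (o.1 (+) p.1, o.2 (+) p.2).
Definition opar (o : oexp) : bool := o.1 (+) o.2.

(* phi^o phi^p = osgn o p * phi^(oadd o p) *)
Definition osgn (o p : oexp) : int :=
  if (o.1 && p.1) || (o.2 && p.2) then 0 else (- 1) ^+ (o.2 && p.1).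

Definition series (M : Type) : Type := eexp -> oexp -> M.

(* The binomial coefficient n(n-1)...(n-k+1)/k! *)
Definition zbin (n : int) (k : nat) : int :=
  match n with
  | Posz m => 'C(m, k)%:Z
  | Negz m => (- 1) ^+ k * 'C(m + k, k)%:Z
  end.

Section Series.
Variables (K : fieldType) (L : option nat).
Notation A := (grass K L).

Definition scst (M : zmodType) (m : M) : series M :=
  fun e o => if (e == 0) && (o == o0) then m else 0.

(* The sum over [d] is the finitely supported sum of the library; it is only
   used on products that exist, where for each [e] finitely many terms are
   nonzero.  Moving an odd variable to the left past an odd coefficient costs
   a sign. *)
Definition smul (M : lmodType A) (f : series A) (g : series M) : series M :=
  fun e o =>
    \sum_(p : oexp * oexp | oadd p.1 p.2 == o)
      (\sum_(d \in [set: eexp])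
         (if opar p.2 then gconj (f d p.1) else f d p.1) *: g (e - d) p.2)
      *~ osgn p.1 p.2.

Definition smulA (f g : series A) : series A := @smul A^o f g.

(* (a x_i + b x_j)^n in nonnegative powers of x_j; needs [body a != 0] when n
   is negative. *)
Definition lexp (i j : evar) (a b : A) (n : int) (e : eexp) : A :=
  if (0 <= e j) && (e == xe i (n - e j) + xe j (e j)) then
    (gpow a (n - e j) * b ^+ absz (e j)) *~ zbin n (absz (e j))
  else 0.

(* (a x_i + b x_j + c phi_1 phi_2)^n, expanded about the even variables. *)
Definition lpow (i j : evar) (a b c : A) (n : int) : series A :=
  fun e o =>
    if o == o0 then lexp i j a b n e
    else if o == o12 then (c * lexp i j a b (n - 1) e) *~ n
    else 0.

(* x_k^-1 delta((x_i - x_j + c phi_1 phi_2) / (s x_k)) for s = 1 or -1: the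
   exponent of x_k singles out one term of the sum over n. *)
Definition sdelta (i j k : evar) (c : A) (s : int) : series A :=
  fun e o =>
    let n := - e k - 1 in
    lpow i j 1 (- 1) c n (e - xe k (e k)) o *~ (s ^+ absz n).

End Series.

(* Half-integers are doubled: [wt v k] is the component of [v] of weight k/2,
   and [mode u k] is the endomorphism u_(k/2). *)
Record nsdata (K : fieldType) (L : option nat) (V : lmodType (grass K L)) :=
  NSData {
    wt : V -> int -> V;
    sg : V -> bool -> V;
    mode : V -> int -> V -> V;
    vac : V;
    tau : V;
    rk : K
  }.

Section VertexOperators.
Variables (K : fieldType) (L : option nat) (V : lmodType (grass K L)).
Variable D : nsdata V.
Implicit Types (u v w : V).

(* The coefficient of phi^s x^n in Y(u,(x,phi))w. *)
Definition Ycoef u (s : bool) (n : int) w : V :=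
  mode D u (- (n + 1) * 2 - s%:Z) w.

Definition vconj v : V := sg D v false - sg D v true.

(* The operator f' such that f phi^o = phi^o f' when [b] is the parity of o. *)
Definition optwist (b : bool) (f : V -> V) : V -> V :=
  if b then fun w => vconj (f (vconj w)) else f.

Definition Yterm (i : evar) (s : bool) (o1 o2 : oexp) (S W : series V)
    (e : eexp) : V :=
  \sum_(q \in [set: eexp * int])
     optwist (opar o2) (Ycoef (S q.1 o1) s q.2) (W (e - q.1 - xe i q.2) o2).

(* Y(S,(x_i,phi))W with phi = c false phi_1 + c true phi_2, extended
   linearly to series: Y(phi^o u,(x,phi)) = phi^o Y(u,(x,phi)). *)
Definition Yser (i : evar) (c : bool -> int) (S W : series V) : series V :=
  fun e o =>
    \sum_(p : oexp * oexp | oadd p.1 p.2 == o)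
       Yterm i false p.1 p.2 S W e *~ osgn p.1 p.2
  + \sum_(t : bool)
     \sum_(p : oexp * oexp | oadd (oadd p.1 (ovar t)) p.2 == o)
       Yterm i true p.1 p.2 S W e
         *~ (c t * osgn p.1 (ovar t) * osgn (oadd p.1 (ovar t)) p.2).

Definition phi1 (t : bool) : int := (~~ t)%:Z.
Definition phi2 (t : bool) : int := t%:Z.
Definition phi12 (t : bool) : int := if t then - 1 else 1.

(* Y(u,(x_1,phi_1))Y(v,(x_2,phi_2))w *)
Definition Yprod u v w : series V :=
  Yser x1 phi1 (scst u) (Yser x2 phi2 (scst v) (scst w)).

(* Y(v,(x_2,phi_2))Y(u,(x_1,phi_1))w *)
Definition Yprod_op u v w : series V :=
  Yser x2 phi2 (scst v) (Yser x1 phi1 (scst u) (scst w)).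

(* Y(Y(u,(x_0,phi_1-phi_2))v,(x_2,phi_2))w *)
Definition Yiter u v w : series V :=
  Yser x2 phi2 (Yser x0 phi12 (scst u) (scst v)) (scst w).

(* L(n) and G(n+1/2) *)
Definition Lop (n : int) w : V := (2^-1)%:A *: mode D (tau D) (2 * n + 1) w.
Definition Gop (n : int) w : V := mode D (tau D) (2 * n + 2) w.

Definition of_sign (i : bool) v : Prop := sg D v i = v.
Definition of_weight (k : int) v : Prop := wt D v k = v.

(* V is the direct sum of its components of weight k/2 (submodules) and sign i
   (subgroups), given by their projections. *)
Record is_graded : Prop := IsGraded {
  wt_linear : forall k (a : grass K L) u v,
    wt D (a *: u + v) k = a *: wt D u k + wt D v k;
  wt_proj : forall k l v, wt D (wt D v k) l = if k == l then wt D v k else 0;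
  wt_finite : forall v, finite_set [set k | wt D v k != 0];
  wt_sum : forall v, v = \sum_(k \in [set: int]) wt D v k;
  sg_additive : forall i u v, sg D (u + v) i = sg D u i + sg D v i;
  sg_proj : forall i j v, sg D (sg D v i) j = if i == j then sg D v i else 0;
  sg_sum : forall v, v = sg D v false + sg D v true;
  sg_scale : forall i j (a : grass K L) v,
    gpart i a = a -> of_sign j v -> of_sign (i (+) j) (a *: v);
  wt_sg : forall k i v, wt D (sg D v i) k = sg D (wt D v k) i
}.

Record is_nsvosa : Prop := IsNSVosa {
  nsv_graded : is_graded;
  (* dim V_(k/2) < oo, over the Grassmann algebra: V_(k/2) is finitely
     generated *)
  nsv_fg : forall k, exists s : seq V, forall v, of_weight k v ->
    exists c : nat -> grass K L, v = \sum_(i < size s) c i *: s`_i;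
  nsv_pos : exists N : int, forall k v, k < N -> wt D v k = 0;

  (* v |-> Y(v,(x,phi)) is linear with values in the linear endomorphisms,
     with the sign rule for odd scalars *)
  nsv_addl : forall u v k w, mode D (u + v) k w = mode D u k w + mode D v k w;
  nsv_addr : forall u k v w, mode D u k (v + w) = mode D u k v + mode D u k w;
  nsv_scalel : forall a u k w,
    mode D (a *: u) k w
    = (if odd (absz k) then gconj a else a) *: mode D u k w;
  nsv_scaler : forall i u k a w, of_sign i u ->
    mode D u k (a *: w)
    = (if i (+) odd (absz k) then gconj a else a) *: mode D u k w;
  nsv_sign : forall i j u k w, of_sign i u -> of_sign j w ->
    of_sign (i (+) odd (absz k) (+) j) (mode D u k w);

  nsv_vac : of_weight 0 (vac D) /\ of_sign false (vac D);
  nsv_tau : of_weight 3 (tau D) /\ of_sign true (tau D);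

  nsv_trunc : forall u v, exists N : int, forall k, N <= k -> mode D u k v = 0;
  nsv_unit : forall v s n,
    Ycoef (vac D) s n v = if ~~ s && (n == 0) then v else 0;
  nsv_creation : forall v,
    (forall s n, n < 0 -> Ycoef v s n (vac D) = 0)
    /\ Ycoef v false 0 (vac D) = v;

  nsv_jacobi : forall i j u v w, of_sign i u -> of_sign j v ->
    forall e o,
      smul (sdelta x1 x2 x0 (- 1) 1) (Yprod u v w) e o
      - smul (sdelta x2 x1 x0 1 (- 1)) (Yprod_op u v w) e o *~ (- 1) ^+ (i && j)
      = smul (sdelta x1 x0 x2 (- 1) 1) (Yiter u v w) e o;

  nsv_LL : forall (m n : int) v,
    Lop m (Lop n v) - Lop n (Lop m v)
    = Lop (m + n) v *~ (m - n)
      + (if m + n == 0 then (12^-1 * (m ^+ 3 - m)%:~R * rk D)%:A else 0) *: v;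
  nsv_GL : forall (m n : int) v,
    Gop m (Lop n v) - Lop n (Gop m v)
    = (m%:~R - (n - 1)%:~R / 2)%:A *: Gop (m + n) v;
  nsv_GG : forall (m n : int) v,
    Gop m (Gop (n - 1) v) + Gop (n - 1) (Gop m v)
    = Lop (m + n) v *~ 2
      + (if m + n == 0 then (3^-1 * (m ^+ 2 + m)%:~R * rk D)%:A else 0) *: v;
  nsv_L0 : forall k v, of_weight k v -> Lop 0 v = (k%:~R / 2)%:A *: v;

  (* coefficients of x^n and phi x^n *)
  nsv_deriv : forall v n w,
    Ycoef v true n w = Ycoef (Gop (- 1) v) false n w
    /\ Ycoef v false (n + 1) w *~ (n + 1) = Ycoef (Gop (- 1) v) true n w
}.

(* V' as linear forms on V, extended by zero *)
Definition graded_dual (v' : {scalar V}) : Prop :=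
  exists s : seq int, forall k v, k \notin s -> of_weight k v -> v' v = 0.

Definition pairing (v' : {scalar V}) (S : series V) : series (grass K L) :=
  fun e o => v' (S e o).

End VertexOperators.

Section RationalSuperfunctions.
Variables (K : fieldType) (L : option nat).
Notation A := (grass K L).
Implicit Types (i j : evar).

Definition is_spoly i j (p : series A) : Prop :=
  finite_set [set q : eexp * oexp | p q.1 q.2 != 0]
  /\ forall e o, p e o != 0 ->
       forall k, 0 <= e k /\ (k != i -> k != j -> e k = 0).

(* (a, b, c) stands for a x_i + b x_j + c phi_1 phi_2 *)
Definition sform : Type := (A * A * A)%type.

Definition in_S (t : sform) : Prop :=
  let: (a, b, c) := t in
  [/\ gpart false a = a, gpart false b = b, gpart false c = c
    & (body a != 0) || (body b != 0)].

Definition form_ser i j (t : sform) : series A :=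
  let: (a, b, c) := t in
  fun e o =>
    if o == o0 then
      (if e == xe i 1 then a else 0) + (if e == xe j 1 then b else 0)
    else if (o == o12) && (e == 0) then c else 0.

(* A fraction is a numerator and the list of the factors of its denominator. *)
Definition sfrac : Type := (series A * seq sform)%type.

Definition is_sfrac i j (f : sfrac) : Prop :=
  is_spoly i j f.1 /\ {in f.2, forall t, in_S t}.

Definition den_ser i j (s : seq sform) : series A :=
  foldr (fun t S => smulA (form_ser i j t) S) (scst (1 : A)) s.

(* Equality in the localization (the denominators are even, hence central). *)
Definition sfrac_eq i j (f g : sfrac) : Prop :=
  exists s : seq sform, {in s, forall t, in_S t} /\
    smulA (den_ser i j s) (smulA f.1 (den_ser i j g.2))
    =2 smulA (den_ser i j s) (smulA g.1 (den_ser i j f.2)).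

(* 1 / (a x_i + b x_j + c phi_1 phi_2) with finitely many negative powers of
   x_j: when [body a = 0], [a] is nilpotent and the expansion in powers of
   a x_i is finite. *)
Definition form_inv i j (t : sform) : series A :=
  let: (a, b, c) := t in
  if body a != 0 then lpow i j a b c (- 1) else lpow j i b a c (- 1).

Definition iota i j (f : sfrac) : series A :=
  foldr (fun t S => smulA (form_inv i j t) S) f.1 f.2.

Definition is_iota_inv i j (S : series A) (f : sfrac) : Prop :=
  [/\ is_sfrac i j f, iota i j f =2 S
    & forall f', is_sfrac i j f' -> iota i j f' =2 S -> sfrac_eq i j f' f].

(* The substitution x_0 = x_1 - x_2 - phi_1 phi_2, from fractions in x_2, x_0
   (in this order) to fractions in x_1, x_2. *)
Definition subst_num (p : series A) : series A :=
  fun e o =>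
    \sum_(d \in [set: eexp])
      smulA (fun d' o' => if d' == d - xe x0 (d x0) then p d o' else 0)
            (lpow x1 x2 1 (- 1) (- 1) (d x0)) e o.

Definition subst_form (t : sform) : sform :=
  let: (a, b, c) := t in (b, a - b, c - b).

Definition subst_x0 (g : sfrac) : sfrac := (subst_num g.1, map subst_form g.2).

End RationalSuperfunctions.

(* Main.v *)
Require Import Defs.
From mathcomp Require Import all_boot all_order all_algebra.
From mathcomp Require Import finmap complex zify.
From mathcomp Require Import monalg.
From mathcomp Require Import boolp classical_sets functions cardinality fsbigop reals.
Set Implicit Arguments. Unset Strict Implicit. Unset Printing Implicit Defensive.
Import GRing.Theory.
Local Open Scope ring_scope.

(** Write N for the operator of multiplication by phi_1 phi_2, X_i for
    multiplication by x_i, and P, Q, I for the three matrix coefficients of the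
    Jacobi identity: the product, the product in the opposite order (with its
    sign) and the iterate.  After pairing with v' the identity reads
    delta1 P - delta2 Q = delta3 I.

    The X_i and N act on all doubly infinite series and commute, so no
    convergence question arises for linear superforms as operators ([formop]).
    Each delta function satisfies a recursion, for instance
    (X_1 - X_2 - N) delta1 = X_0 delta1 ([sdelta_shift], from Pascal's rule
    [lpowS]), and has a trivial coefficient in x_0^-1 ([sdelta_coef]) and a
    trivial residue in x_1 ([sdelta_residue]).  From these two facts every
    coefficient needed is found without binomial sums ([slice_neg]).

    The iterate has a pole of bounded order n in x_0.  Hence the coefficients of
    x_0^-n-1 in the Jacobi identity give
    (X_1 - X_2 - N)^n P = (X_1 - X_2 - N)^n Q ([weak_commutativity]).  The left
    side has boundedly many negative powers of x_2, the right side of x_1, and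
    the total degree is bounded above because v' only sees finitely many
    weights; so x_1^n x_2^n (X_1 - X_2 - N)^n P is a polynomial p
    ([num1_spoly]).  This uses that the modes of u shift weights as they should
    ([Ycoef_weight]), which follows from the commutator with L(0), that is from
    the Jacobi identity for tau and u ([T2_commutator]).

    For the iterate one takes residues in x_1: the residue of x_1^n delta3 I is
    (X_0 + X_2 + N)^n I, and Q does not contribute because x_1^n Q has no
    negative powers of x_1 ([residue_formop]).  So (X_0 + X_2 + N)^n I is
    expressed through P and becomes a polynomial after multiplication with
    x_0^n x_2^n.  In the prescribed denominators the sign of N is opposite, and
    (y - 2 N)^(n+1) = y^n (y - 2 (n+1) N) converts one into the other
    ([iter_formop_odd]).

    The substitution x_0 = x_1 - x_2 - phi_1 phi_2 is itself a coefficient of a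
    product with delta1 ([subst_numE]), and a series on which
    X_1 - X_2 - N acts as X_0 is determined by its residue in x_1
    ([residue_determines]).  Therefore the numerator of the iterate goes to p up
    to the factor x_1 - 2 (n+1) phi_1 phi_2 ([subst_num2]), which is the
    asserted equality of fractions.  That the fractions are the only ones with
    the given expansions holds because linear superforms are invertible on
    series with finitely many negative powers of one variable
    ([form_inv_spec], [iota_invP]). *)

(** * Finitely supported sums *)

Definition fin_supp (I : choiceType) (M : zmodType) (F : I -> M) : Prop :=
  exists s : {fset I}, forall i, F i != 0 -> i \in s.

Lemma fin_supp_sub (I : choiceType) (M N : zmodType) (F : I -> M) (G : I -> N) :
  (forall i, F i = 0 -> G i = 0) -> fin_supp F -> fin_supp G.
Proof.
move=> FG [s Hs]; exists s => i; apply: contraR => Hi.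
by apply/eqP/FG/eqP; apply: contraR Hi => /Hs.
Qed.

Lemma fin_suppW (I : choiceType) (M : zmodType) (A : set I) (F : I -> M) :
  finite_set A -> (forall i, F i != 0 -> A i) -> fin_supp F.
Proof.
move=> /finite_fsetP[s ->] FA; exists s => i /FA; by [].
Qed.

Lemma fin_suppD (I : choiceType) (M : zmodType) (F G : I -> M) :
  fin_supp F -> fin_supp G -> fin_supp (fun i => F i + G i).
Proof.
move=> [s Hs] [t Ht]; exists (s `|` t)%fset => i; rewrite in_fsetU.
case: (eqVneq (F i) 0) => [->|/Hs -> //]; rewrite add0r => /Ht ->.
exact: orbT.
Qed.

Lemma fsumE (I : choiceType) (M : zmodType) (F : I -> M) (s : {fset I}) :
  (forall i, F i != 0 -> i \in s) ->
  \sum_(i \in [set: I]) F i = \sum_(i <- s) F i.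
Proof.
by move=> Hs; apply: fsbigTE => i; apply: contraNeq; apply: Hs.
Qed.

Lemma fsumD (I : choiceType) (M : zmodType) (F G : I -> M) :
  fin_supp F -> fin_supp G ->
  \sum_(i \in [set: I]) (F i + G i)
  = \sum_(i \in [set: I]) F i + \sum_(i \in [set: I]) G i.
Proof.
move=> [s Hs] [t Ht].
rewrite !(@fsumE _ _ _ (s `|` t)%fset) ?big_split // => i; rewrite in_fsetU.
- by move/Ht => ->; rewrite orbT.
- by move/Hs => ->.
case: (eqVneq (F i) 0) => [->|/Hs -> //]; rewrite add0r => /Ht ->.
exact: orbT.
Qed.

Lemma fsum_morph (I : choiceType) (M N : zmodType) (h : M -> N) (F : I -> M) :
  (forall x y, h (x + y) = h x + h y) -> fin_supp F ->
  h (\sum_(i \in [set: I]) F i) = \sum_(i \in [set: I]) h (F i).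
Proof.
move=> hD [s Hs].
have h0 : h 0 = 0 by apply: (addrI (h 0)); rewrite -hD !addr0.
rewrite (fsumE Hs) (@fsumE _ _ (h \o F) s) ?(big_morph h hD h0) // => i /=.
by apply: contraR => /(contraR (Hs i))/eqP ->; rewrite h0.
Qed.

Lemma fsum_single (I : choiceType) (M : zmodType) (F : I -> M) (i0 : I) :
  (forall i, i != i0 -> F i = 0) -> \sum_(i \in [set: I]) F i = F i0.
Proof.
move=> H; rewrite (@fsumE _ _ _ [fset i0]%fset) ?big_seq_fset1 // => i.
by rewrite in_fset1; apply: contraNT => /H ->.
Qed.

Lemma fsum_neq0 (I : choiceType) (M : zmodType) (F : I -> M) :
  \sum_(i \in [set: I]) F i != 0 -> exists i, F i != 0.
Proof.
move=> H; apply: contrapT => nH; case/eqP: H; apply: fsbig1 => i _.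
by apply: contrapT => /eqP Fi; apply: nH; exists i.
Qed.

Lemma fsum_shift (I : zmodType) (M : zmodType) (F : I -> M) (c : I) :
  \sum_(i \in [set: I]) F (i - c) = \sum_(i \in [set: I]) F i.
Proof.
rewrite [RHS](reindex_fsbigT (fun i => i - c)) //.
by exists (fun i => i + c) => i; rewrite ?subrK ?addrK.
Qed.

Lemma fsum_reflect (I : zmodType) (M : zmodType) (F : I -> M) (c : I) :
  \sum_(i \in [set: I]) F (c - i) = \sum_(i \in [set: I]) F i.
Proof.
rewrite [RHS](reindex_fsbigT (fun i => c - i)) //.
by exists (fun i => c - i) => i; rewrite subKr.
Qed.

(** * Even elements of the Grassmann algebra *)

Section Even.
Variables (K : fieldType) (L : option nat).
Notation A := (grass K L).
Implicit Types (a b c : A) (S T : {fset gen L}).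

Definition geven a : Prop := gpart false a = a.

Lemma gpartE i a S : (gpart i a)@_S = if odd #|` S| == i then a@_S else 0.
Proof.
rewrite /gpart mcoeffE; case: (boolP (S \in msupp a)) => // /mcoeff_outdom ->.
by rewrite if_same.
Qed.

Lemma gevenP a : geven a <-> (forall S : {fset gen L}, odd #|` S| -> a@_S = 0).
Proof.
split=> [<- S oS|H]; first by rewrite gpartE oS.
by apply/malgP => S; rewrite gpartE; case: (boolP (odd _)) => // /H ->.
Qed.

Lemma gconj_even a : geven a -> gconj a = a.
Proof.
move=> ga; rewrite /gconj ga (_ : gpart true a = 0) ?subr0 //.
apply/malgP => S; rewrite gpartE mcoeff0; case: ifP => // /eqP oS.
by move/gevenP: ga => -> //; rewrite oS.
Qed.

Lemma geven0 : geven 0. Proof. by apply/gevenP => S _; rewrite mcoeff0. Qed.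

Lemma gevenD a b : geven a -> geven b -> geven (a + b).
Proof.
by move=> /gevenP ga /gevenP gb; apply/gevenP => S oS; rewrite mcoeffD ga ?gb ?addr0.
Qed.

Lemma gevenN a : geven a -> geven (- a).
Proof. by move=> /gevenP ga; apply/gevenP => S oS; rewrite mcoeffN ga ?oppr0. Qed.

Lemma gevenB a b : geven a -> geven b -> geven (a - b).
Proof. by move=> ga gb; apply/gevenD/gevenN. Qed.

Lemma gevenMz a (n : int) : geven a -> geven (a *~ n).
Proof.
move=> ga; have gn m : geven (a *+ m).
  by elim: m => [|m IH]; rewrite ?mulr0n ?mulrS; [exact: geven0|exact: gevenD].
by case: n => m; [exact: gn|exact/gevenN/gn].
Qed.

Lemma gevenZ (x : K) a : geven a -> geven (x *: a).
Proof. by move=> /gevenP ga; apply/gevenP => S oS; rewrite mcoeffZ ga ?mulr0. Qed.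

Lemma geven1 : geven 1.
Proof.
apply/gevenP => S oS; rewrite /GRing.one /= /gmono mcoeffU.
by case: eqP => // eS; rewrite -eS cardfs0 in oS.
Qed.

Lemma geven_sum I (r : seq I) (P : pred I) (F : I -> A) :
  (forall i, P i -> geven (F i)) -> geven (\sum_(i <- r | P i) F i).
Proof. by move=> H; elim/big_ind: _ => //; [exact: geven0|exact: gevenD]. Qed.

Lemma gmono_even S (x : K) : ~~ odd #|` S| -> geven (gmono S x).
Proof.
move=> eS; apply/gevenP => T oT; rewrite /gmono mcoeffU; case: eqP => // ST.
by move: eS; rewrite ST oT.
Qed.

Lemma gmonoM S T (x y : K) :
  gmono S x * gmono T y = gmono (S `|` T)%fset (x * y *~ wsign S T) :> A.
Proof. exact: gmulUU. Qed.

Lemma gmono0 S : gmono S 0 = 0 :> A. Proof. exact: monalgU0. Qed.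

Lemma gevenM a b : geven a -> geven b -> geven (a * b).
Proof.
move=> ga gb; rewrite [a]gmonoE [b]gmonoE mulr_suml.
apply: geven_sum => S _; rewrite mulr_sumr; apply: geven_sum => T _.
rewrite gmonoM; move/gevenP: ga => ga; move/gevenP: gb => gb.
case: (boolP (odd #|` S|)) => [/ga ->|eS]; first by rewrite mul0r mul0rz gmono0; exact: geven0.
case: (boolP (odd #|` T|)) => [/gb ->|eT]; first by rewrite mulr0 mul0rz gmono0; exact: geven0.
rewrite /wsign; case: (boolP [disjoint S & T]%fset) => [dST|_]; last first.
  by rewrite mulr0z gmono0; exact: geven0.
apply: gmono_even; have := cardfsUI S T.
by rewrite (eqP dST) cardfs0 addn0 => ->; rewrite oddD (negbTE eS) (negbTE eT).
Qed.

Lemma gevenX a n : geven a -> geven (a ^+ n).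
Proof. by move=> ga; elim: n => [|n IH]; [exact: geven1|rewrite exprS; exact: gevenM]. Qed.

Lemma winvC (S T : {fset gen L}) : [disjoint S & T]%fset ->
  (winv S T + winv T S = #|` S| * #|` T|)%N.
Proof.
move=> dST; rewrite /winv [X in (_ + X)%N]exchange_big -big_split /=.
rewrite (eq_big_seq (fun=> #|` T|)) ?big_const_seq ?iter_addn_0 ?count_predT; last first.
  move=> i iS; rewrite -big_split /= (eq_big_seq (fun=> 1%N)); last first.
    move=> j jT; have ij : val i != val j.
      rewrite (inj_eq val_inj); apply: contraTneq jT => <-.
      exact: (fdisjointP dST).
    by case: ltngtP ij.
  by rewrite sum1_size.
by rewrite mulnC.
Qed.

Lemma wsignC_even (S T : {fset gen L}) : ~~ odd #|` S| -> wsign S T = wsign T S.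
Proof.
move=> eS; rewrite /wsign fdisjoint_sym; case: ifP => // dST.
have H : ~~ odd (winv S T + winv T S).
  by rewrite winvC 1?fdisjoint_sym // oddM negb_and eS.
by rewrite -signr_odd -[RHS]signr_odd; move: H; rewrite oddD; do 2!case: (odd _).
Qed.

(** Even elements are central: a product of an even number of generators
    passes through every monomial without a sign. *)
Lemma geven_central a b : geven a -> a * b = b * a.
Proof.
move=> /gevenP ga; rewrite [a]gmonoE [b]gmonoE mulr_suml mulr_sumr.
apply: eq_bigr => S _; rewrite mulr_sumr mulr_suml; apply: eq_bigr => T _.
rewrite !gmonoM; case: (boolP (odd #|` S|)) => [/ga ->|eS].
  by rewrite mulr0 mul0r !mul0rz !gmono0.
by rewrite fsetUC mulrC wsignC_even.
Qed.

(** An element without body is nilpotent, even for infinitely many generators: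
    it involves only a finite set U of them, and the monomials of its n-th
    power are products of at least n elements of U. *)
Lemma body0_nilp a : body a = 0 -> exists n, a ^+ n = 0.
Proof.
move=> ba; pose U := (\bigcup_(S <- msupp a) S)%fset.
have inU S : S \in msupp a -> (S `<=` U)%fset.
  by move=> Sa; apply: (@bigfcup_sup _ _ (msupp a) S xpredT id Sa).
have step m : forall S, (a ^+ m)@_S != 0 -> (m <= #|` S|)%N /\ (S `<=` U)%fset.
  elim: m => [|m IH] S.
    rewrite expr0 /GRing.one /= /gmono mcoeffU.
    case: (eqVneq fset0 S) => [<-|_]; last by rewrite mulr0n eqxx.
    by move=> _; rewrite leq0n fsub0set.
  rewrite exprS; move: (a ^+ m) IH => y IH.
  rewrite [a]gmonoE [y]gmonoE mulr_suml raddf_sum /=.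
  rewrite big_seq => H.
  have [S1 S1a] : exists2 S1, S1 \in msupp a &
      (gmono S1 a@_S1 * (\sum_(T <- msupp y) gmono T y@_T))@_S != 0.
    apply: contrapT => nH; case/eqP: H; rewrite big1 // => T Ta.
    by apply: contrapT => /eqP HT; apply: nH; exists T.
  rewrite mulr_sumr raddf_sum /= big_seq => {}H.
  have [T Tm] : exists2 T, T \in msupp y &
      (gmono S1 a@_S1 * gmono T y@_T)@_S != 0.
    apply: contrapT => nH; case/eqP: H; rewrite big1 // => T Ta.
    by apply: contrapT => /eqP HT; apply: nH; exists T.
  rewrite gmonoM mcoeffU.
  case: (eqVneq (S1 `|` T)%fset S) => [<-|_]; last by rewrite mulr0n eqxx.
  rewrite /wsign; case: (boolP [disjoint S1 & T]%fset) => [dST _|_]; last first.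
    by rewrite mulr0z eqxx.
  have [cT TU] := IH _ (etrans (mcoeff_neq0 _ _) Tm).
  split; last by rewrite fsubUset inU.
  have := cardfsUI S1 T; rewrite (eqP dST) cardfs0 addn0 => ->.
  rewrite -add1n leq_add // cardfs_gt0.
  by apply: contraTneq S1a => ->; rewrite -mcoeff_eq0; apply/eqP.
exists #|` U|.+1; apply/malgP => S; rewrite mcoeff0; apply/eqP.
apply: contraT => /step[cS /fsubset_leq_card]; by rewrite leqNgt cS.
Qed.

Lemma bodyD a b : body (a + b) = body a + body b.
Proof. exact: mcoeffD. Qed.
Lemma bodyN a : body (- a) = - body a.
Proof. exact: mcoeffN. Qed.
Lemma bodyC (x : K) : body (x%:A : A) = x.
Proof. by rewrite /body mcoeffZ /GRing.one /= mcoeffUU mulr1. Qed.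
Lemma body1 : body (1 : A) = 1.
Proof. by rewrite /body /GRing.one /= mcoeffUU. Qed.

Section Inverse.
Variable a : A.
Hypothesis ba : body a != 0.
Let x : A := a - (body a)%:A.
Let T k : A := ((- 1) ^+ k * (body a)^-1 ^+ k.+1) *: x ^+ k.

Lemma ginv_finite : exists n, x ^+ n = 0 /\ ginv a = \sum_(k < n) T k.
Proof.
have [|n xn] := @body0_nilp x; first by rewrite bodyD bodyN bodyC subrr.
exists n; split => //; rewrite /ginv -/x (@fsumE _ _ _ [fset k in iota 0 n]%fset).
  rewrite -(big_mkord xpredT T) /index_iota subn0; apply: perm_big; apply: uniq_perm.
  - exact: fset_uniq.
  - exact: iota_uniq.
  - by move=> k; rewrite inE.
move=> k; rewrite inE mem_iota add0n leq0n /=; apply: contraNT; rewrite -leqNgt => nk.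
by rewrite -(subnKC nk) [x ^+ _]exprD xn mul0r scaler0.
Qed.

(** The geometric series telescopes. *)
Lemma mulr_ginv : a * ginv a = 1.
Proof.
have [n [xn ->]] := ginv_finite; rewrite mulr_sumr.
pose t k : A := ((- 1) ^+ k * (body a)^-1 ^+ k) *: x ^+ k.
have tE k : a * T k = t k - t k.+1.
  have e1 : body a *: T k = t k.
    by rewrite /T /t scalerA exprS mulrCA mulVKf.
  have e2 : x * T k = - t k.+1.
    by rewrite /T /t -scalerAr -exprS -scaleNr [(-1) ^+ k.+1]exprS mulN1r mulNr opprK.
  by rewrite -e1 -e2 -mulr_algl -mulrDl /x addrC subrK.
transitivity (\sum_(0 <= k < n) (t k - t k.+1)).
  by rewrite big_mkord; apply: eq_bigr => k _; exact: tE.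
rewrite (telescope_sumr_eq (fun k => - t k)) // => [|k _]; last by rewrite opprK addrC.
by rewrite /t xn scaler0 oppr0 add0r !expr0 mulr1 scale1r opprK.
Qed.

Lemma geven_ginv : geven a -> geven (ginv a).
Proof.
move=> ga; have [n [_ ->]] := ginv_finite; apply: geven_sum => k _.
by apply/gevenZ/gevenX/gevenB => //; exact/gevenZ/geven1.
Qed.

Lemma gpowS (n : int) : geven a -> a * gpow a n = gpow a (n + 1).
Proof.
move=> ga; case: n => m.
  by rewrite /gpow (_ : Posz m + 1 = Posz m.+1) ?exprS // -addn1.
rewrite {1}/gpow exprS mulrA mulr_ginv mul1r.
by rewrite (_ : Negz m + 1 = - m%:Z); [case: m|rewrite NegzE; lia].
Qed.

Lemma geven_gpow (n : int) : geven a -> geven (gpow a n).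
Proof. by move=> ga; case: n => m; apply: gevenX => //; exact: geven_ginv. Qed.

End Inverse.
End Even.

(** * Superseries and their even multipliers *)

Lemma series_ext (M : Type) (S T : series M) : (forall e o, S e o = T e o) -> S = T.
Proof. by move=> H; apply/funext => e; apply/funext => o; exact: H. Qed.

Definition shift (M : Type) (d : eexp) (S : series M) : series M :=
  fun e o => S (e - d) o.

Lemma shiftD (M : Type) d d' (S : series M) : shift d (shift d' S) = shift (d + d') S.
Proof. by apply: series_ext => e o; rewrite /shift opprD addrA. Qed.

Lemma shiftC (M : Type) d d' (S : series M) : shift d (shift d' S) = shift d' (shift d S).
Proof. by rewrite !shiftD addrC. Qed.

Lemma shift0 (M : Type) (S : series M) : shift 0 S = S.
Proof. by apply: series_ext => e o; rewrite /shift subr0. Qed.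

Lemma oadd0 o : oadd o0 o = o. Proof. by case: o => -[] []. Qed.

Section Multipliers.
Variables (A : nzRingType) (M : lmodType A).
Implicit Types (i j k l : evar) (e d : eexp) (o p : oexp) (t : A * A * A).
Implicit Types (S T : series M) (G : series A).

Definition central (a : A) : Prop := forall b, a * b = b * a.

Definition cform t : Prop :=
  let: (a, b, c) := t in [/\ central a, central b & central c].

(** Multiplication by [a x_i + b x_j + c phi_1 phi_2], as an operator defined
    on all doubly infinite series: such operators commute, and most of the
    formal calculus reduces to recursions that they satisfy. *)
Definition formop i j t S : series M :=
  let: (a, b, c) := t in fun e o =>
    a *: S (e - xe i 1) o + b *: S (e - xe j 1) o
    + c *: (if o == o12 then S e o0 else 0).

Definition conv G S o p e : M := \sum_(d \in [set: eexp]) G d o *: S (e - d) p.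

(** The product of [S] with a series without terms in [phi_1] or [phi_2]
    alone. *)
Definition emul G S : series M := fun e o =>
  conv G S o0 o e + if o == o12 then conv G S o12 o0 e else 0.

(** The coefficients of the product are finite sums. *)
Definition cvg G S : Prop := forall e o p, exists s : {fset eexp},
  forall d, G d o != 0 -> S (e - d) p != 0 -> d \in s.

Lemma cvg_fin G S e o p : cvg G S -> fin_supp (fun d => G d o *: S (e - d) p).
Proof.
move=> /(_ e o p)[s Hs]; exists s => d H; apply: Hs.
  by apply: contraNneq H => ->; rewrite scale0r.
by apply: contraNneq H => ->; rewrite scaler0.
Qed.

Lemma formopE i j (a b c : A) S e o :
  formop i j (a, b, c) S e o = a *: S (e - xe i 1) o + b *: S (e - xe j 1) o
    + c *: (if o == o12 then S e o0 else 0).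
Proof. by []. Qed.

Lemma formop_neq0 i j t S e o : formop i j t S e o != 0 ->
  exists d p, S d p != 0 /\ [\/ d = e - xe i 1, d = e - xe j 1 | d = e].
Proof.
case: t => [[a b] c]; rewrite formopE => H.
case: (eqVneq (S (e - xe i 1) o) 0) => [E1|]; last first.
  by exists (e - xe i 1), o; split=> //; constructor 1.
case: (eqVneq (S (e - xe j 1) o) 0) => [E2|]; last first.
  by exists (e - xe j 1), o; split=> //; constructor 2.
exists e, o0; split; last by constructor 3.
by apply: contraNneq H; rewrite E1 E2 => ->; rewrite if_same !scaler0 !addr0.
Qed.

Lemma formop_shift i j t d S : formop i j t (shift d S) = shift d (formop i j t S).
Proof.
case: t => [[a b] c]; apply: series_ext => e o; rewrite /formop /shift.
by rewrite ![e - d - _]addrAC.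
Qed.

Lemma formopX i j S : formop i j (1, 0, 0) S = shift (xe i 1) S.
Proof. by apply: series_ext => e o; rewrite /formop /shift !scale0r scale1r !addr0. Qed.

Lemma formopY i j S : formop i j (0, 1, 0) S = shift (xe j 1) S.
Proof. by apply: series_ext => e o; rewrite /formop /shift !scale0r scale1r add0r addr0. Qed.

Lemma formopC i j k l t t' S : cform t ->
  formop i j t (formop k l t' S) = formop k l t' (formop i j t S).
Proof.
case: t t' => [[a b] c] [[a' b'] c'] [ca cb cc]; apply: series_ext => e o.
rewrite /formop !scalerDr !scalerA.
rewrite (ca a') (ca b') (ca c') (cb a') (cb b') (cb c').
rewrite ![e - xe k 1 - _]addrAC ![e - xe l 1 - _]addrAC.
case: (o == o12); last first.
  by rewrite !scaler0 !addr0 addrACA.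
rewrite /= !scalerDr !scalerA !scaler0 !addr0 (cc a') (cc b').
by rewrite [LHS](AC (3*3*2) ((1*4*7)*(2*5*8)*(3*6)))%AC.
Qed.

Lemma convD G S T o p e : cvg G S -> cvg G T ->
  conv G (fun e o => S e o + T e o) o p e = conv G S o p e + conv G T o p e.
Proof.
move=> cS cT; rewrite -fsumD; [|exact: cvg_fin..].
by apply: eq_fsbigr => d _; rewrite scalerDr.
Qed.

Lemma emulD G S T : cvg G S -> cvg G T ->
  emul G (fun e o => S e o + T e o) = (fun e o => emul G S e o + emul G T e o).
Proof.
move=> cS cT; apply: series_ext => e o; rewrite /emul !convD // addrACA; congr (_ + _).
by case: ifP; rewrite ?addr0.
Qed.

Lemma conv_scale G S o p e (a : A) : central a -> cvg G S ->
  a *: conv G S o p e = \sum_(d \in [set: eexp]) G d o *: (a *: S (e - d) p).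
Proof.
move=> ca cS.
rewrite /conv (@fsum_morph _ _ _ (fun x => a *: x)) //.
- by apply: eq_fsbigr => d _; rewrite !scalerA ca.
- by move=> x y; rewrite scalerDr.
- exact: cvg_fin.
Qed.

Lemma conv_formopr i j a b c G S o p e : cform (a, b, c) -> cvg G S ->
  conv G (formop i j (a, b, c) S) o p e
  = a *: conv G S o p (e - xe i 1) + b *: conv G S o p (e - xe j 1)
    + c *: (if p == o12 then conv G S o o0 e else 0).
Proof.
move=> [ca cb cc] cS.
have fin (x : A) e' p' : central x -> fin_supp (fun d => G d o *: (x *: S (e' - d) p')).
  move=> cx; apply: fin_supp_sub (cvg_fin e' o p' cS) => d H.
  by rewrite scalerA -cx -scalerA H scaler0.
rewrite !conv_scale // (_ : c *: _ = \sum_(d \in [set: eexp])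
   G d o *: (c *: (if p == o12 then S (e - d) o0 else 0))); last first.
  case: ifP => _; first by rewrite conv_scale.
  by rewrite scaler0 fsbig1 // => d _; rewrite !scaler0.
rewrite -!fsumD; try exact: fin; last first.
- case: (p == o12); first exact: fin.
  by exists fset0 => d; rewrite !scaler0 eqxx.
- by apply: fin_suppD; exact: fin.
by apply: eq_fsbigr => d _; rewrite /formop !scalerDr ![e - d - _]addrAC.
Qed.

Lemma emul_formopr i j t G S : cform t -> cvg G S ->
  emul G (formop i j t S) = formop i j t (emul G S).
Proof.
case: t => [[a b] c] ct cS; apply: series_ext => e o.
rewrite /emul [RHS]/formop !conv_formopr //=.
case: (o == o12); last by rewrite !addr0.
rewrite scaler0 !addr0 !scalerDr.
by rewrite (AC (3*2) ((1*4)*(2*5)*3))%AC.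
Qed.

Lemma emul_shiftr d G S : emul G (shift d S) = shift d (emul G S).
Proof.
apply: series_ext => e o; rewrite /shift /emul /conv; congr (_ + _).
  by apply: eq_fsbigr => d' _; rewrite addrAC.
by case: ifP => // _; apply: eq_fsbigr => d' _; rewrite addrAC.
Qed.

Lemma emul_shiftl d G S : emul (shift d G) S = shift d (emul G S).
Proof.
apply: series_ext => e o; rewrite /shift /emul /conv.
have H p q : \sum_(d' \in [set: eexp]) G (d' - d) p *: S (e - d') q
   = \sum_(d' \in [set: eexp]) G d' p *: S (e - d - d') q.
  rewrite -[RHS](fsum_shift _ d); apply: eq_fsbigr => d' _.
  by congr (_ *: S _ _); rewrite opprB addrA addrNK.
by rewrite !H.
Qed.

Lemma emul1 S : emul (scst (1 : A)) S = S.
Proof.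
apply: series_ext => e o; rewrite /emul /conv (fsum_single (i0 := 0)); last first.
  by move=> d /negbTE d0; rewrite /scst d0 scale0r.
rewrite /scst !eqxx /= scale1r subr0 (_ : (if _ then _ else _) = 0) ?addr0 //.
case: ifP => // _; apply: fsbig1 => d _.
by rewrite andbF scale0r.
Qed.

Definition bnd_below j S : Prop :=
  exists N : int, forall e o, S e o != 0 -> N <= e j.

Definition fin_series S : Prop :=
  exists s : {fset eexp}, forall e o, S e o != 0 -> e \in s.

Lemma cvg_fin_series G S : fin_series S -> cvg G S.
Proof.
move=> [s Hs] e o p; exists [fset e - d | d in s]%fset => d _ /Hs H.
by apply/imfsetP; exists (e - d) => //=; rewrite subKr.
Qed.

End Multipliers.

Arguments formop : simpl never.

Section LeftMultiplier.
Variables (A : nzRingType) (M : lmodType A).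
Implicit Types (i j k l : evar) (e d : eexp) (o p : oexp) (t : A * A * A).
Implicit Types (S T : series M) (G : series A).

Definition formopA i j t G : series A := @formop A A^o i j t G.

Arguments formopA : simpl never.

Lemma conv_formopl i j a b c G S o p e : cvg G S ->
  conv (formopA i j (a, b, c) G) S o p e
  = a *: conv G S o p (e - xe i 1) + b *: conv G S o p (e - xe j 1)
    + c *: (if o == o12 then conv G S o0 p e else 0).
Proof.
move=> cS.
have E (x : A) d' o' : x *: conv G S o' p (e - d')
    = \sum_(d \in [set: eexp]) (x * G (d - d') o') *: S (e - d) p.
  rewrite /conv (@fsum_morph _ _ _ (fun y => x *: y)); last 2 first.
  - by move=> y z; rewrite scalerDr.
  - exact: cvg_fin.
  rewrite -[LHS](fsum_shift _ d'); apply: eq_fsbigr => d _.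
  by rewrite scalerA opprB addrA addrNK.
have F (x : A) d' o' : fin_supp (fun d => (x * G (d - d') o') *: S (e - d) p).
  have [s Hs] := cS (e - d') o' p; exists [fset (d + d')%R | d in s]%fset => d H.
  apply/imfsetP; exists (d - d'); rewrite /= ?subrK //; apply: Hs.
    by apply: contraNneq H => ->; rewrite mulr0 scale0r.
  rewrite opprB addrA addrNK.
  by apply: contraNneq H => ->; rewrite scaler0.
rewrite !E (_ : c *: _ = \sum_(d \in [set: eexp])
   (c * (if o == o12 then G (d - 0) o0 else 0)) *: S (e - d) p); last first.
  case: ifP => _; first by rewrite -E subr0.
  by rewrite scaler0 fsbig1 // => d _; rewrite mulr0 scale0r.
rewrite -!fsumD; try exact: F; last first.
- case: (o == o12); first exact: F.
  by exists fset0 => d; rewrite mulr0 scale0r eqxx.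
- by apply: fin_suppD; exact: F.
by apply: eq_fsbigr => d _; rewrite /formopA /formop !scalerDl subr0.
Qed.

Lemma emul_formopl i j t G S : cvg G S ->
  emul (formopA i j t G) S = formop i j t (emul G S).
Proof.
case: t => [[a b] c] cS; apply: series_ext => e o.
rewrite /emul [RHS]/formop !conv_formopl //=.
case: (o == o12); last by rewrite !scaler0 !addr0.
rewrite scaler0 !addr0 !scalerDr.
by rewrite (AC (2*3) ((1*3)*(2*4)*5))%AC.
Qed.

End LeftMultiplier.

Lemma formopAE (A : nzRingType) i j (a b c : A) (G : series A) e o :
  formopA i j (a, b, c) G e o
  = a * G (e - xe i 1) o + b * G (e - xe j 1) o
    + c * (if o == o12 then G e o0 else 0).
Proof. by []. Qed.

Lemma emul_neq0 (A : nzRingType) (M : lmodType A) (G : series A) (S : series M) e o :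
  emul G S e o != 0 -> exists d p q, G d p != 0 /\ S (e - d) q != 0.
Proof.
have E p q : conv G S p q e != 0 -> exists d p q, G d p != 0 /\ S (e - d) q != 0.
  move=> /fsum_neq0[d H]; exists d, p, q.
  split; first by apply: contraNneq H => ->; rewrite scale0r.
  by apply: contraNneq H => ->; rewrite scaler0.
rewrite /emul; case: (eqVneq (conv G S o0 o e) 0) => [->|/E //].
by rewrite add0r; case: ifP => [_ /E //|_]; rewrite eqxx.
Qed.

Lemma cvg_finl (A : nzRingType) (M : lmodType A) (G : series A) (S : series M) :
  fin_series (G : series A^o) -> cvg G S.
Proof. by move=> [s Hs] e o p; exists s => d /Hs. Qed.

Lemma scale_regular (A : nzRingType) (a : A) (x : A^o) : a *: x = a * x.
Proof. by []. Qed.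

Lemma central_conv (A : nzRingType) (cj : A -> A) (p G : series A) q r e :
  (forall d, central (G d r)) -> (opar r -> forall d, G d r = 0) ->
  \sum_(d \in [set: eexp])
    (if opar r then cj (p d q) else p d q) *: (G (e - d) r : A^o)
  = conv G (p : series A^o) r q e.
Proof.
move=> cG G0; rewrite /conv -[RHS](fsum_reflect _ e).
apply: eq_fsbigr => d _; rewrite subKr.
by case: ifP => [/G0 ->|_]; rewrite !scale_regular ?mulr0 ?mul0r ?cG.
Qed.

Lemma iter_formopX (A : nzRingType) (M : lmodType A) n i j (S : series M) :
  iter n (formop i j (1, 0, 0)) S = shift (xe i 1 *+ n) S.
Proof.
elim: n => [|n IH]; first by rewrite mulr0n shift0.
by rewrite iterS IH formopX shiftD mulrS.
Qed.

Lemma iter_formopY (A : nzRingType) (M : lmodType A) n i j (S : series M) :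
  iter n (formop i j (0, 1, 0)) S = shift (xe j 1 *+ n) S.
Proof.
elim: n => [|n IH]; first by rewrite mulr0n shift0.
by rewrite iterS IH formopY shiftD mulrS.
Qed.

(** * Exponents *)

Lemma xeE i n k : xe i n k = if k == i then n else 0.
Proof. by rewrite /xe ffunE. Qed.

Lemma eexpD (e d : eexp) k : (e + d) k = e k + d k. Proof. by rewrite ffunE. Qed.
Lemma eexpN (e : eexp) k : (- e) k = - e k. Proof. by rewrite ffunE. Qed.
Lemma eexpB (e d : eexp) k : (e - d) k = e k - d k. Proof. by rewrite !ffunE. Qed.
Definition eexpE := (eexpB, eexpD, eexpN, xeE).

Lemma xeD i m n : xe i (m + n) = xe i m + xe i n.
Proof. by apply/ffunP => k; rewrite !eexpE; case: ifP; rewrite ?addr0. Qed.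

Lemma xeN i m : xe i (- m) = - xe i m.
Proof. by apply/ffunP => k; rewrite !eexpE; case: ifP; rewrite ?oppr0. Qed.

Lemma xe0 i : xe i 0 = 0.
Proof. by apply/ffunP => k; rewrite xeE if_same ffunE. Qed.

Lemma neq01 : x0 != x1. Proof. by rewrite -val_eqE /= !inordK. Qed.
Lemma neq02 : x0 != x2. Proof. by rewrite -val_eqE /= !inordK. Qed.
Lemma neq10 : x1 != x0. Proof. by rewrite -val_eqE /= !inordK. Qed.
Lemma neq12 : x1 != x2. Proof. by rewrite -val_eqE /= !inordK. Qed.
Lemma neq20 : x2 != x0. Proof. by rewrite -val_eqE /= !inordK. Qed.
Lemma neq21 : x2 != x1. Proof. by rewrite -val_eqE /= !inordK. Qed.
#[local] Hint Resolve neq01 neq02 neq10 neq12 neq20 neq21 : core.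

Lemma evarP (k : evar) : [\/ k = x0, k = x1 | k = x2].
Proof.
case: k => -[|[|[|//]]] lt; [constructor 1|constructor 2|constructor 3];
  by apply: val_inj; rewrite /= inordK.
Qed.

Lemma box_finite (B : nat) :
  exists s : {fset eexp}, forall e : eexp, (forall k, (absz (e k) <= B)%N) -> e \in s.
Proof.
pose F (f : {ffun evar -> 'I_(B + B).+1}) : eexp := [ffun k => (f k)%:Z - B%:Z].
exists [fset x in codom F]%fset => e eB; rewrite inE.
apply/codomP; exists [ffun k => inord (absz (e k + B%:Z))].
have H (z : int) : (absz z <= B)%N ->
  z = (absz (z + B%:Z))%:Z - B%:Z /\ (absz (z + B%:Z)%R < (B + B).+1)%N by lia.
by apply/ffunP => k; have [zE zlt] := H _ (eB k); rewrite !ffunE inordK.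
Qed.

(** * Powers of linear superforms *)

Lemma zbinS (n : int) k : zbin (n + 1) k.+1 = zbin n k.+1 + zbin n k.
Proof.
case: n => [m|[|m]].
- by rewrite (_ : Posz m + 1 = m.+1) ?[LHS]/= ?binS ?PoszD //; lia.
- by rewrite /= !add0n !binn exprS mulN1r mulNr mulr1 addNr.
have -> : Negz m.+1 + 1 = Negz m by rewrite !NegzE; lia.
rewrite /= [in RHS]addSn binS [in X in _ + X]addSnnS PoszD mulrDr exprS.
by rewrite -addrA mulN1r !mulNr addNr addr0.
Qed.

Lemma zbinn0 n : zbin n 0 = 1.
Proof. by case: n => m /=; rewrite bin0. Qed.

Lemma zbin0 k : zbin 0 k = (k == 0%N)%:R.
Proof. by rewrite /= bin0n; case: k. Qed.

Lemma zbin_small n k : (n < k)%N -> zbin n k = 0.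
Proof. by move=> nk; rewrite /= bin_small. Qed.

Lemma ring_pascal (A : nzRingType) (a b g h : A) m (y z : int) :
  a * g = h -> b * h = h * b ->
  a * ((g * b ^+ m.+1) *~ y) + b * ((h * b ^+ m) *~ z) = (h * b ^+ m.+1) *~ (y + z).
Proof.
move=> E C; rewrite mulrzDr !mulrzAr !mulrA E C.
by rewrite -[h * b * _]mulrA -exprS.
Qed.

Lemma central_mulrz (A : nzRingType) (c x y : A) (n : int) :
  central c -> x * (c * y *~ n) = c * (x * y) *~ n.
Proof.
move=> cc; rewrite mulrzAr; congr (_ *~ _).
by rewrite [LHS]mulrA -(cc x) mulrA.
Qed.

Section Grassmann.
Variables (K : fieldType) (L : option nat).
Notation A := (grass K L).
Implicit Types (i j k : evar) (e d : eexp) (o p : oexp) (t : sform K L).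
Implicit Types (a b c : A) (G : series A).

Definition eform t : Prop :=
  let: (a, b, c) := t in [/\ geven a, geven b & geven c].

Lemma eform_c t : eform t -> cform t.
Proof.
by case: t => [[a b] c] [ga gb gc]; split=> x; apply: geven_central.
Qed.

(** Series without terms in [phi_1] or [phi_2] alone and with even coefficients:
    they are central for the product of superseries, and all multipliers that
    occur are of this kind. *)
Definition gevens G : Prop :=
  forall e o, geven (G e o) /\ (o != o0 -> o != o12 -> G e o = 0).

Lemma big_oexp (M : zmodType) (F : oexp -> M) :
  \sum_(p : oexp) F p = F o0 + F (false, true) + (F (true, false) + F o12).
Proof.
rewrite (eq_bigr (fun p => F (p.1, p.2))); last by case.
rewrite -(pair_bigA _ (fun x y => F (x, y))) /= big_bool !big_bool /=.
by rewrite addrC ![F (_, true) + _]addrC.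
Qed.

Lemma big_osgnl (M : zmodType) (F : oexp -> oexp -> M) o :
  (forall p q, p != o0 -> p != o12 -> F p q = 0) ->
  \sum_(p : oexp * oexp | oadd p.1 p.2 == o) F p.1 p.2 *~ osgn p.1 p.2
  = F o0 o + if o == o12 then F o12 o0 else 0.
Proof.
move=> F0; rewrite big_mkcond /=.
rewrite -(pair_bigA _ (fun x y => if oadd x y == o then F x y *~ osgn x y else 0)) /=.
rewrite big_oexp !big_oexp.
case: o => -[] [] /=; rewrite ?(F0 (false, true)) ?(F0 (true, false)) //=;
  by rewrite ?mul0rz ?mulr0z ?mulr1z ?(addr0, add0r).
Qed.

Lemma big_osgnr (M : zmodType) (F : oexp -> oexp -> M) o :
  (forall p q, q != o0 -> q != o12 -> F p q = 0) ->
  \sum_(p : oexp * oexp | oadd p.1 p.2 == o) F p.1 p.2 *~ osgn p.1 p.2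
  = F o o0 + if o == o12 then F o0 o12 else 0.
Proof.
move=> F0; rewrite big_mkcond /=.
rewrite -(pair_bigA _ (fun x y => if oadd x y == o then F x y *~ osgn x y else 0)) /=.
rewrite big_oexp !big_oexp.
case: o => -[] [] /=; rewrite ?(F0 _ (false, true)) ?(F0 _ (true, false)) //=;
  rewrite ?mul0rz ?mulr0z ?mulr1z ?(addr0, add0r) //; exact: addrC.
Qed.

(** The signs of the general product disappear for an even left factor. *)
Lemma smul_emul (M : lmodType A) G (S : series M) : gevens G -> smul G S = emul G S.
Proof.
move=> gG; apply: series_ext => e o.
rewrite -[RHS](@big_osgnl _ (fun p q => conv G S p q e)); last first.
  move=> p q p0 p12; apply: fsbig1 => d _.
  by have [_ ->] := gG d p; rewrite ?scale0r.
apply: eq_bigr => -[p q] _ /=; congr (_ *~ _); apply: eq_fsbigr => d _.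
by rewrite (gconj_even (gG d p).1) if_same.
Qed.

(** Even coefficients are central and [phi_1 phi_2] passes through everything
    without a sign, so an even series may be moved to the left. *)
Lemma smulA_emul (p : series A) G : gevens G -> smulA p G = emul G (p : series A^o).
Proof.
move=> gG; apply: series_ext => e o.
rewrite /smulA /smul -[RHS](@big_osgnr _ (fun q r => conv G (p : series A^o) r q e)).
  apply: eq_bigr => -[q r] _.
  rewrite /=.
  apply: (congr1 (fun x : A^o => x *~ osgn q r)).
  apply: central_conv => [d x|r1 d]; first exact/geven_central/(gG _ _).1.
  by apply: (gG _ _).2; apply: contraTneq r1 => ->.
move=> q r r0 r12; apply: fsbig1 => d _.
by rewrite (gG _ _).2 // scale0r.
Qed.

Lemma gevens_formop i j t G : eform t -> gevens G -> gevens (formopA i j t G).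
Proof.
case: t => [[a b] c] [ga gb gc] gG e o; rewrite formopAE.
split; last first.
  move=> n0 no12; rewrite (negbTE no12) !(gG _ o).2 //.
  by rewrite !mulr0 !addr0.
apply: gevenD; first by apply: gevenD; apply: gevenM => //; exact: (gG _ _).1.
by apply: gevenM => //; case: ifP => _; [exact: (gG _ _).1|exact: geven0].
Qed.

Lemma gevens1 : gevens (scst (1 : A)).
Proof.
move=> e o; rewrite /scst; split; first by case: ifP => _; [exact: geven1|exact: geven0].
by move=> /negbTE ->; rewrite andbF.
Qed.

Section Power.
Variables (i j : evar) (a b c : A).
Hypotheses (ij : i != j) (ga : geven a) (gb : geven b) (gc : geven c) (ba : body a != 0).

Lemma lexpS n e :
  a * lexp i j a b n (e - xe i 1) + b * lexp i j a b n (e - xe j 1)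
  = lexp i j a b (n + 1) e.
Proof.
rewrite /lexp !eexpE eqxx eq_sym (negbTE ij) subr0.
have -> : (e - xe i 1 == xe i (n - e j) + xe j (e j))
          = (e == xe i (n + 1 - e j) + xe j (e j)).
  by rewrite subr_eq addrAC -xeD; congr (e == xe i _ + _); lia.
have -> : (e - xe j 1 == xe i (n - (e j - 1)) + xe j (e j - 1))
          = (e == xe i (n + 1 - e j) + xe j (e j)).
  rewrite subr_eq -addrA -xeD subrK; congr (e == xe i _ + _); lia.
case: (_ == _); last by rewrite !andbF !mulr0 addr0.
rewrite !andbT; case: (e j) => [[|m]|m] /=; last by rewrite !mulr0 addr0.
  rewrite mulr0 addr0 !expr0 !mulr1 !subr0 !zbinn0 gpowS //.
have -> : Posz m.+1 - 1 = m%:Z by lia.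
have -> : n + 1 - m.+1%:Z = (n - m.+1%:Z) + 1 by lia.
have -> : n - m%:Z = (n - m.+1%:Z) + 1 by lia.
rewrite zbinS subn1 /=; apply: ring_pascal; last exact: geven_central.
exact: gpowS.
Qed.

(** Pascal's rule, for all integral exponents at once. *)
Lemma lpowS n : formopA i j (a, b, c) (lpow i j a b c n) = lpow i j a b c (n + 1).
Proof.
apply: series_ext => e o; rewrite formopAE /lpow.
case: (eqVneq o o0) => [->|n0] /=; first by rewrite mulr0 addr0 lexpS.
case: (eqVneq o o12) => [_|no12] /=; last by rewrite !mulr0 !addr0.
have E x e' : x * (c * lexp i j a b (n - 1) e' *~ n)
    = c * (x * lexp i j a b (n - 1) e') *~ n.
  by apply: central_mulrz => y; exact: geven_central.
rewrite !E -mulrzDl -mulrDr lexpS subrK addrK.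
by rewrite mulrzDr mulr1z.
Qed.

Lemma lpow_exp0 : lpow i j a b c 0 = scst 1.
Proof.
apply: series_ext => e o; rewrite /lpow /scst.
case: (eqVneq o o0) => [_|n0]; last by rewrite andbF mulr0z if_same.
rewrite andbT /lexp sub0r zbin0.
case: (eqVneq (e j) 0) => [->|ej].
  by rewrite /= oppr0 !xe0 addr0 expr0 mulr1 mulr1z.
have -> : (absz (e j) == 0)%N = false by apply/negbTE; rewrite absz_eq0.
rewrite mulr0z if_same; case: eqP => // e0; move: ej; rewrite e0 ffunE eqxx //.
Qed.

Lemma lpow_even n : gevens (lpow i j a b c n).
Proof.
have ge m e : geven (lexp i j a b m e).
  rewrite /lexp; case: ifP => _; last exact: geven0.
  by apply/gevenMz/gevenM; [exact: geven_gpow|exact: gevenX].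
move=> e o; rewrite /lpow; split.
  case: ifP => _ //; case: ifP => _; last exact: geven0.
  by apply/gevenMz/gevenM.
by move=> /negbTE -> /negbTE ->.
Qed.
End Power.

Lemma lexp_neq0 i j a b n e : lexp i j a b n e != 0 ->
  [/\ 0 <= e j, e = xe i (n - e j) + xe j (e j) & b ^+ absz (e j) != 0].
Proof.
rewrite /lexp; case: ifP => [/andP[ej /eqP E]|_]; last by rewrite eqxx.
move=> H; split=> //; apply: contraNneq H => ->; by rewrite mulr0 mul0rz.
Qed.

Lemma lpow_neq0 i j a b c n e o : lpow i j a b c n e o != 0 ->
  [/\ 0 <= e j, b ^+ absz (e j) != 0 & exists2 m : int, (m == n) || (m == n - 1)
     & e = xe i (m - e j) + xe j (e j)].
Proof.
rewrite /lpow; case: ifP => [_ /lexp_neq0[? H ?]|_].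
  by split=> //; exists n; rewrite ?eqxx.
case: ifP => [_ H|_]; last by rewrite eqxx.
have [|? ? ?] := @lexp_neq0 i j a b (n - 1) e.
  by apply: contraNneq H => ->; rewrite mulr0 mul0rz.
by split=> //; exists (n - 1); rewrite ?eqxx ?orbT.
Qed.

Lemma cvg_lpow (M : lmodType A) i j a b c n (S : series M) :
  bnd_below j S -> cvg (lpow i j a b c n) S.
Proof.
move=> [N HN] e o p.
have [s Hs] := box_finite (absz n + absz (e j) + absz N + 1)%N.
exists s => d /lpow_neq0[dj _ [m Hm E]] /HN; rewrite eexpB => ej.
apply: Hs => k; rewrite E !eexpE.
by case: eqP => _; case: eqP => _; lia.
Qed.

(** For a form [a x_i + b x_j] in which [b] has no body: the expansion of its
    inverse in powers of [b x_j] stops. *)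
Lemma fin_lpow i j a b c n m : b ^+ m = 0 ->
  fin_series (lpow i j a b c n : series A^o).
Proof.
move=> bm; have [s Hs] := box_finite (absz n + m + m + 1)%N.
exists s => e o /lpow_neq0[ej bj [l Hl E]].
have ejm : (absz (e j) < m)%N.
  rewrite ltnNge; apply: contraNN bj => mj.
  by rewrite -(subnKC mj) exprD bm mul0r.
apply: Hs => k; rewrite E !eexpE.
by case: eqP => _; case: eqP => _; lia.
Qed.

End Grassmann.

(** * Rational superfunctions and their expansions *)

Section Fractions.
Variables (K : fieldType) (L : option nat).
Notation A := (grass K L).
Implicit Types (i j k : evar) (e d : eexp) (o p : oexp) (t : sform K L).
Implicit Types (s : seq (sform K L)).

Lemma in_S_eform t : in_S t -> eform t.
Proof. by case: t => [[a b] c] []. Qed.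

Lemma formop_swap (M : lmodType A) i j (a b c : A) (S : series M) :
  formop i j (a, b, c) S = formop j i (b, a, c) S.
Proof. by apply: series_ext => e o; rewrite /formop [a *: _ + _]addrC. Qed.

Section Module.
Variable M : lmodType A.
Implicit Types (S T X : series M).

(** Multiplication by the denominator [s], as an operator on all series. *)
Definition opden i j s S : series M := foldr (formop i j) S s.

Lemma opden_nseq i j n t S : opden i j (nseq n t) S = iter n (formop i j t) S.
Proof. by elim: n => //= n ->. Qed.

Lemma opden_cat i j s s' S : opden i j (s ++ s') S = opden i j s (opden i j s' S).
Proof. by rewrite /opden foldr_cat. Qed.

Lemma opden_formop i j s k l t S : {in s, forall t, eform t} ->
  opden i j s (formop k l t S) = formop k l t (opden i j s S).
Proof.
elim: s => //= t' s IH H; rewrite IH; last by move=> x xs; apply: H; rewrite inE xs orbT.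
by apply/formopC/eform_c/H; rewrite inE eqxx.
Qed.

Lemma opdenC i j s s' S : {in s, forall t, eform t} ->
  opden i j s (opden i j s' S) = opden i j s' (opden i j s S).
Proof. by move=> H; elim: s' => //= t' s' <-; rewrite opden_formop. Qed.

Lemma bnd_formop i j k t S : bnd_below k S -> bnd_below k (formop i j t S).
Proof.
move=> [N HN]; exists N => e o /formop_neq0[d [p [/HN Hd [] E]]]; move: Hd;
  rewrite E ?eexpE; try case: eqP => _; lia.
Qed.

Lemma bnd_emul i G S : (exists N : int, forall e o, G e o != 0 -> N <= e i) ->
  bnd_below i S -> bnd_below i (emul (G : series A) S).
Proof.
move=> [N HN] [N' HN']; exists (N + N') => e o.
move=> /emul_neq0[d [p [q [/HN H1 /HN']]]]; rewrite eexpB; lia.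
Qed.

End Module.

(** Both expansions of the inverse of a form, according to which coefficient
    is invertible, are genuine inverses on series with finitely many negative
    powers of the second variable. *)
Lemma form_inv_spec i j t : i != j -> in_S t ->
  [/\ formopA i j t (form_inv i j t) = scst 1,
      gevens (form_inv i j t),
      exists N : int, forall e o, form_inv i j t e o != 0 -> N <= e j &
      forall (M : lmodType A) (S : series M), bnd_below j S -> cvg (form_inv i j t) S].
Proof.
case: t => [[a b] c] ij [ga gb gc]; rewrite /form_inv.
case: (eqVneq (body a) 0) => /= [ba|ba _].
  move=> bb; have [m am] := body0_nilp ba.
  have ji : j != i by rewrite eq_sym.
  split.
  - by rewrite /formopA formop_swap [LHS](lpowS (i := j)) // lpow_exp0.
  - exact: lpow_even.
  - have [s Hs] := fin_lpow j i b c (- 1) am.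
    exists (- (\sum_(d <- s) (absz (d j))%:Z)) => e o /Hs es.
    have H (x r : int) : 0 <= r -> - ((absz x)%:Z + r) <= x by lia.
    rewrite (big_fsetD1 e) //=; apply: H.
    by elim/big_ind: _ => // x y; lia.
  - by move=> M S _; apply: cvg_finl; exact: fin_lpow am.
split.
- by rewrite lpowS // lpow_exp0.
- exact: lpow_even.
- by exists 0 => e o /lpow_neq0[].
- by move=> M S; exact: cvg_lpow.
Qed.

Section Expansion.
Variables (i j : evar).
Hypothesis ij : i != j.
Implicit Types (S X : series A^o).

Let finv t S : series A^o := smulA (form_inv i j t) S.

Lemma finvE t S : in_S t -> finv t S = emul (form_inv i j t) S.
Proof. by move=> ht; rewrite /finv /smulA smul_emul //; case: (form_inv_spec ij ht). Qed.

Lemma bnd_finv t S : in_S t -> bnd_below j S -> bnd_below j (finv t S).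
Proof. by move=> ht; rewrite finvE //; apply: bnd_emul; case: (form_inv_spec ij ht). Qed.

Lemma formop_finv t S : in_S t -> bnd_below j S -> formop i j t (finv t S) = S.
Proof.
move=> ht hS; have [E _ _ c] := form_inv_spec ij ht.
by rewrite finvE // -emul_formopl ?E ?emul1 //; exact: c.
Qed.

Lemma finv_formop t t' S : in_S t -> eform t' -> bnd_below j S ->
  finv t (formop i j t' S) = formop i j t' (finv t S).
Proof.
move=> ht ht' hS; have [_ _ _ c] := form_inv_spec ij ht.
by rewrite !finvE // emul_formopr //; [exact: eform_c|exact: c].
Qed.

Lemma bnd_iota s S : {in s, forall t, in_S t} -> bnd_below j S ->
  bnd_below j (foldr finv S s).
Proof.
elim: s => //= t s IH H hS; apply: bnd_finv; first by apply: H; rewrite inE eqxx.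
by apply: IH => // x xs; apply: H; rewrite inE xs orbT.
Qed.

Lemma iota_formop s t S : {in s, forall t, in_S t} -> eform t -> bnd_below j S ->
  foldr finv (formop i j t S) s = formop i j t (foldr finv S s).
Proof.
elim: s => //= t' s IH H ht hS.
have H' : {in s, forall t, in_S t} by move=> x xs; apply: H; rewrite inE xs orbT.
rewrite IH // finv_formop //; first by apply: H; rewrite inE eqxx.
exact: bnd_iota.
Qed.

Lemma opden_iota s S : {in s, forall t, in_S t} -> bnd_below j S ->
  opden i j s (foldr finv S s) = S.
Proof.
elim: s => //= t s IH H hS.
have H' : {in s, forall t, in_S t} by move=> x xs; apply: H; rewrite inE xs orbT.
have ht : in_S t by apply: H; rewrite inE eqxx.
rewrite -opden_formop => [|x /H' /in_S_eform //].
by rewrite formop_finv ?IH //; exact: bnd_iota.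
Qed.

Lemma iota_opden s S : {in s, forall t, in_S t} -> bnd_below j S ->
  foldr finv (opden i j s S) s = S.
Proof.
elim: s => //= t s IH H hS.
have H' : {in s, forall t, in_S t} by move=> x xs; apply: H; rewrite inE xs orbT.
have ht : in_S t by apply: H; rewrite inE eqxx.
have et := in_S_eform ht.
have hs : bnd_below j (opden i j s S) by elim: (s) => //= t' s' hs; exact: bnd_formop.
by rewrite iota_formop // IH // finv_formop // formop_finv.
Qed.

End Expansion.

Lemma fin_scst1 : fin_series (scst (1 : A) : series A^o).
Proof.
exists [fset 0]%fset => e o; rewrite /scst in_fset1.
by case: (e == 0) => //=; rewrite eqxx.
Qed.

Lemma form_serE i j t : form_ser i j t = formopA i j t (scst 1).
Proof.
case: t => [[a b] c]; apply: series_ext => e o; rewrite formopAE /form_ser /scst.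
rewrite !subr_eq0 !eqxx andbT.
case: (eqVneq o o0) => [->|n0] /=.
  by rewrite mulr0 addr0 !andbT; do 2!case: (_ == _); rewrite ?mulr1 ?mulr0.
by rewrite !andbF !mulr0 !add0r; case: (o == o12); case: (e == 0); rewrite /= ?mulr1 ?mulr0.
Qed.

Lemma smulA_form i j t (S : series A^o) : eform t ->
  smulA (form_ser i j t) S = formop i j t S.
Proof.
move=> ht; rewrite form_serE /smulA smul_emul; last by apply: gevens_formop => //; exact: gevens1.
by rewrite emul_formopl ?emul1 //; apply/cvg_finl/fin_scst1.
Qed.

Lemma den_serE i j s : {in s, forall t, eform t} ->
  den_ser i j s = opden i j s (scst (1 : A) : series A^o)
  /\ gevens (den_ser i j s).
Proof.
elim: s => [_|t s IH H]; first by split=> //; exact: gevens1.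
have ht : eform t by apply: H; rewrite inE eqxx.
have [E1 E2] : den_ser i j s = opden i j s (scst (1 : A) : series A^o)
  /\ gevens (den_ser i j s) by apply: IH => x xs; apply: H; rewrite inE xs orbT.
have E : den_ser i j (t :: s) = formopA i j t (den_ser i j s).
  exact: (smulA_form i j (den_ser i j s) ht).
rewrite E; split; last exact: gevens_formop.
exact: (f_equal (@formop A A^o i j t) E1).
Qed.

Lemma smulA_den i j s (p : series A^o) : {in s, forall t, eform t} ->
  fin_series p -> smulA p (den_ser i j s) = opden i j s p.
Proof.
move=> H hp; have [E1 E2] := den_serE i j H.
rewrite smulA_emul // E1 {E1 E2}; elim: s H => /= [|t s IH] H; first by rewrite emul1.
rewrite [LHS]emul_formopl ?IH //; last exact: cvg_fin_series.
by move=> x xs; apply: H; rewrite inE xs orbT.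
Qed.

Lemma spoly_fin i j (p : series A^o) : is_spoly i j p ->
  fin_series p /\ forall k, bnd_below k p.
Proof.
move=> [fp pp]; split; last by move=> k; exists 0 => e o /pp/(_ k)[].
have /finite_fsetP[s Es] := fp.
exists [fset q.1 | q in s]%fset => e o H; apply/imfsetP; exists (e, o) => //.
suff : [set` s]%classic (e, o) by [].
by rewrite -Es.
Qed.

(** Cross-multiplication suffices, with no further factor from the
    localization. *)
Lemma sfrac_eqP i j (f g : sfrac K L) :
  is_spoly i j f.1 -> is_spoly i j g.1 ->
  {in f.2, forall t, eform t} -> {in g.2, forall t, eform t} ->
  opden i j g.2 (f.1 : series A^o) = opden i j f.2 (g.1 : series A^o) ->
  sfrac_eq i j f g.
Proof.
move=> pf pg ef eg E; exists [::]; split; first by [].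
have [ff _] := spoly_fin pf; have [fg _] := spoly_fin pg.
have H := etrans (smulA_den i j eg ff) (etrans E (esym (smulA_den i j ef fg))).
by move=> e o; exact: (f_equal (fun X => smulA (den_ser i j [::]) X e o) H).
Qed.

(** A series is the expansion of a fraction as soon as the denominator
    multiplies it into the numerator: on series with finitely many negative
    powers of [x_j], linear superforms act injectively. *)
Lemma iota_invP i j (S : series A^o) (f : sfrac K L) : i != j ->
  is_sfrac i j f -> bnd_below j S -> opden i j f.2 S = f.1 ->
  is_iota_inv i j S f.
Proof.
move=> ij [pf sf] hS E; split; first by split.
  have H := iota_opden ij sf hS; rewrite E in H.
  by move=> e o; exact: (f_equal (fun X => X e o) H).
move=> f' [pf' sf'] E'.
have {}E' : Defs.iota i j f' = S by apply: series_ext.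
have ef : {in f.2, forall t, eform t} by move=> t /sf/in_S_eform.
have ef' : {in f'.2, forall t, eform t} by move=> t /sf'/in_S_eform.
apply: sfrac_eqP; [exact: pf'|exact: pf|exact: ef'|exact: ef|].
have E2 : opden i j f'.2 S = f'.1.
  rewrite -E'; apply: (opden_iota ij sf').
  by have [_] := spoly_fin pf'; apply.
by rewrite -E -E2; exact: opdenC.
Qed.

End Fractions.

(** * Delta functions *)

Section GenericOps.
Variables (A : nzRingType) (M : lmodType A).
Implicit Types (i j k l : evar) (e d : eexp) (o p : oexp) (t : A * A * A).
Implicit Types (S T : series M) (G : series A).

Lemma xeMn i n : xe i 1 *+ n = xe i n.
Proof. by elim: n => [|n IH]; rewrite ?mulr0n ?xe0 // mulrS IH -xeD; congr xe; lia. Qed.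

Lemma iter_formop_shift n i j t d S :
  iter n (formop i j t) (shift d S) = shift d (iter n (formop i j t) S).
Proof. by elim: n => //= n ->; rewrite formop_shift. Qed.

Lemma iter_formopC n i j t k l t' S : cform t ->
  iter n (formop i j t) (formop k l t' S) = formop k l t' (iter n (formop i j t) S).
Proof. by move=> ct; elim: n => //= n ->; rewrite formopC. Qed.

Lemma emul_iter n i j t G S : cform t -> cvg G S ->
  (forall m, cvg G (iter m (formop i j t) S)) ->
  emul G (iter n (formop i j t) S) = iter n (formop i j t) (emul G S).
Proof. by move=> ct cS cI; elim: n => //= n IH; rewrite emul_formopr // IH. Qed.

(** Since the square of [phi_1 phi_2] vanishes, a product of two forms that
    differ only in their odd terms depends only on the sum of these. *)
Lemma formop_odd i j (a b c c' d d' : A) S :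
  central a -> central b -> c + d = c' + d' ->
  formop i j (a, b, c) (formop i j (a, b, d) S)
  = formop i j (a, b, c') (formop i j (a, b, d') S).
Proof.
move=> ca cb cd; apply: series_ext => e o; rewrite !formopE /=.
case: (o == o12); last by rewrite !scaler0 !addr0.
rewrite !scaler0 !addr0 !scalerDr !scalerA -(ca c) -(cb c) -(ca c') -(cb c').
have E u x y z w v : u + x + a * d *: v + (y + z + b * d *: w) + (a * c *: v + b * c *: w)
   = u + x + (y + z) + ((a * (c + d)) *: v + (b * (c + d)) *: w) :> M.
  by rewrite !mulrDr !scalerDl (AC (3*3*2) ((1*2)*(4*5)*((7*3)*(8*6))))%AC.
have E' u x y z w v : u + x + a * d' *: v + (y + z + b * d' *: w) + (a * c' *: v + b * c' *: w)
   = u + x + (y + z) + ((a * (c' + d')) *: v + (b * (c' + d')) *: w) :> M.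
  by rewrite !mulrDr !scalerDl (AC (3*3*2) ((1*2)*(4*5)*((7*3)*(8*6))))%AC.
by rewrite E E' cd.
Qed.

(** By [formop_odd] the odd terms can be collected in one factor: with
    y = [a x_i + b x_j + c phi_1 phi_2],
    (y - d phi_1 phi_2)^(n+1) = y^n (y - (n+1) d phi_1 phi_2). *)
Lemma iter_formop_odd i j (a b c d : A) n S : central a -> central b -> central c ->
  iter n.+1 (formop i j (a, b, c - d)) S
  = iter n (formop i j (a, b, c)) (formop i j (a, b, c - d *+ n.+1) S).
Proof.
move=> ca cb cc; elim: n => [|n IH]; first by rewrite mulr1n.
rewrite iterS IH -iter_formopC // [in RHS]iterSr; congr iter.
apply: formop_odd => //; rewrite [d *+ n.+2]mulrS opprD.
by rewrite (AC (2*2) (1*(3*(2*4))))%AC.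
Qed.

Lemma iter_formop_agree n i j l (m : int) t S T : l != i -> l != j ->
  (forall e o, e l = m -> S e o = T e o) ->
  forall e o, e l = m -> iter n (formop i j t) S e o = iter n (formop i j t) T e o.
Proof.
case: t => [[a b] c] li lj H; elim: n => //= n IH e o em.
by rewrite !formopE !IH // !eexpE ?(negbTE li) ?(negbTE lj) ?subr0.
Qed.

Lemma formop_supp i j l t (P : int -> Prop) S : l != i -> l != j ->
  (forall e o, S e o != 0 -> P (e l)) ->
  forall e o, formop i j t S e o != 0 -> P (e l).
Proof.
case: t => [[a b] c] li lj H e o; rewrite formopE => S0; apply: contrapT => nP.
have S0' d p : d l = e l -> S d p = 0.
  by move=> E; apply: contrapT => /eqP/H; rewrite E.
move: S0; rewrite !S0' ?if_same ?scaler0 ?addr0 ?eqxx // !eexpE ?(negbTE li) ?(negbTE lj) ?subr0 //.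
Qed.

Lemma iter_formop_supp n i j l t (P : int -> Prop) S : l != i -> l != j ->
  (forall e o, S e o != 0 -> P (e l)) ->
  forall e o, iter n (formop i j t) S e o != 0 -> P (e l).
Proof. by move=> li lj H; elim: n => //= n IH; exact: formop_supp. Qed.

(** If multiplication by [x_l] acts on [T] as a form in the other variables, then
    one coefficient of [T] in [x_l] determines those below it. *)
Lemma slice_neg i j l t n S T : l != i -> l != j ->
  formop i j t T = shift (xe l 1) T ->
  (forall e o, e l = - 1 -> T e o = S (e + xe l 1) o) ->
  forall e o, e l = - n%:Z - 1 ->
    T e o = iter n (formop i j t) S (e + xe l (n.+1)%:Z) o.
Proof.
move=> li lj TE TS e o el.
have T1 : iter n (formop i j t) T = shift (xe l n%:Z) T.
  elim: n {el} => [|n IH]; first by rewrite xe0 shift0.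
  rewrite iterS IH formop_shift TE shiftD -xeD; congr (shift (xe l _) T); lia.
have -> : T e o = iter n (formop i j t) T (e + xe l n%:Z) o by rewrite T1 /shift addrK.
rewrite (@iter_formop_agree n i j l (- 1) t T (shift (- xe l 1) S) li lj) //; first last.
- by rewrite !eexpE eqxx el; lia.
- by move=> e' o' /TS ->; rewrite /shift opprK.
rewrite iter_formop_shift /shift opprK -addrA -xeD; congr (iter n _ S (e + xe l _) o); lia.
Qed.

(** A coefficient of a product with a delta function is trivial where that of the
    delta function is. *)
Lemma emul_slice l G S e o :
  (forall d p, d l = - 1 -> G d p = scst 1 (d + xe l 1) p) ->
  (forall e o, S e o != 0 -> e l = 0) -> e l = - 1 ->
  emul G S e o = S (e + xe l 1) o.
Proof.
move=> GE S0 el.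
transitivity (emul (shift (- xe l 1) (scst 1)) S e o); last first.
  by rewrite emul_shiftl emul1 /shift opprK.
have E p q : conv G S p q e = conv (shift (- xe l 1) (scst 1)) S p q e.
  apply: eq_fsbigr => d _; case: (eqVneq (S (e - d) q) 0) => [->|/S0].
    by rewrite !scaler0.
  by rewrite eexpB el => dl; rewrite /shift opprK GE //; lia.
by rewrite /emul !E.
Qed.

Lemma emul_mono G d (m : oexp -> M) e o :
  emul G (fun d' p => if d' == d then m p else 0) e o
  = G (e - d) o0 *: m o + if o == o12 then G (e - d) o12 *: m o0 else 0.
Proof.
have E p q : conv G (fun d' p => if d' == d then m p else 0) p q e = G (e - d) p *: m q.
  rewrite /conv (fsum_single (i0 := e - d)); first by rewrite subKr eqxx.
  move=> d' dd'; rewrite ifF ?scaler0 //; apply: contraNF dd' => /eqP <-.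
  by rewrite subKr.
by rewrite /emul !E.
Qed.

End GenericOps.

Lemma scaler_mulrz (A : nzRingType) (a b x y z c : A) (n : int) (t : bool) :
  a * (x *~ n) + b * (y *~ n) + c * (if t then z *~ n else 0)
  = (a * x + b * y + c * (if t then z else 0)) *~ n.
Proof. by rewrite !mulrzDl; case: t; rewrite ?mulr0 ?mul0rz !mulrzAr. Qed.

Lemma formopA_opp (A : nzRingType) i j (c : A) (G : series A) e o :
  formopA j i (1, - 1, - c) G e o = - formopA i j (1, - 1, c) G e o.
Proof.
rewrite !formopAE !mulN1r !mul1r mulNr !opprD opprK.
by rewrite [- _ + G _ _]addrC.
Qed.

Section Delta.
Variables (K : fieldType) (L : option nat).
Notation A := (grass K L).
Implicit Types (e d : eexp) (o p : oexp).
Variables (i j k : evar) (c : A) (s : int).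
Hypotheses (ij : i != j) (ik : i != k) (jk : j != k) (gc : geven c).
Notation delta := (sdelta i j k c s).

Let b1 : body (1 : A) != 0. Proof. by rewrite body1 oner_neq0. Qed.
Let g1 : geven (1 : A). Proof. exact: geven1. Qed.
Let gN1 : geven (- 1 : A). Proof. exact: gevenN. Qed.

Lemma sdelta_even : gevens delta.
Proof.
move=> e o; have [H1 H2] := lpow_even i j g1 gN1 gc (- e k - 1) (e - xe k (e k)) o.
rewrite /sdelta; split; first exact: gevenMz.
by move=> n0 no12; rewrite H2 // mul0rz.
Qed.

Lemma sdelta_step e o : formopA i j (1, - 1, c) delta e o
  = lpow i j 1 (- 1) c (- e k) (e - xe k (e k)) o *~ s ^+ absz (- e k - 1).
Proof.
have H := lpowS ij g1 gN1 gc b1 (- e k - 1).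
have {}H : formopA i j (1, - 1, c) (lpow i j 1 (- 1) c (- e k - 1)) (e - xe k (e k)) o
   = lpow i j 1 (- 1) c (- e k) (e - xe k (e k)) o by rewrite H subrK.
rewrite formopAE in H; rewrite formopAE -H /sdelta !eexpE ![k == _]eq_sym.
rewrite (negbTE ik) (negbTE jk) !subr0 ![e - _ - xe k _]addrAC.
exact: scaler_mulrz.
Qed.

Lemma sdelta_coef e o : e k = - 1 -> delta e o = scst 1 (e + xe k 1) o.
Proof.
by move=> ek; rewrite /sdelta ek opprK subrr /= expr0 mulr1z lpow_exp0 xeN opprK.
Qed.

Lemma sdelta_neq0 e o : delta e o != 0 ->
  [/\ 0 <= e j & exists2 m : int, (m == - e k - 1) || (m == - e k - 2)
     & e = xe k (e k) + xe i (m - e j) + xe j (e j)].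
Proof.
rewrite /sdelta => H.
have : lpow i j 1 (- 1) c (- e k - 1) (e - xe k (e k)) o != 0.
  by apply: contraNneq H => ->; rewrite mul0rz.
move=> /lpow_neq0[]; rewrite !eexpE (negbTE jk) subr0 => ej _ [m Hm E].
split=> //; exists m; first by move: Hm; rewrite -addrA -opprD.
by rewrite -addrA -E addrC subrK.
Qed.

Lemma cvg_sdelta (M : lmodType A) (S : series M) (N : int) :
  (forall e o, S e o != 0 -> (e k = 0 \/ e i = 0) /\ N <= e j) -> cvg delta S.
Proof.
move=> HS e o p.
have [f Hf] := box_finite ((absz (e i) + absz (e k) + absz (e j) + absz N + 3) * 2)%N.
have ki : (k == i) = false by rewrite eq_sym (negbTE ik).
have kj : (k == j) = false by rewrite eq_sym (negbTE jk).
exists f => d /sdelta_neq0[dj [m Hm E]] /HS; rewrite !eexpB => -[dki ej].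
have dm : d i = m - d j by rewrite {1}E !eexpE eqxx eq_sym ki (negbTE ij) add0r addr0.
have {dki} : (d k = e k) \/ (d i = e i) by case: dki; lia.
move: dm Hm dj ej; move: (d i) (d k) (d j) (e i) (e k) (e j) E Hf =>
  di dk dj ei ek ej E Hf dm Hm dj0 ejN dki.
by apply: Hf => l; rewrite E !eexpE; do 3!case: eqP => _; case: dki; lia.
Qed.

End Delta.

Section UnitDelta.
Variables (K : fieldType) (L : option nat).
Notation A := (grass K L).
Implicit Types (e d : eexp) (o p : oexp).

Lemma gpow1 (n : int) : gpow (1 : A) n = 1.
Proof.
case: n => m; rewrite /gpow ?expr1n //.
have -> : ginv (1 : A) = 1; last by rewrite expr1n.
by rewrite -[LHS]mul1r mulr_ginv // body1 oner_neq0.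
Qed.

Variables (i j k : evar) (c : A).
Hypotheses (ij : i != j) (ik : i != k) (jk : j != k) (gc : geven c).

Let shiftE s e o : shift (xe k 1) (sdelta i j k c s) e o
  = lpow i j 1 (- 1) c (- e k) (e - xe k (e k)) o *~ s ^+ absz (- e k).
Proof.
rewrite /shift /sdelta.
have -> : (e - xe k 1) k = e k - 1 by rewrite !eexpE eqxx.
have -> : - (e k - 1) - 1 = - e k by lia.
have -> // : e - xe k 1 - xe k (e k - 1) = e - xe k (e k).
by rewrite -addrA -opprD -xeD; congr (e - xe k _); lia.
Qed.

(** [x_i - x_j + c phi_1 phi_2] acts on the delta function as [x_k]. *)
Lemma sdelta_shift :
  formopA i j (1, - 1, c) (sdelta i j k c 1) = shift (xe k 1) (sdelta i j k c 1).
Proof.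
apply: series_ext => e o; rewrite shiftE (sdelta_step 1 ij ik jk gc e o).
by rewrite !expr1n.
Qed.

Lemma sdelta_shiftN :
  formopA j i (1, - 1, - c) (sdelta i j k c (- 1))
  = shift (xe k 1) (sdelta i j k c (- 1)).
Proof.
apply: series_ext => e o.
have E : formopA j i (1, - 1, - c) (sdelta i j k c (- 1)) e o
    = - formopA i j (1, - 1, c) (sdelta i j k c (- 1)) e o.
  exact: formopA_opp.
rewrite E shiftE (sdelta_step (- 1) ij ik jk gc e o) -mulrNz.
apply: (f_equal (intmul _)); rewrite -signr_odd -[RHS]signr_odd.
have -> : odd (absz (- e k - 1)) = ~~ odd (absz (- e k)) by lia.
by case: odd.
Qed.

(** The residue in [x_i]: a nonnegative power of [x_i - x_j] has no pole, and
    in the other powers only the leading term of the inverse has exponent -1;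
    the odd term is a derivative. *)
Lemma sdelta_residue e o : e i = - 1 -> sdelta i j k c 1 e o = scst 1 (e + xe i 1) o.
Proof.
move=> ei; rewrite /sdelta expr1n mulr1z.
have E n e' : e' i = - 1 -> lexp i j (1 : A) (- 1) n e'
    = if (n == - 1) && (e' == xe i (- 1)) then 1 else 0.
  move=> ei'; rewrite /lexp gpow1 mul1r.
  case: ifP => [/andP[ej /eqP E]|H].
    have nq : n = e' j - 1.
      by move: ei'; rewrite {1}E !eexpE eqxx (negbTE ij); lia.
    case q : (e' j) ej => [[|m]|//] _.
      rewrite q /= in nq *; rewrite nq expr0 E q nq !eqxx /= addr0.
      by rewrite [xe j _]xe0 addr0 eqxx bin0 expr0 mulr1 mulr1z.
    rewrite (_ : zbin n _ = 0) ?mulr0z; last first.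
      by rewrite nq q (_ : Posz m.+1 - 1 = m%:Z) ?zbin_small //; lia.
    by rewrite ifF // nq q; apply/negbTE; rewrite negb_and; apply/orP; left; lia.
  rewrite ifF //; apply: contraFF H => /andP[/eqP -> /eqP ->].
  have ji : (j == i) = false by rewrite eq_sym (negbTE ij).
  by rewrite !eexpE ji /= xe0 addr0 subr0 eqxx.
have ei' : (e - xe k (e k)) i = - 1 by rewrite !eexpE (negbTE ik) subr0.
rewrite /lpow !E // /scst.
have e0 : (e + xe i 1 == 0) = (- e k - 1 == - 1) && (e - xe k (e k) == xe i (- 1)).
  apply/eqP/andP => [E0|[/eqP ek /eqP E0]].
    have ek : e k = 0.
      have := f_equal (fun d : eexp => d k) E0.
      by rewrite !eexpE [k == i]eq_sym (negbTE ik) addr0 => ->; rewrite ffunE.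
    have eE : e = - xe i 1 by apply/eqP; rewrite -addr_eq0 E0.
    by rewrite ek xe0 subr0 xeN eE eqxx.
  have ek0 : e k = 0 by lia.
  by move: E0; rewrite ek0 xe0 subr0 => ->; rewrite xeN addNr.
rewrite e0; case: (eqVneq o o0) => [_|n0]; first by rewrite andbT.
rewrite andbF; case: ifP => // _.
case: (eqVneq (e k) (- 1)) => [->|ek]; first by rewrite mulr0z.
rewrite ifF ?mulr0 ?mul0rz //.
by apply/negbTE; rewrite negb_and; apply/orP; left; lia.
Qed.

End UnitDelta.

(** * From the Jacobi identity to rational functions *)

(** The relation satisfied by a delta function, solved for [x_i]. *)
Lemma delta_rearrange (A : nzRingType) (M : lmodType A) i j k (c : A) (T : series M) :
  formop i j (1, - 1, - 1) T = shift (xe k 1) T ->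
  formop k j (1, 1, 1 + c) T = formop i k (1, 0, c) T.
Proof.
move=> H; apply: series_ext => e o.
have {}H : T (e - xe k 1) o = formop i j (1, - 1, - 1) T e o by rewrite H.
rewrite !formopE !scale1r scale0r addr0 H formopE !scaleN1r scale1r scalerDl scale1r.
set u := T _ _; set v := T _ _; set w := if _ then _ else _.
rewrite [LHS](AC (3*1*2) ((1*6)*((2*4)*(3*5))))%AC.
by rewrite /= !addNr !addr0.
Qed.

Section Core.
Variables (K : fieldType) (L : option nat).
Notation A := (grass K L).
Implicit Types (e d : eexp) (o p : oexp).

Notation delta1 := (sdelta x1 x2 x0 (- 1 : A) 1).
Notation delta2 := (sdelta x2 x1 x0 (1 : A) (- 1)).
Notation delta3 := (sdelta x1 x0 x2 (- 1 : A) 1).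

Let g1 : geven (1 : A). Proof. exact: geven1. Qed.
Let gN1 : geven (- 1 : A). Proof. exact: gevenN. Qed.
Let g0 : geven (0 : A). Proof. exact: geven0. Qed.

Section Slices.
Variables (M : lmodType A) (N : int).
Implicit Types S : series M.

Lemma delta1_formop S : cvg delta1 S ->
  formop x1 x2 (1, - 1, - 1) (emul delta1 S) = shift (xe x0 1) (emul delta1 S).
Proof.
move=> cS; rewrite -(emul_formopl _ _ _ cS) -emul_shiftl.
exact: (f_equal (fun G => emul G S) (sdelta_shift neq12 neq10 neq20 gN1)).
Qed.

Lemma delta2_formop S : cvg delta2 S ->
  formop x1 x2 (1, - 1, - 1) (emul delta2 S) = shift (xe x0 1) (emul delta2 S).
Proof.
move=> cS; rewrite -(emul_formopl _ _ _ cS) -emul_shiftl.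
exact: (f_equal (fun G => emul G S) (sdelta_shiftN neq21 neq20 neq10 g1)).
Qed.

Lemma delta3_formop S : cvg delta3 S ->
  formop x1 x0 (1, - 1, - 1) (emul delta3 S) = shift (xe x2 1) (emul delta3 S).
Proof.
move=> cS; rewrite -(emul_formopl _ _ _ cS) -emul_shiftl.
exact: (f_equal (fun G => emul G S) (sdelta_shift neq10 neq12 neq02 gN1)).
Qed.

Lemma delta1_slice S n e o :
  (forall e o, S e o != 0 -> e x0 = 0 /\ N <= e x2) -> e x0 = - n%:Z - 1 ->
  emul delta1 S e o = iter n (formop x1 x2 (1, - 1, - 1)) S (e + xe x0 n.+1%:Z) o.
Proof.
move=> HS; apply: slice_neg => //.
  have HS' d p : S d p != 0 -> (d x0 = 0 \/ d x1 = 0) /\ N <= d x2.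
    by move=> /HS[]; split=> //; left.
  by apply: delta1_formop; exact: cvg_sdelta HS'.
move=> {}e {}o; apply: emul_slice; last by move=> d p /HS[].
by move=> d p; exact: sdelta_coef.
Qed.

Lemma delta2_slice S n e o :
  (forall e o, S e o != 0 -> e x0 = 0 /\ N <= e x1) -> e x0 = - n%:Z - 1 ->
  emul delta2 S e o = iter n (formop x1 x2 (1, - 1, - 1)) S (e + xe x0 n.+1%:Z) o.
Proof.
move=> HS; apply: slice_neg => //.
  have HS' d p : S d p != 0 -> (d x0 = 0 \/ d x2 = 0) /\ N <= d x1.
    by move=> /HS[]; split=> //; left.
  by apply: delta2_formop; exact: cvg_sdelta HS'.
move=> {}e {}o; apply: emul_slice; last by move=> d p /HS[].
by move=> d p; exact: sdelta_coef.
Qed.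

(** Taking residues in [x_1] on the right-hand side of the Jacobi identity:
    there [x_1] acts as [x_0 + x_2 + phi_1 phi_2]. *)
Lemma delta3_slice S n e o :
  (forall e o, S e o != 0 -> e x1 = 0 /\ N <= e x0) -> e x1 = - n%:Z - 1 ->
  emul delta3 S e o = iter n (formop x2 x0 (1, 1, 1)) S (e + xe x1 n.+1%:Z) o.
Proof.
move=> HS; apply: slice_neg => //.
  have HS' d p : S d p != 0 -> (d x2 = 0 \/ d x1 = 0) /\ N <= d x0.
    by move=> /HS[]; split=> //; right.
  have cS : cvg delta3 S by exact: cvg_sdelta HS'.
  have H := delta_rearrange 0 (delta3_formop cS).
  by rewrite addr0 formopX in H.
move=> {}e {}o; apply: emul_slice; last by move=> d p /HS[].
by move=> d p; exact: sdelta_residue.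
Qed.
End Slices.
End Core.

Section Bounds.
Variables (A : nzRingType) (M : lmodType A).
Implicit Types (i j k l : evar) (e d : eexp) (o p : oexp) (t : A * A * A).
Implicit Types (S T : series M) (N B : int).

Lemma iter_formop_ge n i j l t N S :
  (forall e o, S e o != 0 -> N <= e l) ->
  forall e o, iter n (formop i j t) S e o != 0 -> N <= e l.
Proof.
move=> H; elim: n => //= n IH e o /formop_neq0[d [p [/IH Hd []]]] E; move: Hd;
  rewrite E ?eexpE; try case: eqP => _; lia.
Qed.

Lemma iter_formop_deg n i j t B S : i != j ->
  (forall e o, S e o != 0 -> e i + e j <= B) ->
  forall e o, iter n (formop i j t) S e o != 0 -> e i + e j <= B + n%:Z.
Proof.
move=> ij H; elim: n => [|n IH] e o; first by rewrite addr0 => /H.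
move=> /formop_neq0[d [p [/IH Hd []]]] E; move: Hd; rewrite E ?eexpE ?eqxx.
- by rewrite eq_sym (negbTE ij); lia.
- by rewrite (negbTE ij); lia.
- by lia.
Qed.

Lemma iter_step n i j t d T :
  formop i j t T = shift d T -> iter n (formop i j t) T = shift (d *+ n) T.
Proof.
move=> H; elim: n => [|n IH]; first by rewrite mulr0n shift0.
by rewrite iterS IH formop_shift H shiftD -mulrSr.
Qed.

Lemma opp2E : (1 - 2%:R = - 1 :> A) * (0 - 2%:R = - 1 - 1 :> A).
Proof. by rewrite sub0r mulr2n !opprD; split=> //; rewrite addrA subrr sub0r. Qed.

End Bounds.

Section Polynomials.
Variables (K : fieldType) (L : option nat).
Notation A := (grass K L).
Implicit Types (e d : eexp) (o p : oexp).

(** Bounds below in each variable and above in the total degree leave finitely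
    many monomials. *)
Lemma spoly_intro i j l (B : int) (p : series A^o) :
  i != j -> l != i -> l != j ->
  (forall e o, p e o != 0 -> e l = 0) -> (forall e o, p e o != 0 -> 0 <= e i) ->
  (forall e o, p e o != 0 -> 0 <= e j) -> (forall e o, p e o != 0 -> e i + e j <= B) ->
  is_spoly i j p.
Proof.
move=> ij li lj Hl Hi Hj HB.
have third k : k != i -> k != j -> k = l.
  move: ij li lj.
  by case: (evarP i) => ->; case: (evarP j) => ->; case: (evarP l) => ->;
     case: (evarP k) => ->; rewrite ?eqxx.
have [s Hs] := box_finite (absz B).
split; last first.
  move=> e o H k; split; last by move=> ki kj; rewrite (third k) //; exact: Hl H.
  case: (eqVneq k i) => [->|ki]; first exact: Hi H.
  case: (eqVneq k j) => [->|kj]; first exact: Hj H.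
  by rewrite (third k) // (Hl _ _ H).
apply: (@sub_finite_set _ _ [set q : eexp * oexp | q \in [seq (e, o) | e <- s, o <- enum {: oexp}]]%classic).
  move=> [e o] /= H; apply/allpairsP; exists (e, o); split => //=; last by rewrite mem_enum.
  apply: Hs => k; have := (Hl _ _ H, Hi _ _ H, Hj _ _ H, HB _ _ H) => -[[[h1 h2] h3] h4].
  case: (eqVneq k i) => [->|ki]; first by lia.
  case: (eqVneq k j) => [->|kj]; first by lia.
  by rewrite (third k) // h1.
exact: finite_seq.
Qed.

Lemma in_S_unitl (b c : A) : geven b -> geven c -> in_S (1, b, c).
Proof. by move=> gb gc; split=> //; [exact: geven1|rewrite body1 oner_neq0]. Qed.

Lemma in_S_unitr (a c : A) : geven a -> geven c -> in_S (a, 1, c).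
Proof. by move=> ga gc; split=> //; [exact: geven1|rewrite body1 oner_neq0 orbT]. Qed.

Lemma all_nseq3 (T : eqType) (P : T -> Prop) a b c (x y z : T) : P x -> P y -> P z ->
  {in nseq a x ++ nseq b y ++ nseq c z, forall t, P t}.
Proof.
by move=> Px Py Pz t; rewrite !mem_cat !mem_nseq => /or3P[] /andP[_ /eqP ->].
Qed.

Lemma formop_inj i j t (S T : series A^o) : i != j -> in_S t ->
  bnd_below j S -> bnd_below j T -> formop i j t S = formop i j t T -> S = T.
Proof.
move=> ij ht hS hT E.
have inv (X : series A^o) : bnd_below j X -> smulA (form_inv i j t) (formop i j t X) = X.
  move=> hX; have H := finv_formop ij ht (in_S_eform ht) hX.
  exact: (etrans H (formop_finv ij ht hX)).
by rewrite -(inv S hS) E (inv T hT).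
Qed.

(** The substitution x_0 = x_1 - x_2 - phi_1 phi_2 in a polynomial is the
    residue in [x_0] of its product with the delta function. *)
Lemma subst_numE (q : series A^o) e o : fin_series q ->
  subst_num q e o
  = if e x0 == 0 then emul (sdelta x1 x2 x0 (- 1 : A) 1) q (e - xe x0 1) o else 0.
Proof.
move=> fq; pose l n := lpow x1 x2 (1 : A) (- 1) (- 1) n.
have gl n : gevens (l n).
  exact: lpow_even _ _ (geven1 _ _) (gevenN (geven1 _ _)) (gevenN (geven1 _ _)) n.
have E d : smulA (fun d' o' => if d' == d - xe x0 (d x0) then q d o' else 0)
            (l (d x0)) e o
    = l (d x0) (e - (d - xe x0 (d x0))) o0 *: q d o
      + if o == o12 then l (d x0) (e - (d - xe x0 (d x0))) o12 *: q d o0 else 0.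
  by rewrite smulA_emul // emul_mono.
have W d p : l (d x0) (e - (d - xe x0 (d x0))) p
    = if e x0 == 0 then sdelta x1 x2 x0 (- 1 : A) 1 (e - xe x0 1 - d) p else 0.
  case: (eqVneq (e x0) 0) => [e0|e0]; last first.
    apply: contrapT => /eqP/lpow_neq0[_ _ [m _ Em]].
    have := f_equal (fun d : eexp => d x0) Em.
    rewrite !eexpE eqxx !(negbTE neq01) !(negbTE neq02) addr0.
    by move/eqP: e0; lia.
  rewrite /sdelta expr1n mulr1z.
  have -> : (e - xe x0 1 - d) x0 = - 1 - d x0 by rewrite !eexpE eqxx e0; lia.
  have -> : - (- 1 - d x0) - 1 = d x0 by lia.
  have -> // : e - xe x0 1 - d - xe x0 (- 1 - d x0) = e - (d - xe x0 (d x0)).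
  have H (b : bool) (x y z : int) : x - (if b then 1 else 0) - y - (if b then - 1 - z else 0)
    = x - (y - (if b then z else 0)) by case: b; lia.
  by apply/ffunP => k; rewrite !eexpE H.
rewrite /subst_num -/l (eq_fsbigr (fun d =>
   l (d x0) (e - (d - xe x0 (d x0))) o0 *: q d o
      + (if o == o12 then l (d x0) (e - (d - xe x0 (d x0))) o12 *: q d o0 else 0))) //.
have fW (G : eexp -> A) p : fin_supp (fun d => G d *: q d p).
  have [s Hs] := fq; exists s => d H; apply: (Hs d p).
  by apply: contraNneq H => ->; rewrite scaler0.
have C p r : \sum_(d \in [set: eexp]) l (d x0) (e - (d - xe x0 (d x0))) p *: q d r
   = if e x0 == 0 then conv (sdelta x1 x2 x0 (- 1 : A) 1) q p r (e - xe x0 1) else 0.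
  rewrite /conv -[X in if _ then X else _](fsum_reflect _ (e - xe x0 1)).
  case: (e x0 == 0) W => W; last by apply: fsbig1 => d _; rewrite W scale0r.
  by apply: eq_fsbigr => d _; rewrite W subKr.
rewrite /emul fsumD; last 2 first.
- exact: fW.
- case: (o == o12); first exact: fW.
  by exists fset0 => d; rewrite eqxx.
rewrite C; case: (o == o12).
  by rewrite C; case: (e x0 == 0); [|exact: addr0].
rewrite fsbig1; last by [].
by case: (e x0 == 0); [|exact: addr0].
Qed.

End Polynomials.

Section ResidueCalculus.
Variables (A : nzRingType) (M : lmodType A).
Implicit Types (e d : eexp) (o p : oexp) (S T : series M).

Lemma central1 : central (1 : A). Proof. by move=> x; rewrite mul1r mulr1. Qed.
Lemma central0 : central (0 : A). Proof. by move=> x; rewrite mul0r mulr0. Qed.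

Lemma iter_formopXY m n i j S :
  iter m (formop i j (1, 0, 0)) (iter n (formop i j (0, 1, 0)) S)
  = shift (xe i m) (shift (xe j n) S).
Proof. by rewrite iter_formopX iter_formopY !xeMn. Qed.

Lemma iter_formopYX m n i j S :
  iter m (formop i j (0, 1, 0)) (iter n (formop i j (1, 0, 0)) S)
  = shift (xe j m) (shift (xe i n) S).
Proof. by rewrite iter_formopX iter_formopY !xeMn. Qed.

Lemma iter_formop_shift2 n i j (t : A * A * A) d d' S :
  iter n (formop i j t) (shift d (shift d' S))
  = shift d' (shift d (iter n (formop i j t) S)).
Proof. by rewrite !iter_formop_shift shiftC. Qed.

Lemma iter_formop_conj i j n S :
  iter n.+1 (formop i j (1, 1, - 1)) S
  = iter n (formop i j (1, 1, 1)) (formop i j (1, 1, 1 - 2%:R *+ n.+1) S).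
Proof. by rewrite -iter_formop_odd ?opp2E; first done; exact: central1. Qed.

Lemma iter_formop_conjX i j n S :
  iter n.+1 (formop i j (1, 0, - 1 - 1)) S
  = shift (xe i n) (formop i j (1, 0, 0 - 2%:R *+ n.+1) S).
Proof.
rewrite -opp2E iter_formop_odd; [|exact: central1|exact: central0|exact: central0].
by rewrite iter_formopX xeMn.
Qed.

(** The residue in [x_1] of a multiple of [cP] only involves coefficients with a
    small exponent of [x_1], where [cP] may be replaced by [cR]; on [cR], [x_1]
    acts as [x_0 + x_2 + phi_1 phi_2].  The form with [0 - 2 (n+1)] is the one
    that turns a power of [x_0 + x_2 + phi_1 phi_2] into one of
    [x_0 + x_2 - phi_1 phi_2]. *)
Lemma residue_formop n (cP cR S : series M) :
  (forall e o, e x1 <= - n%:Z - 1 -> cP e o = cR e o) ->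
  formop x1 x0 (1, - 1, - 1) cR = shift (xe x2 1) cR ->
  (forall e o, e x1 = - 1 -> cR e o = S (e + xe x1 1) o) ->
  forall e o, e x1 = - 1 ->
  formop x1 x2 (1, 0, 0 - 2%:R *+ n.+1)
    (shift (xe x1 n) (shift (xe x2 n) (shift (xe x0 n) cP))) e o
  = shift (xe x0 n) (shift (xe x2 n) (iter n.+1 (formop x2 x0 (1, 1, - 1)) S))
      (e + xe x1 1) o.
Proof.
move=> PR HR RS e o e1; pose c : A := 0 - 2%:R *+ n.+1.
have F c' : formop x2 x0 (1, 1, 1 + c') cR = formop x1 x2 (1, 0, c') cR.
  exact: delta_rearrange.
have R1 : iter n (formop x2 x0 (1, 1, 1)) cR = shift (xe x1 n) cR.
  by have := F 0; rewrite addr0 formopX => /(iter_step n) ->; rewrite xeMn.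
transitivity (formop x1 x2 (1, 0, c)
    (shift (xe x1 n) (shift (xe x2 n) (shift (xe x0 n) cR))) e o).
  rewrite !formopE !scale0r !addr0 /shift !PR //;
  by rewrite !eexpE !eqxx e1 /= !(negbTE neq12) !(negbTE neq10) /=; lia.
rewrite -/c !formop_shift -F.
have -> : 1 + c = 1 - 2%:R *+ n.+1 by rewrite /c sub0r.
rewrite (shiftC (xe x2 n) (xe x0 n)) (shiftC (xe x1 n) (xe x0 n)).
rewrite (shiftC (xe x1 n) (xe x2 n)) -formop_shift -R1.
rewrite -iter_formopC; last by split; exact: central1.
rewrite -iter_formop_conj /shift.
rewrite (@iter_formop_agree _ _ n.+1 x2 x0 x1 (- 1) _ cR (shift (- xe x1 1) S)) //; first last.
- by rewrite !eexpE (negbTE neq12) (negbTE neq10) !subr0.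
- by move=> d p /RS ->; rewrite /shift opprK.
rewrite iter_formop_shift /shift opprK.
by rewrite addrAC [e - _ + _]addrAC.
Qed.

(** A series on which [x_1 - x_2 - phi_1 phi_2] acts as [x_0] is determined by
    its residue in [x_1]: downwards in [x_1] by multiplication with
    [x_0 + x_2 + phi_1 phi_2], upwards by its injectivity. *)
Lemma residue_determines S T T' :
  (forall X Y : series M, bnd_below x2 X -> bnd_below x2 Y ->
    formop x0 x2 (1, 1, 1) X = formop x0 x2 (1, 1, 1) Y -> X = Y) ->
  formop x1 x2 (1, - 1, - 1) T = shift (xe x0 1) T ->
  formop x1 x2 (1, - 1, - 1) T' = shift (xe x0 1) T' ->
  bnd_below x2 T -> bnd_below x2 T' ->
  (forall e o, e x1 = - 1 -> T e o = S (e + xe x1 1) o) ->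
  (forall e o, e x1 = - 1 -> T' e o = S (e + xe x1 1) o) ->
  T = T'.
Proof.
move=> inj HT HT' bT bT' TS TS'.
have Y (X : series M) : formop x1 x2 (1, - 1, - 1) X = shift (xe x0 1) X ->
    formop x0 x2 (1, 1, 1) X = shift (xe x1 1) X.
  by move/(delta_rearrange 0); rewrite addr0 formopX.
(* Upwards: [R] keeps the terms with exponent m of [x_1]. *)
have up m : forall e o, e x1 = m%:Z - 1 -> T e o = T' e o.
  elim: m => [|m IH] e o em; first by rewrite TS ?TS' //; rewrite em.
  pose R (X : series M) : series M := fun e o => if e x1 == m%:Z then X e o else 0.
  have bR X : bnd_below x2 X -> bnd_below x2 (R X).
    move=> [N HN]; exists N => d p; rewrite /R; case: ifP => _; [exact: HN|by rewrite eqxx].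
  have FR X : formop x1 x2 (1, - 1, - 1) X = shift (xe x0 1) X ->
      formop x0 x2 (1, 1, 1) (R X)
      = fun e o => if e x1 == m%:Z then X (e - xe x1 1) o else 0.
    move=> /Y EX; apply: series_ext => d p.
    have {}EX : formop x0 x2 (1, 1, 1) X d p = X (d - xe x1 1) p by rewrite EX.
    rewrite -EX !formopE /R !eexpE (negbTE neq10) (negbTE neq12) !subr0.
    by case: (d x1 == _); rewrite // !scaler0 !if_same !scaler0 !addr0.
  have RE : R T = R T'.
    apply: inj; [exact: bR|exact: bR|rewrite !FR //].
    apply: series_ext => d p; case: eqP => // dm; apply: IH.
    by rewrite eexpB xeE eqxx dm.
  have := f_equal (fun X : series M => X e o) RE.
  by rewrite /R; case: eqP => // -[]; rewrite em; lia.
apply: series_ext => e o; case: (boolP (0 <= e x1)) => e1.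
  apply: (up (absz (e x1 + 1))); lia.
have e1' : e x1 = - (absz (e x1 + 1))%:Z - 1 by lia.
by rewrite (slice_neg neq10 neq12 (Y _ HT) TS o e1') (slice_neg neq10 neq12 (Y _ HT') TS' o e1').
Qed.

End ResidueCalculus.

Section Associativity.
Variables (K : fieldType) (L : option nat).
Notation A := (grass K L).
Implicit Types (e d : eexp) (o p : oexp).

Notation delta1 := (sdelta x1 x2 x0 (- 1 : A) 1).
Notation delta2 := (sdelta x2 x1 x0 (1 : A) (- 1)).
Notation delta3 := (sdelta x1 x0 x2 (- 1 : A) 1).

Let g1 : geven (1 : A). Proof. exact: geven1. Qed.
Let gN1 : geven (- 1 : A). Proof. exact: gevenN. Qed.
Let g0 : geven (0 : A). Proof. exact: geven0. Qed.

(** The matrix coefficients of product, opposite product and iterate, with the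
    bounds on their exponents.  Such triples can be added, so that vectors of
    inhomogeneous sign need no separate argument. *)
Definition jacobi_triple (n : nat) (B : int) (P Q I : series A^o) : Prop :=
  [/\ forall e o, P e o != 0 -> [/\ e x0 = 0, - n%:Z <= e x2 & e x1 + e x2 <= B],
      forall e o, Q e o != 0 -> e x0 = 0 /\ - n%:Z <= e x1,
      forall e o, I e o != 0 -> [/\ e x1 = 0, - n%:Z <= e x0 & e x2 + e x0 <= B] &
      forall e o, emul delta1 P e o - emul delta2 Q e o = emul delta3 I e o].

Variables (n : nat) (B : int) (P Q I : series A^o).
Hypothesis H : jacobi_triple n B P Q I.

Let HP e o : P e o != 0 -> [/\ e x0 = 0, - n%:Z <= e x2 & e x1 + e x2 <= B].
Proof. by case: H => h _ _ _; exact: h. Qed.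
Let HQ e o : Q e o != 0 -> e x0 = 0 /\ - n%:Z <= e x1.
Proof. by case: H => _ h _ _; exact: h. Qed.
Let HI e o : I e o != 0 -> [/\ e x1 = 0, - n%:Z <= e x0 & e x2 + e x0 <= B].
Proof. by case: H => _ _ h _; exact: h. Qed.
Let HJ e o : emul delta1 P e o - emul delta2 Q e o = emul delta3 I e o.
Proof. by case: H => _ _ _ h; exact: h. Qed.
Let HP' e o : P e o != 0 -> e x0 = 0 /\ - n%:Z <= e x2.
Proof. by case/HP. Qed.
Let HI' e o : I e o != 0 -> e x1 = 0 /\ - n%:Z <= e x0.
Proof. by case/HI. Qed.

Let cP : series A^o := emul delta1 P.
Let cQ : series A^o := emul delta2 Q.
Let cR : series A^o := emul delta3 I.

(** Weak commutativity: the right-hand side of the Jacobi identity has poles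
    of bounded order in [x_0]. *)
Lemma weak_commutativity :
  iter n (formop x1 x2 (1, - 1, - 1)) P = iter n (formop x1 x2 (1, - 1, - 1)) Q.
Proof.
apply: series_ext => e o; case: (eqVneq (e x0) 0) => [e0|e0]; last first.
  have Z (S : series A^o) : (forall e o, S e o != 0 -> e x0 = 0) ->
      iter n (formop x1 x2 (1, - 1, - 1)) S e o = 0.
    move=> HS; apply: contrapT => /eqP.
    move/(iter_formop_supp (P := fun v => v = 0) neq01 neq02 HS) => E0.
    by rewrite E0 eqxx in e0.
  by rewrite !Z // => d p => [/HQ[]|/HP[]].
(* The coefficients of x_0^-n-1, where the iterate does not contribute. *)
pose e' := e - xe x0 n.+1%:Z.
have ee' : e = e' + xe x0 n.+1%:Z by rewrite /e' subrK.
have e'0 : e' x0 = - n%:Z - 1 by rewrite /e' !eexpE eqxx e0; lia.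
rewrite ee' -(delta1_slice _ HP' e'0) -(delta2_slice _ HQ e'0).
apply/eqP; rewrite -subr_eq0 HJ; apply/eqP; apply: contrapT => /eqP.
move=> /emul_neq0[d [p [q [/(sdelta_neq0 neq02)[d0 _] /HI'[_]]]]].
by rewrite eexpB e'0; lia.
Qed.

(** The opposite product has no large negative powers of [x_1]. *)
Lemma cP_cR e o : e x1 <= - n%:Z - 1 -> cP e o = cR e o.
Proof.
move=> e1; suff Q0 : cQ e o = 0.
  have E : cP e o - cQ e o = cR e o by exact: HJ.
  rewrite Q0 in E.
  exact: (etrans (esym (subr0 (cP e o))) E).
apply: contrapT => /eqP.
move=> /emul_neq0[d [p [q [/(sdelta_neq0 neq10)[d0 _] /HQ[_]]]]].
by rewrite eexpB; lia.
Qed.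

Definition den1 : seq (sform K L) :=
  nseq n (1, 0, 0) ++ nseq n (0, 1, 0) ++ nseq n (1, - 1, - 1).

(** The inverse of [x_0 + x_2 + phi_1 phi_2] has to be written with powers of
    [x_0 + x_2 - phi_1 phi_2], which costs one more factor. *)
Definition den2 : seq (sform K L) :=
  nseq n (0, 1, 0) ++ nseq n (1, 0, 0) ++ nseq n.+1 (1, 1, - 1).

Definition num1 : series A^o := opden x1 x2 den1 P.
Definition num2 : series A^o := opden x2 x0 den2 I.

Lemma den1_inS : {in den1, forall t, in_S t}.
Proof.
apply: (all_nseq3 (P := @in_S K L)).
- exact: in_S_unitl.
- exact: in_S_unitr.
- exact: in_S_unitl.
Qed.

Lemma den2_inS : {in den2, forall t, in_S t}.
Proof.
apply: (all_nseq3 (P := @in_S K L)).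
- exact: in_S_unitr.
- exact: in_S_unitl.
- exact: in_S_unitl.
Qed.

Lemma num1E : num1 = shift (xe x1 n) (shift (xe x2 n)
  (iter n (formop x1 x2 (1, - 1, - 1)) P)).
Proof. by rewrite /num1 /den1 !opden_cat !opden_nseq; exact: iter_formopXY. Qed.

Lemma num2E : num2 = shift (xe x0 n) (shift (xe x2 n)
  (iter n.+1 (formop x2 x0 (1, 1, - 1)) I)).
Proof. by rewrite /num2 /den2 !opden_cat !opden_nseq; exact: iter_formopYX. Qed.

Let cvg1 (S : series A^o) : (forall e o, S e o != 0 -> e x0 = 0 /\ - n%:Z <= e x2) ->
  cvg delta1 S.
Proof.
move=> HS.
have HS' d p : S d p != 0 -> (d x0 = 0 \/ d x1 = 0) /\ - n%:Z <= d x2.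
  by move=> /HS[]; split=> //; left.
exact: cvg_sdelta HS'.
Qed.

Let cvg3 : cvg delta3 I.
Proof.
have HS' d p : I d p != 0 -> (d x2 = 0 \/ d x1 = 0) /\ - n%:Z <= d x0.
  by move=> /HI'[]; split=> //; right.
exact: cvg_sdelta HS'.
Qed.

Lemma neq0_shift (S : series A^o) d e o : shift d S e o != 0 -> S (e - d) o != 0.
Proof. by []. Qed.

Let num1_supp e o : num1 e o != 0 ->
  [/\ e x0 = 0, 0 <= e x1, 0 <= e x2 & e x1 + e x2 <= B + n%:Z * 3].
Proof.
pose X := iter n (formop x1 x2 (1, - 1, - 1)) P.
have X0 d p : X d p != 0 -> d x0 = 0.
  by move/(iter_formop_supp (P := fun v => v = 0) neq01 neq02); apply=> {}d {}p /HP[].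
have X1 d p : X d p != 0 -> - n%:Z <= d x1.
  by rewrite /X weak_commutativity; apply: iter_formop_ge => {}d {}p /HQ[].
have X2 d p : X d p != 0 -> - n%:Z <= d x2.
  by apply: iter_formop_ge => {}d {}p /HP[].
have X3 d p : X d p != 0 -> d x1 + d x2 <= B + n%:Z.
  by apply: iter_formop_deg => // {}d {}p /HP[].
rewrite num1E -/X => /neq0_shift/neq0_shift E.
move: (X0 _ _ E) (X1 _ _ E) (X2 _ _ E) (X3 _ _ E).
rewrite !eexpE !eqxx (negbTE neq01) (negbTE neq02) (negbTE neq12) (negbTE neq21).
by move=> *; split; lia.
Qed.

Lemma num1_spoly : is_spoly x1 x2 num1.
Proof.
by apply: (spoly_intro (l := x0) (B := B + n%:Z * 3)) => // e o /num1_supp[].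
Qed.

(** The bound on negative powers of [x_2] is not visible in the iterate itself; it
    comes from the product through the residue in [x_1]. *)
Lemma iter_formop_I_x2 m e o :
  iter m (formop x2 x0 (1, 1, 1)) I e o != 0 -> (n <= m)%N -> - n%:Z <= e x2.
Proof.
move=> H0 nm.
have e1 : e x1 = 0.
  by move: H0 => /(iter_formop_supp (P := fun v => v = 0) neq12 neq10); apply=> d p /HI[].
pose e' := e - xe x1 m.+1%:Z.
have ee' : e = e' + xe x1 m.+1%:Z by rewrite /e' subrK.
have e'1 : e' x1 = - m%:Z - 1 by rewrite /e' !eexpE eqxx e1; lia.
move: H0; rewrite {1}ee' -(delta3_slice _ HI' e'1) -/cR -cP_cR; last by rewrite e'1; lia.
move=> /emul_neq0[d [p [q [/(sdelta_neq0 neq20)[d0 _] /HP[_ + _]]]]].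
by rewrite /e' !eexpE (negbTE neq21); lia.
Qed.

Lemma num2_spoly : is_spoly x2 x0 num2.
Proof.
pose X := iter n.+1 (formop x2 x0 (1, 1, - 1)) I.
have X1 e o : X e o != 0 -> e x1 = 0.
  by move/(iter_formop_supp (P := fun v => v = 0) neq12 neq10); apply=> d p /HI[].
have X0 e o : X e o != 0 -> - n%:Z <= e x0.
  by apply: iter_formop_ge => d p /HI[].
have X2 e o : X e o != 0 -> - n%:Z <= e x2.
  rewrite /X iter_formop_conj iter_formopC; last by split; exact: central1.
  apply: (iter_formop_ge (n := 1)) => d p Hd; exact: iter_formop_I_x2 Hd _.
have X3 e o : X e o != 0 -> e x2 + e x0 <= B + n.+1%:Z.
  by apply: iter_formop_deg => // d p /HI[].
have E : num2 = shift (xe x0 n) (shift (xe x2 n) X) := num2E.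
have supp d p : num2 d p != 0 ->
    [/\ d x1 = 0, 0 <= d x2, 0 <= d x0 & d x2 + d x0 <= B + n%:Z * 3 + 1].
  rewrite E => /neq0_shift/neq0_shift h.
  move: (X0 _ _ h) (X1 _ _ h) (X2 _ _ h) (X3 _ _ h).
  rewrite !eexpE !eqxx (negbTE neq10) (negbTE neq12) (negbTE neq02) (negbTE neq20).
  by move=> *; split; lia.
apply: (spoly_intro (B := B + n%:Z * 3 + 1) neq20 neq12 neq10) => e o h;
  case: (supp _ _ h) => h1 h2 h3 h4.
- exact: h1.
- exact: h2.
- exact: h3.
- exact: h4.
Qed.

Let num1' : series A^o := formop x1 x2 (1, 0, 0 - 2%:R *+ n.+1) num1.

Let num1'_supp e o : num1' e o != 0 ->
  [/\ e x0 = 0, 0 <= e x1, 0 <= e x2 & e x1 + e x2 <= B + n%:Z * 3 + 1].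
Proof.
move=> E; split.
- move: e o E; apply: (formop_supp (P := fun v => v = 0) neq01 neq02).
  by move=> e o /num1_supp[].
- by move: e o E; apply: (@iter_formop_ge _ _ 1) => e o /num1_supp[].
- by move: e o E; apply: (@iter_formop_ge _ _ 1) => e o /num1_supp[].
- by move: e o E; apply: (@iter_formop_deg _ _ 1) => // e o /num1_supp[].
Qed.

Let num1'_spoly : is_spoly x1 x2 num1'.
Proof.
apply: (spoly_intro (B := B + n%:Z * 3 + 1) neq12 neq01 neq02) => e o h;
  case: (num1'_supp h) => h1 h2 h3 h4.
- exact: h1.
- exact: h2.
- exact: h3.
- exact: h4.
Qed.

(** Multiplied by the delta function, both numerators have the same residue in
    [x_1]; the extra form in [num1'] accounts for the denominators. *)
Lemma subst_num2 : subst_num num2 = num1'.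
Proof.
have [f2 b2] := spoly_fin num2_spoly.
have [f1' b1'] := spoly_fin num1'_spoly.
have d1j : exists N : int, forall e o, delta1 e o != 0 -> N <= e x2.
  by exists 0 => e o /(sdelta_neq0 neq20)[].
have HR e o : e x1 = - 1 -> cR e o = I (e + xe x1 1) o.
  by move=> e1; apply: (delta3_slice (n := 0) _ HI').
have X0 m d p : iter m (formop x1 x2 (1, - 1, - 1)) P d p != 0 -> d x0 = 0.
  by move/(iter_formop_supp (P := fun v => v = 0) neq01 neq02); apply=> {}d {}p /HP[].
have X2 m d p : iter m (formop x1 x2 (1, - 1, - 1)) P d p != 0 -> - n%:Z <= d x2.
  by apply: iter_formop_ge => {}d {}p /HP[].
have cI m : cvg delta1 (iter m (formop x1 x2 (1, - 1, - 1)) P).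
  by apply: cvg1 => d p h; split; [exact: X0 h|exact: X2 h].
have TE : emul delta1 num1' = formop x1 x2 (1, 0, 0 - 2%:R *+ n.+1)
    (shift (xe x1 n) (shift (xe x2 n) (shift (xe x0 n) cP))).
  have [f1 _] := spoly_fin num1_spoly.
  have c1 : cform (1 : A, 0 : A, 0 - 2%:R *+ n.+1 : A).
    apply: eform_c; split => //; apply: gevenB => //.
    exact: (gevenMz n.+1%:Z (gevenMz 2%:Z g1)).
  rewrite /num1' (emul_formopr _ _ c1 (cvg_fin_series _ f1)).
  apply: (f_equal (@formop A A^o x1 x2 _)).
  rewrite num1E !emul_shiftr; apply: (f_equal (shift _)); apply: (f_equal (shift _)).
  have cN1 : cform (1 : A, - 1 : A, - 1 : A) by apply: eform_c; split.
  rewrite (emul_iter n cN1 (cI 0%N) cI).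
  by rewrite (iter_step n (delta1_formop (cI 0%N))) xeMn.
have E : emul delta1 num1' = emul delta1 (num2 : series A^o).
  apply: (@residue_determines _ _ num2).
  - move=> X Y bX bY; apply: formop_inj => //; exact: in_S_unitl.
  - by apply: delta1_formop; exact: cvg_fin_series.
  - by apply: delta1_formop; exact: cvg_fin_series.
  - exact: bnd_emul.
  - exact: bnd_emul.
  - move=> e o e1; rewrite TE num2E.
    exact: (residue_formop cP_cR (delta3_formop cvg3) HR o e1).
  - move=> e o; apply: emul_slice; last by move=> d p; case: num2_spoly => _ h /h/(_ x1)[_]; apply.
    by move=> d p; exact: sdelta_residue.
apply: series_ext => e o; apply: (etrans (subst_numE e o f2)).
case: (eqVneq (e x0) 0) => [e0|e0]; last first.
  apply/esym; apply: contrapT => /eqP/num1'_supp[h _ _ _].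
  by rewrite h eqxx in e0.
rewrite -(f_equal (fun X => X (e - xe x0 1) o) E).
have e1 : (e - xe x0 1) x0 = - 1 by rewrite !eexpE eqxx e0.
have d1 d p : d x0 = - 1 -> delta1 d p = scst 1 (d + xe x0 1) p by exact: sdelta_coef.
have s1 d p : num1' d p != 0 -> d x0 = 0 by case/num1'_supp.
apply: (etrans (emul_slice o d1 s1 e1)).
by rewrite subrK.
Qed.

Let den1_eform : {in den1, forall t, eform t}.
Proof. by move=> t /den1_inS/in_S_eform. Qed.

Lemma subst_den2 : map (@subst_form K L) den2
  = nseq n (1, - 1, - 1) ++ nseq n (0, 1, 0) ++ nseq n.+1 (1, 0, - 1 - 1).
Proof. by rewrite /den2 !map_cat !map_nseq /subst_form !subr0 !sub0r subrr. Qed.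

(** In the variables [x_1, x_2] the form [x_0 + x_2 - phi_1 phi_2] becomes
    [x_1 - 2 phi_1 phi_2], whose (n+1)-st power is [x_1^n] times the extra form in
    [num1']. *)
Lemma subst_den2_num1 : opden x1 x2 (map (@subst_form K L) den2) num1 = opden x1 x2 den1 num1'.
Proof.
rewrite subst_den2 /den1 !opden_cat !opden_nseq.
set y := formop x1 x2 (1, - 1, - 1).
transitivity (iter n y (shift (xe x2 n) (shift (xe x1 n) num1'))).
  apply: (f_equal (iter n y)).
  rewrite iter_formopY xeMn; apply: (f_equal (shift _)).
  exact: iter_formop_conjX.
apply: (etrans (iter_formop_shift2 _ _ _ _ _ _ _)).
by apply/esym; exact: iter_formopXY.
Qed.

Lemma associativity_of_triple : exists f g : sfrac K L,
  [/\ is_iota_inv x1 x2 P f, f.2 = den1, is_iota_inv x2 x0 I g, g.2 = den2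
    & sfrac_eq x1 x2 f (subst_x0 g)].
Proof.
exists (num1, den1), (num2, den2); split.
- apply: (iota_invP neq12); [split; [exact: num1_spoly|exact: den1_inS]| |by []].
  by exists (- n%:Z) => e o /HP[].
- by [].
- apply: (iota_invP neq20); [split; [exact: num2_spoly|exact: den2_inS]| |by []].
  by exists (- n%:Z) => e o /HI[].
- by [].
rewrite /subst_x0 /fst /snd subst_num2.
apply: sfrac_eqP; [exact: num1_spoly|exact: num1'_spoly|exact: den1_eform| |].
  rewrite /snd subst_den2; apply: (all_nseq3 (P := @eform K L)).
  - exact: (in_S_eform (in_S_unitl gN1 gN1)).
  - exact: (in_S_eform (in_S_unitr g0 g0)).
  - exact: (in_S_eform (in_S_unitl g0 (gevenB gN1 g1))).
exact: subst_den2_num1.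
Qed.

End Associativity.

(** * Vertex operators as series *)

Definition additive_fun (U W : zmodType) (f : U -> W) : Prop :=
  forall x y, f (x + y) = f x + f y.

Section AdditiveFun.
Variables (U W : zmodType) (f : U -> W).
Hypothesis fD : additive_fun f.

Lemma add_fun0 : f 0 = 0.
Proof. by apply: (addrI (f 0)); rewrite -fD !addr0. Qed.

Lemma add_funN x : f (- x) = - f x.
Proof. by apply: (addrI (f x)); rewrite -fD !subrr add_fun0. Qed.

Lemma add_funMz x (n : int) : f (x *~ n) = f x *~ n.
Proof.
have H m : f (x *+ m) = f x *+ m.
  by elim: m => [|m IH]; rewrite ?mulr0n ?add_fun0 // !mulrS fD IH.
by case: n => m /=; [exact: H|rewrite add_funN; congr (- _); exact: H].
Qed.
End AdditiveFun.

Section VertexSeries.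
Variables (K : fieldType) (L : option nat) (V : lmodType (grass K L)).
Notation A := (grass K L).
Variables (D : nsdata V) (hD : is_nsvosa D).
Implicit Types (u v w x y : V) (i j : evar) (e d : eexp) (o p q : oexp) (s : bool).

Let hG := nsv_graded hD.

Lemma YcoefDl s n w : additive_fun (fun u => Ycoef D u s n w).
Proof. by move=> u v; exact: (nsv_addl hD). Qed.

Lemma YcoefDr u s n : additive_fun (Ycoef D u s n).
Proof. by move=> v w; exact: (nsv_addr hD). Qed.

Lemma Ycoef0l s n w : Ycoef D 0 s n w = 0.
Proof. exact: (add_fun0 (YcoefDl s n w)). Qed.

Lemma Ycoef0r u s n : Ycoef D u s n 0 = 0.
Proof. exact: (add_fun0 (YcoefDr u s n)). Qed.

Lemma sgD k : additive_fun (fun v => sg D v k).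
Proof. by move=> u v; exact: (sg_additive hG). Qed.

Lemma vconjD : additive_fun (vconj D).
Proof.
by move=> u v; rewrite /vconj !(sg_additive hG) opprD addrACA.
Qed.

Lemma vconj_sign b v : of_sign D b v -> vconj D v = v *~ (-1) ^+ b.
Proof.
rewrite /of_sign /vconj => E; have E' : sg D v (~~ b) = 0.
  by rewrite -E (sg_proj hG); case: b {E}.
by case: b E E' => /= -> ->; rewrite ?sub0r ?subr0 ?expr1 ?mulrN1z.
Qed.

Lemma optwistD b (f : V -> V) : additive_fun f -> additive_fun (optwist D b f).
Proof. by case: b => //= fD u v; rewrite vconjD fD vconjD. Qed.

Lemma optwist_addl b (f g h : V -> V) x : (forall x, f x = g x + h x) ->
  optwist D b f x = optwist D b g x + optwist D b h x.
Proof. by case: b => //= E; rewrite E vconjD. Qed.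

(** Conjugation by the sign involution is the sign that an operator picks up when
    an odd variable passes through it. *)
Lemma optwist_sign (a : bool) u s n x : of_sign D a u ->
  optwist D true (Ycoef D u s n) x = Ycoef D u s n x *~ (-1) ^+ (a (+) s).
Proof.
move=> uj; have xE := sg_sum hG x; rewrite /= [in LHS]xE [in RHS]xE.
have kodd : odd (absz (- (n + 1) * 2 - s%:Z)%R) = s by case: s; lia.
have E b : vconj D (Ycoef D u s n (vconj D (sg D x b)))
         = Ycoef D u s n (sg D x b) *~ (-1) ^+ (a (+) s).
  have xb : of_sign D b (sg D x b) by rewrite /of_sign (sg_proj hG) eqxx.
  rewrite (vconj_sign xb) (add_funMz (YcoefDr u s n)) (add_funMz vconjD).
  have := nsv_sign hD (- (n + 1) * 2 - s%:Z)%R uj xb; rewrite kodd => /vconj_sign ->.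
  by rewrite -mulrzA -[LHS]/(_ *~ _); congr (_ *~ _); case: a s b {uj kodd xb} => -[] [].
by rewrite vconjD (YcoefDr u s n (vconj D _)) vconjD (YcoefDr u s n (sg D x false)) !E mulrzDl.
Qed.

(** In a product of series one factor of which is a constant, only one pair of odd
    exponents contributes. *)
Lemma pick_left (F : oexp -> oexp -> V) r o :
  (forall p q, p != o0 -> F p q = 0) ->
  \sum_(p : oexp * oexp | oadd (oadd p.1 r) p.2 == o) F p.1 p.2 = F o0 (oadd r o).
Proof.
move=> F0; rewrite (bigD1 (o0, oadd r o)) /=; last by case: r o => -[] [] [[] []].
rewrite big1 ?addr0 // => -[p q] /= /andP[/eqP E N].
apply: F0; apply: contra N => /eqP p0; move: E; rewrite p0 => <-.
by case: r q => -[] [] [[] []].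
Qed.

Lemma pick_right (F : oexp -> oexp -> V) r o :
  (forall p q, q != o0 -> F p q = 0) ->
  \sum_(p : oexp * oexp | oadd (oadd p.1 r) p.2 == o) F p.1 p.2 = F (oadd o r) o0.
Proof.
move=> F0; rewrite (bigD1 (oadd o r, o0)) /=; last by case: r o => -[] [] [[] []].
rewrite big1 ?addr0 // => -[p q] /= /andP[/eqP E N].
apply: F0; apply: contra N => /eqP p0; move: E; rewrite p0 => <-.
by case: r p {p0} => -[] [] [[] []].
Qed.

Lemma oadd0r o : oadd o o0 = o. Proof. by case: o => -[] []. Qed.

Lemma pick_left0 (F : oexp -> oexp -> V) o :
  (forall p q, p != o0 -> F p q = 0) ->
  \sum_(p : oexp * oexp | oadd p.1 p.2 == o) F p.1 p.2 = F o0 o.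
Proof.
move=> F0; rewrite -[o in RHS]oadd0 -pick_left //.
by apply: eq_bigl => p; rewrite oadd0r.
Qed.

Lemma pick_right0 (F : oexp -> oexp -> V) o :
  (forall p q, q != o0 -> F p q = 0) ->
  \sum_(p : oexp * oexp | oadd p.1 p.2 == o) F p.1 p.2 = F o o0.
Proof.
move=> F0; rewrite -[o in RHS]oadd0r -pick_right //.
by apply: eq_bigl => p; rewrite oadd0r.
Qed.

Lemma Yterm_scst i s o1 o2 u (W : series V) e :
  (forall d p, W d p != 0 -> d i = 0) ->
  Yterm D i s o1 o2 (scst u) W e
  = if o1 == o0 then optwist D (opar o2) (Ycoef D u s (e i)) (W (e - xe i (e i)) o2)
    else 0.
Proof.
move=> W0; rewrite /Yterm (fsum_single (i0 := (0 : eexp, e i))) /=.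
  rewrite /scst eqxx /= subr0; case: (o1 == o0) => //.
  by case: (opar o2); rewrite /= Ycoef0l // (add_fun0 vconjD).
move=> [d n] /=; rewrite -pair_eqE /= negb_and => /orP N.
have op0 b x : optwist D b (Ycoef D 0 s n) x = 0.
  by case: b; rewrite /= Ycoef0l // (add_fun0 vconjD).
rewrite /scst; case: (eqVneq d 0) N => [->|d0] /= N; last exact: op0.
case: (o1 == o0); last exact: op0.
case: N => // nei.
suff -> : W (e - 0 - xe i n) o2 = 0 by rewrite (add_fun0 (optwistD _ (YcoefDr u s n))).
apply: contrapT => /eqP/W0; rewrite !eexpE eqxx.
have -> : (0 : eexp) i = 0 by rewrite ffunE.
by move/eqP: nei; lia.
Qed.

Lemma Yterm_scst_r i s o1 o2 (S : series V) w e :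
  (forall d p, S d p != 0 -> d i = 0) ->
  Yterm D i s o1 o2 S (scst w) e
  = if o2 == o0 then Ycoef D (S (e - xe i (e i)) o1) s (e i) w else 0.
Proof.
move=> S0; rewrite /Yterm (fsum_single (i0 := (e - xe i (e i), e i))) /=.
  rewrite /scst opprB addrA addrC addrA addNr add0r subrr eqxx /=.
  case: (eqVneq o2 o0) => [->|_] //.
  exact: (add_fun0 (optwistD _ (YcoefDr _ _ _))).
move=> [d n] /= N; rewrite /scst.
case: (eqVneq (S d o1) 0) => [->|/S0 di].
  by case: (opar o2); rewrite /= Ycoef0l // (add_fun0 vconjD).
case: eqP => /= [E|_]; last exact: (add_fun0 (optwistD _ (YcoefDr _ _ _))).
have dE : e - xe i n = d by apply/eqP; rewrite -subr_eq0 addrAC E.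
have nE : n = e i by move: di; rewrite -dE !eexpE eqxx; lia.
by rewrite -dE nE eqxx in N.
Qed.

Lemma osgn0 o : osgn o0 o = 1. Proof. by case: o => -[] []. Qed.
Lemma osgn0r o : osgn o o0 = 1. Proof. by case: o => -[] []. Qed.

Lemma Yser_scst i c u (W : series V) e o : (forall d p, W d p != 0 -> d i = 0) ->
  Yser D i c (scst u) W e o
  = optwist D (opar o) (Ycoef D u false (e i)) (W (e - xe i (e i)) o)
  + \sum_(t : bool)
      optwist D (opar (oadd (ovar t) o)) (Ycoef D u true (e i))
        (W (e - xe i (e i)) (oadd (ovar t) o))
      *~ (c t * osgn (ovar t) (oadd (ovar t) o)).
Proof.
move=> W0; rewrite /Yser; congr (_ + _).
  rewrite (pick_left0 (F := fun p q => Yterm D i false p q (scst u) W e *~ osgn p q)).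
    by rewrite Yterm_scst // eqxx osgn0 mulr1z.
  by move=> p q /negbTE p0; rewrite Yterm_scst // p0 mul0rz.
apply: eq_bigr => t _.
rewrite (pick_left (F := fun p q => Yterm D i true p q (scst u) W e
   *~ (c t * osgn p (ovar t) * osgn (oadd p (ovar t)) q))).
  by rewrite Yterm_scst // eqxx osgn0 mulr1 oadd0.
by move=> p q /negbTE p0; rewrite Yterm_scst // p0 mul0rz.
Qed.

Lemma Yser_scst_r i c (S : series V) w e o : (forall d p, S d p != 0 -> d i = 0) ->
  Yser D i c S (scst w) e o
  = Ycoef D (S (e - xe i (e i)) o) false (e i) w
  + \sum_(t : bool)
      Ycoef D (S (e - xe i (e i)) (oadd o (ovar t))) true (e i) w
      *~ (c t * osgn (oadd o (ovar t)) (ovar t)).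
Proof.
move=> S0; rewrite /Yser; congr (_ + _).
  rewrite (pick_right0 (F := fun p q => Yterm D i false p q S (scst w) e *~ osgn p q)).
    by rewrite Yterm_scst_r // eqxx osgn0r mulr1z.
  by move=> p q /negbTE p0; rewrite Yterm_scst_r // p0 mul0rz.
apply: eq_bigr => t _.
rewrite (pick_right (F := fun p q => Yterm D i true p q S (scst w) e
   *~ (c t * osgn p (ovar t) * osgn (oadd p (ovar t)) q))).
  by rewrite Yterm_scst_r // eqxx osgn0r mulr1.
by move=> p q /negbTE p0; rewrite Yterm_scst_r // p0 mul0rz.
Qed.

Lemma scst_supp (w : V) i d p : scst w d p != 0 -> d i = 0.
Proof. by rewrite /scst; case: (eqVneq d 0) => [->|_]; rewrite ?ffunE //= eqxx. Qed.

(** Y(v, (x_i, phi)) w *)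
Definition Yone i c v w : series V := Yser D i c (scst v) (scst w).

Lemma YoneE i c v w e o : Yone i c v w e o
  = if e == xe i (e i) then
      if o == o0 then Ycoef D v false (e i) w
      else if o == o12 then 0
      else Ycoef D v true (e i) w *~ c (o == ovar true)
    else 0.
Proof.
rewrite /Yone Yser_scst; last by move=> d p; exact: scst_supp.
rewrite big_bool /scst subr_eq0; case: (e == xe i (e i)) => /=; last first.
  by rewrite !(add_fun0 (optwistD _ (YcoefDr _ _ _))) !mul0rz !addr0.
by case: o => -[] []; rewrite /= ?Ycoef0r ?(add_fun0 vconjD) ?Ycoef0r ?(add_fun0 vconjD)
   ?mul0rz ?mulr1 ?addr0 ?add0r.
Qed.

Lemma Yone_supp i j c v w e o : j != i -> Yone i c v w e o != 0 -> e j = 0.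
Proof.
rewrite YoneE => ji; case: (eqVneq e (xe i (e i))) => [-> _|_]; last by rewrite eqxx.
by rewrite xeE (negbTE ji).
Qed.

Lemma Yone_neq0 (W : zmodType) (f : V -> W) i c v w e o : additive_fun f ->
  f (Yone i c v w e o) != 0 ->
  e = xe i (e i) /\ exists s, f (Ycoef D v s (e i) w) != 0.
Proof.
move=> fD; rewrite YoneE; case: (eqVneq e (xe i (e i))) => [E|_]; last by rewrite (add_fun0 fD) eqxx.
case: ifP => [_|_ H]; first by split=> //; exists false.
split=> //; move: H; case: ifP => _; first by rewrite (add_fun0 fD) eqxx.
rewrite (add_funMz fD) => H; exists true.
by apply: contraNneq H => ->; rewrite mul0rz.
Qed.

(** Stated for the image under an additive map [f], to be used both in [V] and after
    pairing with a linear form. *)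
Lemma Yser_neq0 (W : zmodType) (f : V -> W) i j c c' u v w e o :
  additive_fun f -> i != j ->
  f (Yser D i c (scst u) (Yone j c' v w) e o) != 0 ->
  e = xe i (e i) + xe j (e j) /\
  exists b s s', f (optwist D b (Ycoef D u s (e i)) (Ycoef D v s' (e j) w)) != 0.
Proof.
move=> fD ij; rewrite Yser_scst; last by move=> d p; exact: Yone_supp.
set e' := e - xe i (e i).
have e'j : e' j = e j by rewrite /e' !eexpE eq_sym (negbTE ij) subr0.
have T b s p : f (optwist D b (Ycoef D u s (e i)) (Yone j c' v w e' p)) != 0 ->
    e = xe i (e i) + xe j (e j) /\
    exists b s s', f (optwist D b (Ycoef D u s (e i)) (Ycoef D v s' (e j) w)) != 0.
  move=> H; have gD : additive_fun (fun x => f (optwist D b (Ycoef D u s (e i)) x)).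
    by move=> x y; rewrite (optwistD _ (YcoefDr _ _ _)) fD.
  have [E [s' Hs']] := Yone_neq0 gD H; split; last by exists b, s, s'; rewrite -e'j.
  by rewrite -e'j -E /e' addrC subrK.
rewrite big_bool !fD !(add_funMz fD) => H.
case: (eqVneq (f (optwist D (opar o) (Ycoef D u false (e i)) (Yone j c' v w e' o))) 0);
  last exact: T.
move=> E1; rewrite E1 add0r in H.
case: (eqVneq (f (optwist D (opar (oadd (ovar true) o)) (Ycoef D u true (e i))
   (Yone j c' v w e' (oadd (ovar true) o)))) 0); last exact: T.
move=> E2; rewrite E2 mul0rz add0r in H.
apply: (T (opar (oadd (ovar false) o)) true (oadd (ovar false) o)).
by apply: contraNneq H => ->; rewrite mul0rz.
Qed.

Lemma Yser_r_neq0 (W : zmodType) (f : V -> W) i j c c' u v w e o :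
  additive_fun f -> i != j ->
  f (Yser D i c (Yone j c' u v) (scst w) e o) != 0 ->
  e = xe i (e i) + xe j (e j) /\
  exists s s', f (Ycoef D (Ycoef D u s (e j) v) s' (e i) w) != 0.
Proof.
move=> fD ij; rewrite Yser_scst_r; last by move=> d p; exact: Yone_supp.
set e' := e - xe i (e i).
have e'j : e' j = e j by rewrite /e' !eexpE eq_sym (negbTE ij) subr0.
have T s' p : f (Ycoef D (Yone j c' u v e' p) s' (e i) w) != 0 ->
    e = xe i (e i) + xe j (e j) /\
    exists s s', f (Ycoef D (Ycoef D u s (e j) v) s' (e i) w) != 0.
  move=> H; have gD : additive_fun (fun x => f (Ycoef D x s' (e i) w)).
    by move=> x y; rewrite YcoefDl fD.
  have [E [s Hs]] := Yone_neq0 gD H; split; last by exists s, s'; rewrite -e'j.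
  by rewrite -e'j -E /e' addrC subrK.
rewrite big_bool !fD !(add_funMz fD) => H.
case: (eqVneq (f (Ycoef D (Yone j c' u v e' o) false (e i) w)) 0); last exact: T.
move=> E1; rewrite E1 add0r in H.
case: (eqVneq (f (Ycoef D (Yone j c' u v e' (oadd o (ovar true))) true (e i) w)) 0);
  last exact: T.
move=> E2; rewrite E2 mul0rz add0r in H.
apply: (T true (oadd o (ovar false))).
by apply: contraNneq H => ->; rewrite mul0rz.
Qed.

Lemma Ycoef_trunc v w : exists m : nat, forall s n, Ycoef D v s n w != 0 -> - m%:Z <= n.
Proof.
have [N HN] := nsv_trunc hD v w; exists (absz N + 2)%N => s n H.
have : ~ (N <= - (n + 1) * 2 - s%:Z) by move=> /HN; rewrite -/(Ycoef D v s n w); move/eqP: H.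
by case: s {H}; lia.
Qed.

End VertexSeries.

(** * Weights *)

Section AlgebraScaling.
Variables (K : fieldType) (A : algType K) (W : lmodType A).
Implicit Types (x y : W).

Lemma alg_scaleA (a b : K) y : a%:A *: (b%:A *: y) = (a * b)%:A *: y.
Proof. by rewrite scalerA mulr_algl scalerA. Qed.

Lemma alg_scale_int (n : int) y : (n%:~R : K)%:A *: y = y *~ n.
Proof. by rewrite !scaler_int. Qed.

Lemma scale_half (k : int) x y : (2%:R : K) != 0 ->
  (2^-1 : K)%:A *: x = (k%:~R / 2 : K)%:A *: y -> x = y *~ k.
Proof.
move=> two0 E; have := f_equal (fun x => (2%:R : K)%:A *: x) E.
by rewrite !alg_scaleA divff // scale1r scale1r mulrCA divff // mulr1 alg_scale_int.
Qed.

Lemma halfK x : (2%:R : K) != 0 -> ((2^-1 : K)%:A *: x) *~ 2 = x.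
Proof.
move=> two0; rewrite -alg_scale_int alg_scaleA.
by rewrite (_ : 2%:~R * 2^-1 = 1 :> K) ?scale1r ?scale1r // divff.
Qed.

Lemma mulrz_eq0 (n : int) y : (n%:~R : K) != 0 -> y *~ n = 0 -> y = 0.
Proof.
move=> n0; rewrite -alg_scale_int => H.
by rewrite -[y]scale1r -[1 : A]scale1r -(mulVf n0) -alg_scaleA H scaler0.
Qed.
End AlgebraScaling.

Lemma formop_one (A : nzRingType) (W : lmodType A) i j (S : series W) e o :
  formop i j (1, 1, 1) S e o = S (e - xe i 1) o + S (e - xe j 1) o
    + (if o == o12 then S e o0 else 0).
Proof. by rewrite formopE !scale1r. Qed.

Lemma rewrite_jacobi (W : zmodType) (n : int) (x x' y y' z z' : W) :
  x = x' -> y = y' -> z = z' -> x - y *~ n = z -> x' - y' *~ n = z'.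
Proof. by move=> -> -> ->. Qed.

Section Weights.
Variables (K : fieldType) (L : option nat) (V : lmodType (grass K L)).
Hypothesis char0 : forall n : int, n != 0 -> (n%:~R : K) != 0.
Notation A := (grass K L).
Variables (D : nsdata V) (hD : is_nsvosa D).
Implicit Types (u v w x y : V) (e d : eexp) (o p : oexp) (s : bool).

Let hG := nsv_graded hD.
Notation T2 := (mode D (tau D) 1).

Lemma Yprod_neq0 (W : zmodType) (f : V -> W) u v w e o : additive_fun f ->
  f (Yprod D u v w e o) != 0 -> e = xe x1 (e x1) + xe x2 (e x2) /\
  exists b s s', f (optwist D b (Ycoef D u s (e x1)) (Ycoef D v s' (e x2) w)) != 0.
Proof. by move=> fD; exact: (Yser_neq0 hD fD neq12). Qed.

Lemma Yprod_op_neq0 (W : zmodType) (f : V -> W) u v w e o : additive_fun f ->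
  f (Yprod_op D u v w e o) != 0 -> e = xe x2 (e x2) + xe x1 (e x1) /\
  exists b s s', f (optwist D b (Ycoef D v s (e x2)) (Ycoef D u s' (e x1) w)) != 0.
Proof. by move=> fD; exact: (Yser_neq0 hD fD neq21). Qed.

Lemma Yiter_neq0 (W : zmodType) (f : V -> W) u v w e o : additive_fun f ->
  f (Yiter D u v w e o) != 0 -> e = xe x2 (e x2) + xe x0 (e x0) /\
  exists s s', f (Ycoef D (Ycoef D u s (e x0) v) s' (e x2) w) != 0.
Proof. by move=> fD; exact: (Yser_r_neq0 hD fD neq20). Qed.

Lemma Yprod_trunc (W : zmodType) (f : V -> W) u v w e o m : additive_fun f ->
  (forall s n, Ycoef D v s n w != 0 -> - m%:Z <= n) ->
  f (Yprod D u v w e o) != 0 -> e x0 = 0 /\ - m%:Z <= e x2.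
Proof.
move=> fD H /(Yprod_neq0 fD)[E [b [s [s' N]]]].
split; first by rewrite E !eexpE (negbTE neq01) (negbTE neq02) addr0.
apply: (H s'); apply: contraNneq N => ->.
by rewrite (add_fun0 (optwistD hD _ (YcoefDr hD _ _ _))) (add_fun0 fD).
Qed.

Lemma Yprod_op_trunc (W : zmodType) (f : V -> W) u v w e o m : additive_fun f ->
  (forall s n, Ycoef D u s n w != 0 -> - m%:Z <= n) ->
  f (Yprod_op D u v w e o) != 0 -> e x0 = 0 /\ - m%:Z <= e x1.
Proof.
move=> fD H /(Yprod_op_neq0 fD)[E [b [s [s' N]]]].
split; first by rewrite E !eexpE (negbTE neq01) (negbTE neq02) addr0.
apply: (H s'); apply: contraNneq N => ->.
by rewrite (add_fun0 (optwistD hD _ (YcoefDr hD _ _ _))) (add_fun0 fD).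
Qed.

Lemma Yiter_trunc (W : zmodType) (f : V -> W) u v w e o m : additive_fun f ->
  (forall s n, Ycoef D u s n v != 0 -> - m%:Z <= n) ->
  f (Yiter D u v w e o) != 0 -> e x1 = 0 /\ - m%:Z <= e x0.
Proof.
move=> fD H /(Yiter_neq0 fD)[E [s [s' N]]].
split; first by rewrite E !eexpE (negbTE neq12) (negbTE neq10) addr0.
apply: (H s); apply: contraNneq N => ->.
by rewrite (Ycoef0l hD) (add_fun0 fD).
Qed.

Lemma Yprod_val u v w m n s :
  Yprod D u v w (xe x1 m + xe x2 n) (true, s)
  = optwist D s (Ycoef D u true m) (Ycoef D v s n w).
Proof.
rewrite /Yprod -/(Yone D x2 phi2 v w) (Yser_scst hD); last by move=> d p; exact: (Yone_supp hD neq12).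
have -> : (xe x1 m + xe x2 n) x1 = m by rewrite !eexpE eqxx (negbTE neq12) addr0.
have -> : xe x1 m + xe x2 n - xe x1 m = xe x2 n by rewrite addrC addKr.
rewrite big_bool !(YoneE hD) !xeE !eqxx.
by case: s; rewrite /= ?(Ycoef0r hD) ?(add_fun0 (vconjD hD)) ?(Ycoef0r hD)
  ?(add_fun0 (vconjD hD)) ?mulr0z ?mulr1z ?addr0 ?add0r.
Qed.

Lemma Yprod_op_val u v w m n s :
  Yprod_op D u v w (xe x1 m + xe x2 n) (true, s)
  = optwist D true (Ycoef D v s n) (Ycoef D u true m w) *~ (- 1) ^+ s.
Proof.
rewrite /Yprod_op -/(Yone D x1 phi1 u w) (Yser_scst hD); last by move=> d p; exact: (Yone_supp hD neq21).
have -> : (xe x1 m + xe x2 n) x2 = n by rewrite !eexpE eqxx (negbTE neq21) add0r.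
have -> : xe x1 m + xe x2 n - xe x2 n = xe x1 m by rewrite addrK.
rewrite big_bool !(YoneE hD) !xeE !eqxx.
by case: s; rewrite /= ?(Ycoef0r hD) ?(add_fun0 (vconjD hD)) ?(Ycoef0r hD)
  ?(add_fun0 (vconjD hD)) ?mulr0z ?mul0rz ?mulr1z ?addr0 ?add0r.
Qed.

Lemma Yiter_val u v w m n s :
  Yiter D u v w (xe x0 m + xe x2 n) (true, s) = Ycoef D (Ycoef D u true m v) s n w.
Proof.
rewrite /Yiter -/(Yone D x0 phi12 u v) (Yser_scst_r hD); last by move=> d p; exact: (Yone_supp hD neq20).
have -> : (xe x0 m + xe x2 n) x2 = n by rewrite !eexpE eqxx (negbTE neq20) add0r.
have -> : xe x0 m + xe x2 n - xe x2 n = xe x0 m by rewrite addrK.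
rewrite big_bool !(YoneE hD) !xeE !eqxx.
by case: s; rewrite /= ?(Ycoef0l hD) ?mulr0z ?mul0rz ?mulr1z ?addr0 ?add0r.
Qed.

Lemma Yiter_val0 u v w m n :
  Yiter D u v w (xe x0 m + xe x2 n) o0 = Ycoef D (Ycoef D u false m v) false n w.
Proof.
rewrite /Yiter -/(Yone D x0 phi12 u v) (Yser_scst_r hD); last by move=> d p; exact: (Yone_supp hD neq20).
have -> : (xe x0 m + xe x2 n) x2 = n by rewrite !eexpE eqxx (negbTE neq20) add0r.
have -> : xe x0 m + xe x2 n - xe x2 n = xe x0 m by rewrite addrK.
rewrite big_bool !(YoneE hD) !xeE !eqxx.
by rewrite /= ?(Ycoef0l hD) ?mulr0z ?mul0rz ?mulr1z ?addr0 ?add0r.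
Qed.

Let two0 : (2%:R : K) != 0. Proof. exact: (char0 (n := 2)). Qed.

Lemma T2_weight (k : int) v : of_weight D k v -> T2 v = v *~ k.
Proof.
move=> vk; have := nsv_L0 hD vk; rewrite /Lop mulr0 add0r; exact: scale_half.
Qed.

(** G(-1/2) squares to L(-1). *)
Lemma tau_neg1 v : mode D (tau D) (- 1) v = Gop D (- 1) (Gop D (- 1) v) *~ 2.
Proof.
have := nsv_GG hD (- 1) 0 v; rewrite sub0r addr0 /= scale0r addr0 /Lop.
by rewrite (halfK _ two0).
Qed.

(** The derivative property twice: 2 L(-1) acts as twice the derivative. *)
Lemma Ycoef_tau_neg1 v s n w :
  Ycoef D (mode D (tau D) (- 1) v) s (n - 1) w = Ycoef D v s n w *~ (2 * n).
Proof.
rewrite tau_neg1 (add_funMz (YcoefDl hD s (n - 1) w)) mulrC mulrzA; congr (_ *~ 2).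
have [G1 G2] := nsv_deriv hD (Gop D (- 1) v) (n - 1) w.
case: s; rewrite -?G1 -?G2 ?subrK.
  by have [-> _] := nsv_deriv hD v n w.
by have [_ <-] := nsv_deriv hD v (n - 1) w; rewrite subrK.
Qed.

(** The residue of the Jacobi identity for [tau] that computes the commutator
    with twice L(0). *)
Lemma T2_commutator (a : bool) (p : int) u s n w :
  of_sign D a u -> of_weight D p u ->
  T2 (Ycoef D u s n w) - Ycoef D u s n (T2 w) = Ycoef D u s n w *~ (p + 2 * n + s%:Z).
Proof.
move=> ua up; have [_ ts] := nsv_tau hD.
(* The mode of [tau] at phi_1 x_1^-2 is 2 L(0); the exponent -1 of [x_0] makes
   both delta functions on the left trivial. *)
pose e : eexp := xe x0 (- 1) + xe x1 (- 2) + xe x2 n.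
have e0 : e x0 = - 1 by rewrite /e !eexpE eqxx (negbTE neq01) (negbTE neq02) !addr0.
have e1 : e x1 = - 2 by rewrite /e !eexpE eqxx (negbTE neq10) (negbTE neq12) addr0 add0r.
have E0 : e + xe x0 1 = xe x1 (- 2) + xe x2 n.
  by rewrite /e addrC -!addrA addrA -xeD subrr xe0 add0r.
have E1 : e + xe x1 2 = xe x0 (- 1) + xe x2 n.
  by rewrite /e addrAC -[_ + _ + xe x1 2]addrA -xeD addNr xe0 addr0.
have idD : additive_fun (@id V) by [].
have [m1 H1] := Ycoef_trunc hD u w.
have [m2 H2] := Ycoef_trunc hD (tau D) w.
have [m3 H3] := Ycoef_trunc hD (tau D) u.
have ge1 : geven (1 : A) by exact: geven1.
have geN1 : geven (- 1 : A) by exact: gevenN.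
have HP := fun d q => Yprod_trunc (e := d) (o := q) (u := tau D) idD H1.
have HQ := fun d q => Yprod_op_trunc (e := d) (o := q) (v := u) idD H2.
have HI := fun d q => Yiter_trunc (e := d) (o := q) (w := w) idD H3.
have P0 : smul (sdelta x1 x2 x0 (- 1 : A) 1) (Yprod D (tau D) u w) e (true, s)
    = Yprod D (tau D) u w (xe x1 (- 2) + xe x2 n) (true, s).
  rewrite smul_emul; last exact: sdelta_even.
  by rewrite -E0; apply: (delta1_slice (n := 0) _ HP).
have Q0 : smul (sdelta x2 x1 x0 (1 : A) (- 1)) (Yprod_op D (tau D) u w) e (true, s)
    = Yprod_op D (tau D) u w (xe x1 (- 2) + xe x2 n) (true, s).
  rewrite smul_emul; last exact: sdelta_even.
  by rewrite -E0; apply: (delta2_slice (n := 0) _ HQ).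
have R0 : smul (sdelta x1 x0 x2 (- 1 : A) 1) (Yiter D (tau D) u w) e (true, s)
    = formop x2 x0 (1, 1, 1) (Yiter D (tau D) u w) (xe x0 (- 1) + xe x2 n) (true, s).
  rewrite smul_emul; last exact: sdelta_even.
  by rewrite -E1; apply: (delta3_slice (n := 1) _ HI).
have R1 : formop x2 x0 (1, 1, 1) (Yiter D (tau D) u w) (xe x0 (- 1) + xe x2 n) (true, s)
    = Ycoef D (mode D (tau D) (- 1) u) s (n - 1) w + Ycoef D (T2 u) s n w
      + (if s then Ycoef D (Gop D (- 1) u) false n w else 0).
  apply: (etrans (formop_one _ _ _ _ _)).
  have -> : xe x0 (- 1) + xe x2 n - xe x2 1 = xe x0 (- 1) + xe x2 (n - 1).
    by rewrite -addrA -xeN -xeD.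
  have -> : xe x0 (- 1) + xe x2 n - xe x0 1 = xe x0 (- 2) + xe x2 n.
    by rewrite addrAC -xeN -xeD.
  by rewrite !Yiter_val Yiter_val0 {P0 Q0 R0}; case: s.
have := rewrite_jacobi (etrans P0 (Yprod_val _ _ _ _ _ _))
  (etrans Q0 (Yprod_op_val _ _ _ _ _ _)) (etrans R0 R1) (nsv_jacobi hD w ts ua e (true, s)).
have Tt x : Ycoef D (tau D) true (- 2) x = T2 x by [].
have TP : optwist D s (Ycoef D (tau D) true (- 2)) (Ycoef D u s n w) = T2 (Ycoef D u s n w).
  by move: {P0 Q0 R0 R1} s => [] //; rewrite (optwist_sign hD _ _ _ ts) mulr1z Tt.
have TQ : optwist D true (Ycoef D u s n) (Ycoef D (tau D) true (- 2) w) *~ (- 1) ^+ s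
    *~ (- 1) ^+ (true && a) = Ycoef D u s n (T2 w).
  rewrite (optwist_sign hD _ _ _ ua) Tt -!mulrzA.
  by move: {P0 Q0 R0 R1 TP} s => []; case: a {ua}; rewrite /= ?mulr1z.
rewrite TP TQ => ->.
rewrite Ycoef_tau_neg1 (T2_weight up) (add_funMz (YcoefDl hD s n w)) -!mulrzDr.
have -> : (if s then Ycoef D (Gop D (- 1) u) false n w else 0) = Ycoef D u s n w *~ s%:Z.
  by move: {P0 Q0 R0 R1 TP TQ} s => []; rewrite ?mulr0z ?mulr1z //; have [-> _] := nsv_deriv hD u n w.
by rewrite -mulrzDr; congr (_ *~ _); lia.
Qed.

(** Eigenvectors of 2 L(0) are homogeneous, since its eigenvalues on the
    components of different weights are different. *)
Lemma weight_T2 (k : int) v : T2 v = v *~ k -> of_weight D k v.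
Proof.
move=> E; have wD m : additive_fun (fun x => wt D x m).
  by move=> x y; have := wt_linear hG m 1 x y; rewrite !scale1r.
have T2D : additive_fun T2 by exact: (YcoefDr hD (tau D) true (- 2)).
have fin : fin_supp (fun m => wt D v m) by exact: fin_suppW (wt_finite hG v) _.
have wT2 m : wt D (T2 v) m = wt D v m *~ m.
  rewrite {1}(wt_sum hG v) (fsum_morph T2D fin) (fsum_morph (wD m)); last first.
    by apply: fin_supp_sub fin => l ->; rewrite (add_fun0 T2D).
  have TE l : T2 (wt D v l) = wt D v l *~ l.
    by apply: T2_weight; rewrite /of_weight (wt_proj hG) eqxx.
  rewrite (fsum_single (i0 := m)); first by rewrite TE (add_funMz (wD m)) (wt_proj hG) eqxx.
  by move=> l /negbTE lm; rewrite TE (add_funMz (wD m)) (wt_proj hG) lm mul0rz.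
have z m : m != k -> wt D v m = 0.
  move=> mk; have := wT2 m; rewrite E (add_funMz (wD m)) => /eqP.
  rewrite eq_sym -subr_eq0 -mulrzBr => /eqP.
  by apply: mulrz_eq0; apply: char0; rewrite subr_eq0.
by rewrite /of_weight [RHS](wt_sum hG) (fsum_single (i0 := k)).
Qed.

(** The commutator shows that modes of vectors with a sign map eigenvectors of
    2 L(0) to eigenvectors; weights are doubled, hence 2 n + s. *)
Lemma Ycoef_weight (p q : int) u s n w : of_weight D p u -> of_weight D q w ->
  of_weight D (p + q + 2 * n + s%:Z) (Ycoef D u s n w).
Proof.
move=> up wq; have wD m : additive_fun (fun x => wt D x m).
  by move=> x y; have := wt_linear hG m 1 x y; rewrite !scale1r.
have H (a : bool) : of_weight D (p + q + 2 * n + s%:Z) (Ycoef D (sg D u a) s n w).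
  have ua : of_sign D a (sg D u a) by rewrite /of_sign (sg_proj hG) eqxx.
  have uap : of_weight D p (sg D u a) by rewrite /of_weight (wt_sg hG) up.
  apply: weight_T2; have := T2_commutator s n w ua uap.
  rewrite (T2_weight wq) (add_funMz (YcoefDr hD _ s n)) => /eqP.
  rewrite subr_eq -mulrzDr => /eqP ->; congr (_ *~ _); lia.
have uE := sg_sum hG u; rewrite /of_weight uE (YcoefDl hD) wD.
by rewrite (H false) (H true).
Qed.

(** The filtration by weight; every vector lies in a fixed step of it, so that
    degree bounds need no decomposition into homogeneous vectors. *)
Definition weight_ge (b : int) v : Prop := forall k, k < b -> wt D v k = 0.

Lemma Ycoef_weight_ge (p q : int) u s n w : weight_ge p u -> weight_ge q w ->
  weight_ge (p + q + 2 * n + s%:Z) (Ycoef D u s n w).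
Proof.
move=> up wq l hl.
have wD m : additive_fun (fun x => wt D x m).
  by move=> x y; have := wt_linear hG m 1 x y; rewrite !scale1r.
have fin v : fin_supp (fun m => wt D v m) by exact: fin_suppW (wt_finite hG v) _.
have lD : additive_fun (fun x => wt D (Ycoef D x s n w) l).
  by move=> x y; rewrite (YcoefDl hD) wD.
rewrite (wt_sum hG u) (fsum_morph lD (fin u)); apply: fsbig1 => i _.
have rD : additive_fun (fun y => wt D (Ycoef D (wt D u i) s n y) l).
  by move=> x y; rewrite (YcoefDr hD) wD.
rewrite (wt_sum hG w) (fsum_morph rD (fin w)); apply: fsbig1 => j _.
case: (boolP (i < p)) => [/up ->|ip]; first by rewrite (Ycoef0l hD) (add_fun0 (wD l)).
case: (boolP (j < q)) => [/wq ->|jq]; first by rewrite (Ycoef0r hD) (add_fun0 (wD l)).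
have wi : of_weight D i (wt D u i) by rewrite /of_weight (wt_proj hG) eqxx.
have wj : of_weight D j (wt D w j) by rewrite /of_weight (wt_proj hG) eqxx.
rewrite -(Ycoef_weight s n wi wj) (wt_proj hG) ifF //.
by apply/negbTE; lia.
Qed.

Lemma weight_ge_vconj (b : int) v : weight_ge b v -> weight_ge b (vconj D v).
Proof.
move=> vb k kb; have wD : additive_fun (fun x => wt D x k).
  by move=> x y; have := wt_linear hG k 1 x y; rewrite !scale1r.
rewrite /vconj wD (add_funN wD) !(wt_sg hG) vb //.
by rewrite !(add_fun0 (sgD hD _)) subrr.
Qed.

End Weights.

(** * Matrix coefficients of products and iterates *)

Section LinearImage.
Variables (A : nzRingType) (V : lmodType A) (f : V -> A^o).
Hypotheses (fD : additive_fun f) (fZ : forall a x, f (a *: x) = a *: f x).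

Lemma emul_map (G : series A) (S : series V) e o : cvg G S ->
  f (emul G S e o) = emul G (fun e o => f (S e o)) e o.
Proof.
move=> cS; have E p q : f (conv G S p q e) = conv G (fun e o => f (S e o)) p q e.
  rewrite /conv (fsum_morph fD (cvg_fin e p q cS)).
  by apply: eq_fsbigr => d _; rewrite fZ.
by rewrite /emul fD E; case: (o == o12); rewrite ?E // (add_fun0 fD).
Qed.
End LinearImage.

Lemma emul_mulz (A : nzRingType) (M : lmodType A) (G : series A) (S : series M) (z : int) e o :
  cvg G S -> emul G (fun e o => S e o *~ z) e o = emul G S e o *~ z.
Proof.
move=> cS; have zD : additive_fun (fun x : M => x *~ z) by move=> x y; rewrite mulrzDl.
have E p q : conv G (fun e o => S e o *~ z) p q e = conv G S p q e *~ z.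
  rewrite /conv (fsum_morph zD (cvg_fin e p q cS)).
  by apply: eq_fsbigr => d _; rewrite -(add_funMz (f := fun x => G d p *: x)) // => x y;
    rewrite scalerDr.
by rewrite /emul !E mulrzDl; case: (o == o12); rewrite // mul0rz.
Qed.

Lemma emul_add3 (A : nzRingType) (M : lmodType A) (G1 G2 G3 : series A)
    (P P' Q Q' I I' : series M) e o :
  cvg G1 P -> cvg G1 P' -> cvg G2 Q -> cvg G2 Q' -> cvg G3 I -> cvg G3 I' ->
  emul G1 P e o - emul G2 Q e o = emul G3 I e o ->
  emul G1 P' e o - emul G2 Q' e o = emul G3 I' e o ->
  emul G1 (fun e o => P e o + P' e o) e o - emul G2 (fun e o => Q e o + Q' e o) e o
  = emul G3 (fun e o => I e o + I' e o) e o.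
Proof.
by move=> *; rewrite !emulD // opprD addrACA; congr (_ + _).
Qed.

Lemma additive_relation (U W : zmodType) (f : U -> W) (X Y Z : U) (z : int) (p q r p' : W) :
  additive_fun f -> X - Y *~ z = Z -> f X = p -> f Y = q -> f Z = r -> p' = q *~ z ->
  p - p' = r.
Proof.
by move=> fD <- <- <- <- ->; rewrite fD (add_funN fD) (add_funMz fD).
Qed.

Lemma add_neq0 (W : zmodType) (x y : W) : x + y != 0 -> x != 0 \/ y != 0.
Proof.
by case: (eqVneq x 0) => [->|x0 _]; [rewrite add0r; right|left].
Qed.

Section Triples.
Variables (K : fieldType) (L : option nat).
Notation A := (grass K L).

Lemma jacobi_tripleD n n' B B' (P P' Q Q' I I' : series A^o) :
  jacobi_triple n B P Q I -> jacobi_triple n' B' P' Q' I' ->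
  exists m C, jacobi_triple m C (fun e o => P e o + P' e o) (fun e o => Q e o + Q' e o)
    (fun e o => I e o + I' e o).
Proof.
move=> [HP HQ HI HJ] [HP' HQ' HI' HJ'].
exists (n + n')%N, ((absz B)%:Z + (absz B')%:Z); split.
- by move=> e o /add_neq0[/HP|/HP'] [h1 h2 h3]; split=> //; lia.
- by move=> e o /add_neq0[/HQ|/HQ'] [h1 h2]; split=> //; lia.
- by move=> e o /add_neq0[/HI|/HI'] [h1 h2 h3]; split=> //; lia.
move=> e o; apply: emul_add3 (HJ e o) (HJ' e o).
- apply: (@cvg_sdelta _ _ x1 x2 x0 (- 1) 1 neq12 neq10 neq20 _ P (- n%:Z)) => d p /HP[h1 h2 _].
  by split=> //; left.
- apply: (@cvg_sdelta _ _ x1 x2 x0 (- 1) 1 neq12 neq10 neq20 _ P' (- n'%:Z)) => d p /HP'[h1 h2 _].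
  by split=> //; left.
- apply: (@cvg_sdelta _ _ x2 x1 x0 1 (- 1) neq21 neq20 neq10 _ Q (- n%:Z)) => d p /HQ[h1 h2].
  by split=> //; left.
- apply: (@cvg_sdelta _ _ x2 x1 x0 1 (- 1) neq21 neq20 neq10 _ Q' (- n'%:Z)) => d p /HQ'[h1 h2].
  by split=> //; left.
- apply: (@cvg_sdelta _ _ x1 x0 x2 (- 1) 1 neq10 neq12 neq02 _ I (- n%:Z)) => d p /HI[h1 h2 _].
  by split=> //; right.
- apply: (@cvg_sdelta _ _ x1 x0 x2 (- 1) 1 neq10 neq12 neq02 _ I' (- n'%:Z)) => d p /HI'[h1 h2 _].
  by split=> //; right.
Qed.
End Triples.

Section Additivity.
Variables (K : fieldType) (L : option nat) (V : lmodType (grass K L)).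
Variables (D : nsdata V) (hD : is_nsvosa D).
Implicit Types (u v w x y : V) (i j : evar) (e d : eexp) (o p : oexp) (s : bool).

Lemma Yser_scstDl i c u u' (W : series V) e o : (forall d p, W d p != 0 -> d i = 0) ->
  Yser D i c (scst (u + u')) W e o
  = Yser D i c (scst u) W e o + Yser D i c (scst u') W e o.
Proof.
move=> W0; rewrite !(Yser_scst hD) //.
have E b s x : optwist D b (Ycoef D (u + u') s (e i)) x
    = optwist D b (Ycoef D u s (e i)) x + optwist D b (Ycoef D u' s (e i)) x.
  by apply: (optwist_addl hD) => y; exact: (YcoefDl hD).
rewrite E addrACA -big_split; congr (_ + _ + _).
by apply: eq_bigr => t _; rewrite E mulrzDl.
Qed.

Lemma Yser_scstDr i c u (W W1 W2 : series V) e o : (forall d p, W d p != 0 -> d i = 0) ->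
  (forall d p, W1 d p != 0 -> d i = 0) -> (forall d p, W2 d p != 0 -> d i = 0) ->
  (forall d p, W d p = W1 d p + W2 d p) ->
  Yser D i c (scst u) W e o
  = Yser D i c (scst u) W1 e o + Yser D i c (scst u) W2 e o.
Proof.
move=> W0 W10 W20 E; rewrite !(Yser_scst hD) // E (optwistD hD _ (YcoefDr hD _ _ _)).
rewrite addrACA -big_split; congr (_ + _ + _).
by apply: eq_bigr => t _; rewrite E (optwistD hD _ (YcoefDr hD _ _ _)) mulrzDl.
Qed.

Lemma Yser_scst_rD i c (S S1 S2 : series V) w e o : (forall d p, S d p != 0 -> d i = 0) ->
  (forall d p, S1 d p != 0 -> d i = 0) -> (forall d p, S2 d p != 0 -> d i = 0) ->
  (forall d p, S d p = S1 d p + S2 d p) ->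
  Yser D i c S (scst w) e o
  = Yser D i c S1 (scst w) e o + Yser D i c S2 (scst w) e o.
Proof.
move=> S0 S10 S20 E; rewrite !(Yser_scst_r hD) // E (YcoefDl hD).
rewrite addrACA -big_split; congr (_ + _ + _).
by apply: eq_bigr => t _; rewrite E (YcoefDl hD) mulrzDl.
Qed.

Lemma YoneDl i c v v' w e o :
  Yone D i c (v + v') w e o = Yone D i c v w e o + Yone D i c v' w e o.
Proof. by apply: Yser_scstDl => d p; exact: scst_supp. Qed.

Lemma YoneDr i c v w w' e o :
  Yone D i c v (w + w') e o = Yone D i c v w e o + Yone D i c v w' e o.
Proof.
rewrite !(YoneE hD); case: (e == _); last by rewrite addr0.
case: (o == o0); first exact: (YcoefDr hD).
by case: (o == o12); rewrite ?addr0 // (YcoefDr hD) mulrzDl.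
Qed.

Lemma YprodDl u u' v w e o :
  Yprod D (u + u') v w e o = Yprod D u v w e o + Yprod D u' v w e o.
Proof. by apply: Yser_scstDl => d p; exact: (Yone_supp hD neq12). Qed.

Lemma YprodDr u v v' w e o :
  Yprod D u (v + v') w e o = Yprod D u v w e o + Yprod D u v' w e o.
Proof.
by apply: Yser_scstDr => d p; first [exact: (Yone_supp hD neq12)|exact: YoneDl].
Qed.

Lemma YiterDl u u' v w e o :
  Yiter D (u + u') v w e o = Yiter D u v w e o + Yiter D u' v w e o.
Proof.
by apply: Yser_scst_rD => d p; first [exact: (Yone_supp hD neq20)|exact: YoneDl].
Qed.

Lemma YiterDr u v v' w e o :
  Yiter D u (v + v') w e o = Yiter D u v w e o + Yiter D u v' w e o.
Proof.
by apply: Yser_scst_rD => d p; first [exact: (Yone_supp hD neq20)|exact: YoneDr].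
Qed.
End Additivity.

Section MatrixCoefficients.
Variables (K : fieldType) (L : option nat) (V : lmodType (grass K L)).
Hypothesis char0 : forall n : int, n != 0 -> (n%:~R : K) != 0.
Notation A := (grass K L).
Variables (D : nsdata V) (hD : is_nsvosa D) (v' : {scalar V}) (hv' : graded_dual D v').
Implicit Types (u v w x y : V) (e d : eexp) (o p : oexp) (s : bool).

Let hG := nsv_graded hD.
Let f : V -> A^o := v'.

Lemma pairing_additive : additive_fun f.
Proof. by move=> x y; exact: linearD. Qed.

Lemma pairing_scale (a : A) x : f (a *: x) = a *: f x.
Proof. exact: linearZ. Qed.

Lemma weight_bound : exists N : int, forall v, weight_ge D N v.
Proof. by have [N HN] := nsv_pos hD; exists N => v k; exact: HN. Qed.

(** The form sees finitely many weights only, and a vector is the sum of its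
    components. *)
Lemma pairing_weight_bound : exists B : int, forall v, weight_ge D B v -> f v = 0.
Proof.
have [s Hs] := hv'; exists ((\sum_(k <- s) absz k)%N%:Z + 1) => v vB.
have fin : fin_supp (fun m => wt D v m) by exact: fin_suppW (wt_finite hG v) _.
rewrite (wt_sum hG v) (fsum_morph pairing_additive fin); apply: fsbig1 => k _.
case: (boolP (k \in s)) => ks; last first.
  by apply: Hs ks _; rewrite /of_weight (wt_proj hG) eqxx.
rewrite vB; first exact: (add_fun0 pairing_additive).
have : (absz k <= \sum_(k <- s) absz k)%N by rewrite (big_rem k) //= leq_addr.
by lia.
Qed.

Lemma Yprod_degree u v w : exists B : int, forall e o,
  f (Yprod D u v w e o) != 0 -> e x1 + e x2 <= B.
Proof.
have [N HN] := weight_bound; have [B HB] := pairing_weight_bound.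
exists ((absz B)%:Z + (absz N)%:Z * 3) => e o.
move=> /(Yprod_neq0 hD pairing_additive)[_ [b [s [s' H]]]].
have W : weight_ge D (N + (N + N + 2 * e x2 + s'%:Z) + 2 * e x1 + s%:Z)
    (optwist D b (Ycoef D u s (e x1)) (Ycoef D v s' (e x2) w)).
  have Wv : weight_ge D (N + N + 2 * e x2 + s'%:Z) (Ycoef D v s' (e x2) w).
    exact: (Ycoef_weight_ge char0 hD (HN v) (HN w)).
  case: b {H} => /=; last exact: (Ycoef_weight_ge char0 hD (HN u) Wv).
  apply: (weight_ge_vconj hD).
  exact: (Ycoef_weight_ge char0 hD (HN u) (weight_ge_vconj hD Wv)).
have : ~ (B <= N + (N + N + 2 * e x2 + s'%:Z) + 2 * e x1 + s%:Z).
  move=> le; case/eqP: H; apply: HB => k kB; apply: W; lia.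
by case: s s' {H W} => -[]; lia.
Qed.

Lemma Yiter_degree u v w : exists B : int, forall e o,
  f (Yiter D u v w e o) != 0 -> e x2 + e x0 <= B.
Proof.
have [N HN] := weight_bound; have [B HB] := pairing_weight_bound.
exists ((absz B)%:Z + (absz N)%:Z * 3) => e o.
move=> /(Yiter_neq0 hD pairing_additive)[_ [s [s' H]]].
have W : weight_ge D ((N + N + 2 * e x0 + s%:Z) + N + 2 * e x2 + s'%:Z)
    (Ycoef D (Ycoef D u s (e x0) v) s' (e x2) w).
  exact: (Ycoef_weight_ge char0 hD (Ycoef_weight_ge char0 hD (HN u) (HN v)) (HN w)).
have : ~ (B <= (N + N + 2 * e x0 + s%:Z) + N + 2 * e x2 + s'%:Z).
  move=> le; case/eqP: H; apply: HB => k kB; apply: W; lia.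
by case: s s' {H W} => -[]; lia.
Qed.

Definition has_triple u v w : Prop := exists n B Q,
  jacobi_triple n B (fun e o => f (Yprod D u v w e o)) Q (fun e o => f (Yiter D u v w e o)).

(** For vectors of homogeneous sign the triple comes from the Jacobi identity,
    with the sign of the exchange absorbed into the opposite product. *)
Lemma has_triple_sign (a b : bool) u v w : of_sign D a u -> of_sign D b v ->
  has_triple u v w.
Proof.
move=> ua vb.
have [m1 H1] := Ycoef_trunc hD v w.
have [m2 H2] := Ycoef_trunc hD u w.
have [m3 H3] := Ycoef_trunc hD u v.
have [B1 HB1] := Yprod_degree u v w.
have [B2 HB2] := Yiter_degree u v w.
pose z : int := (- 1) ^+ (a && b).
exists (m1 + m2 + m3)%N, ((absz B1)%:Z + (absz B2)%:Z),
  (fun e o => f (Yprod_op D u v w e o) *~ z).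
have fD := pairing_additive.
have idD : additive_fun (@id V) by [].
split.
- move=> e o H; have [h1 h2] := Yprod_trunc hD fD H1 H; have h3 := HB1 _ _ H.
  by split=> //; lia.
- move=> e o H; have [|h1 h2] := @Yprod_op_trunc _ _ _ _ hD _ f u v w e o m2 fD H2.
    by apply: contraNneq H => ->; rewrite mul0rz.
  by split=> //; lia.
- move=> e o H; have [h1 h2] := Yiter_trunc hD fD H3 H; have h3 := HB2 _ _ H.
  by split=> //; lia.
have ge1 : geven (1 : A) by exact: geven1.
have geN1 : geven (- 1 : A) by exact: gevenN.
have cP : cvg (sdelta x1 x2 x0 (- 1 : A) 1) (Yprod D u v w).
  apply: (@cvg_sdelta _ _ x1 x2 x0 (- 1) 1 neq12 neq10 neq20 _ _ (- m1%:Z)) => d p.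
  by move=> /(Yprod_trunc hD idD H1)[]; split=> //; left.
have cQ : cvg (sdelta x2 x1 x0 (1 : A) (- 1)) (Yprod_op D u v w).
  apply: (@cvg_sdelta _ _ x2 x1 x0 1 (- 1) neq21 neq20 neq10 _ _ (- m2%:Z)) => d p.
  by move=> /(Yprod_op_trunc hD idD H2)[]; split=> //; left.
have cI : cvg (sdelta x1 x0 x2 (- 1 : A) 1) (Yiter D u v w).
  apply: (@cvg_sdelta _ _ x1 x0 x2 (- 1) 1 neq10 neq12 neq02 _ _ (- m3%:Z)) => d p.
  by move=> /(Yiter_trunc hD idD H3)[]; split=> //; right.
move=> e o.
have J := nsv_jacobi hD w ua vb e o.
have EP := f_equal (fun X => X e o) (smul_emul (Yprod D u v w) (sdelta_even x1 x2 x0 1 geN1)).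
have EQ := f_equal (fun X => X e o) (smul_emul (Yprod_op D u v w) (sdelta_even x2 x1 x0 (- 1) ge1)).
have EI := f_equal (fun X => X e o) (smul_emul (Yiter D u v w) (sdelta_even x1 x0 x2 1 geN1)).
have {}J := rewrite_jacobi EP EQ EI J.
have MP := emul_map fD pairing_scale e o cP.
have MQ := emul_map fD pairing_scale e o cQ.
have MI := emul_map fD pairing_scale e o cI.
have cfQ : cvg (sdelta x2 x1 x0 (1 : A) (- 1)) (fun e o => f (Yprod_op D u v w e o)).
  move=> d p q; have [t Ht] := cQ d p q; exists t => d' h h'; apply: Ht => //.
  by apply: contraNneq h' => ->; rewrite (add_fun0 fD).
have MZ := emul_mulz z e o cfQ.
exact: (additive_relation fD J MP MQ MI MZ).
Qed.

Lemma has_tripleD u v w u1 v1 : has_triple u v w -> has_triple u1 v1 w ->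
  forall u2 v2,
  (forall e o, Yprod D u2 v2 w e o = Yprod D u v w e o + Yprod D u1 v1 w e o) ->
  (forall e o, Yiter D u2 v2 w e o = Yiter D u v w e o + Yiter D u1 v1 w e o) ->
  has_triple u2 v2 w.
Proof.
move=> [n [B [Q HT]]] [n' [B' [Q' HT']]] u2 v2 EP EI.
have [m [C H]] := jacobi_tripleD HT HT'.
exists m, C, (fun e o => Q e o + Q' e o).
have -> : (fun e o => f (Yprod D u2 v2 w e o))
    = fun e o => f (Yprod D u v w e o) + f (Yprod D u1 v1 w e o).
  by apply: series_ext => e o; rewrite EP pairing_additive.
have -> : (fun e o => f (Yiter D u2 v2 w e o))
    = fun e o => f (Yiter D u v w e o) + f (Yiter D u1 v1 w e o).
  by apply: series_ext => e o; rewrite EI pairing_additive.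
exact: H.
Qed.

Lemma has_tripleDl u u' v w : has_triple u v w -> has_triple u' v w ->
  has_triple (u + u') v w.
Proof.
move=> h h'; apply: (has_tripleD h h') => e o.
  exact: YprodDl.
exact: YiterDl.
Qed.

Lemma has_tripleDr u v v1 w : has_triple u v w -> has_triple u v1 w ->
  has_triple u (v + v1) w.
Proof.
move=> h h'; apply: (has_tripleD h h') => e o.
  exact: YprodDr.
exact: YiterDr.
Qed.

Lemma has_triple_all u v w : has_triple u v w.
Proof.
have sgP b x : of_sign D b (sg D x b) by rewrite /of_sign (sg_proj hG) eqxx.
rewrite (sg_sum hG u) (sg_sum hG v).
by apply: has_tripleDl; apply: has_tripleDr; exact: has_triple_sign.
Qed.

End MatrixCoefficients.

Theorem proposition9p3 (R : realType) (L : option nat)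
    (V : lmodType (grass R[i] L)) (D : nsdata V) (hD : is_nsvosa D)
    (u v w : V) (v' : {scalar V}) (hv' : graded_dual D v') :
  exists f g : sfrac R[i] L,
    [/\ is_iota_inv x1 x2 (pairing v' (Yprod D u v w)) f,
        exists r s t : nat,
          f.2 = nseq r (1, 0, 0) ++ nseq s (0, 1, 0) ++ nseq t (1, - 1, - 1),
        is_iota_inv x2 x0 (pairing v' (Yiter D u v w)) g,
        exists r s t : nat,
          g.2 = nseq r (0, 1, 0) ++ nseq s (1, 0, 0) ++ nseq t (1, 1, - 1)
      & sfrac_eq x1 x2 f (subst_x0 g)].
Proof.
have char0 (n : int) : n != 0 -> (n%:~R : R[i]) != 0.
  by rewrite intr_eq0.
have [n [B [Q H]]] := has_triple_all char0 hD hv' u v w.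
have [f [g [Hf f2 Hg g2 E]]] := associativity_of_triple H.
exists f, g; split => //.
- by exists n, n, n; rewrite f2.
- by exists n, n, n.+1; rewrite g2.
Qed.
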